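(* Let $W_{\infty,1}$ and $W_{\infty,2}$ be two periodic hyperbolic weaves in $\mathbb{H}^2\times I$ with weaving diagrams $D_{\infty,1}$ and $D_{\infty,2}$ in $\mathbb{H}^2$. Let $\Lambda_1\subset\Lambda_2$ be two non-equivalent lattices such that, for $i\in\{1,2\}$, the quotient $D_{W_i}$ of $D_{\infty,i}$ by $\Lambda_i$ is a weaving motif of $D_{\infty,i}$ on the closed surface $\mathbb{H}^2/\Lambda_i$ (of genus $\geq 2$). Then $W_{\infty,1}$ and $W_{\infty,2}$ are equivalent if the following two conditions are satisfied: (i) $D_{W_1}$ and $D_{W_2}$ are scale-equivalent, through a weaving motif $D'_{W_1}$ containing $D_{W_1}$ which is made of adjacent copies of $D_{W_1}$ and is the quotient of $D_{\infty,1}$ by $\Lambda_2$; (ii) $D'_{W_1}$ and $D_{W_2}$ are related by a finite sequence of Reidemeister moves $R_1$, $R_2$, $R_3$, isotopies and Dehn twists of the surface $S_g=\mathbb{H}^2/\Lambda_2$.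
   Context: Let $I=[-1,1]$. A lattice here is a discrete group $\Lambda$ generated by translations of $\mathbb{H}^2$ whose quotient $\mathbb{H}^2/\Lambda$ is a closed orientable surface $S_g$ of genus $g\ge2$, with covering maps $\mathbb{H}^2\to S_g$ and $\mathbb{H}^2\times I\to S_g\times I$. Inclusion convention: $\Lambda\subset\Lambda'$ means that a unit cell of $\Lambda'$ is tiled by unit cells of $\Lambda$, i.e. periodicity under $\Lambda$ implies periodicity under $\Lambda'$. An essential closed curve component of a link in $S_g\times I$ lifts to infinite open curves called threads; a thread is unknotted if its projection to $\mathbb{H}^2$ has no self-crossing. The projection of the lifted link to $\mathbb{H}^2$ is required to be isotopic to a quadrivalent kaleidoscopic tiling (obtained by repeatedly reflecting a convex hyperbolic polygon $P$ with $n\ge3$ edges in its sides); if $n$ is odd each edge of $P$ gets a different direction, if $n$ is even opposite edges get the same direction, reflections transport directions, and threads belong to the same set of threads iff they have the same direction. Let $W\subset S_g\times I$ be a link each of whose components is an essential closed curve lifting to an unknotted thread, and whose components can be partitioned into $N\ge2$ sets of threads. The lift $W_\infty$ of $W$ to $\mathbb{H}^2\times I$ is a hyperbolic periodic weave; the diagram $D_W$ of $W$ on $S_g$ is a (hyperbolic) weaving motif, and its lift $D_\infty$ to $\mathbb{H}^2$ is a (hyperbolic) weaving diagram. Scale-equivalence: for $\Lambda_1\subset\Lambda_2$, a motif for $\Lambda_1$ and a motif for $\Lambda_2$ are scale-equivalent if there is a motif for $\Lambda_2$ defined by adjacent copies of the motif for $\Lambda_1$, which is the quotient by $\Lambda_2$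 of the same infinite diagram. Two hyperbolic periodic weaves are equivalent if they are ambient isotopic in the thickened hyperbolic plane $\mathbb{H}^2\times I$. *)

(* Defs.v *)
From HB Require Import structures.
From Stdlib Require Import Relation_Operators.
From mathcomp Require Import all_boot all_order all_algebra.
From mathcomp Require Import generic_quotient.
From mathcomp Require Import all_classical all_reals all_analysis.

Set Implicit Arguments.
Unset Strict Implicit.
Unset Printing Implicit Defensive.

Import Order.TTheory GRing.Theory Num.Theory.
Import numFieldNormedType.Exports.

Local Open Scope classical_set_scope.
Local Open Scope quotient_scope.
Local Open Scope ring_scope.

Definition homeomorphism (X Y : topologicalType) (f : X -> Y) : Prop :=
  continuous f /\
  exists g : Y -> X, [/\ continuous g, cancel f g & cancel g f].

Definition homeomorphic (X Y : topologicalType) : Prop :=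
  exists f : X -> Y, homeomorphism f.

Definition open_embedding (X Y : topologicalType) (e : X -> Y) : Prop :=
  [/\ continuous e, injective e & forall U, open U -> open (e @` U)].

Definition ambient_isotopy (R : realType) (X : topologicalType)
    (F : R -> X -> X) : Prop :=
  [/\ {within `[0, 1] `*` [set: X], continuous (fun p : R * X => F p.1 p.2)},
      forall t, 0 <= t <= 1 -> homeomorphism (F t)
    & F 0 = id].

(* Closed curves are 1-periodic maps from the line. *)
Definition closed_curve (R : realType) (X : topologicalType) (c : R -> X) :=
  continuous c /\ forall t, c (t + 1) = c t.

Definition null_homotopic (R : realType) (X : topologicalType)
    (c : R -> X) : Prop :=
  exists H : R -> R -> X,
    [/\ {within `[0, 1] `*` [set: R], continuous (fun p : R * R => H p.1 p.2)},
        forall s, 0 <= s <= 1 -> forall t, H s (t + 1) = H s t,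
        H 0 = c
      & exists x, forall t, H 1 t = x].

Definition essential (R : realType) (X : topologicalType) (c : R -> X) :=
  closed_curve c /\ ~ null_homotopic c.

Section Quotient.
Variables (T : choiceType) (r : T -> T -> Prop).

Definition eqv_closure : rel T := fun x y => `[< clos_refl_sym_trans T r x y >].

Fact eqv_closure_refl : reflexive eqv_closure.
Proof. by move=> x; apply/asboolP; apply: rst_refl. Qed.

Fact eqv_closure_sym : symmetric eqv_closure.
Proof. by move=> x y; apply/asboolP/asboolP => h; apply: rst_sym. Qed.

Fact eqv_closure_trans : transitive eqv_closure.
Proof.
by move=> y x z /asboolP h /asboolP k; apply/asboolP; apply: rst_trans h k.
Qed.

Canonical eqv_closure_equiv :=
  EquivRel eqv_closure eqv_closure_refl eqv_closure_sym eqv_closure_trans.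
End Quotient.

Definition quot (T : topologicalType) (r : T -> T -> Prop) :=
  quotient_topology {eq_quot (eqv_closure r)}.

Definition quot_map (T : topologicalType) (r : T -> T -> Prop) (x : T)
  : quot r := \pi_{eq_quot (eqv_closure r)} x.

(* The closed disk, with its boundary circle cut into [4 * g] equal sides, the
   sides being glued in pairs along the word [a b a^-1 b^-1] repeated [g] times. *)
Definition disk (R : realType) : set (R * R) :=
  [set p | p.1 ^+ 2 + p.2 ^+ 2 <= 1].

Definition disk_side (R : realType) (g k : nat) (s : R) : R * R :=
  let a := 2 * pi * (k%:R + s) / (4 * g)%N%:R in (cos a, sin a).

Definition gluing (R : realType) (g : nat) (x y : @disk R) : Prop :=
  exists (j : nat) (s : R), [/\ (j < g)%N, 0 <= s <= 1 &
    (set_val x = disk_side g (4 * j)%N s /\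
     set_val y = disk_side g (4 * j + 2)%N (1 - s)) \/
    (set_val x = disk_side g (4 * j + 1)%N s /\
     set_val y = disk_side g (4 * j + 3)%N (1 - s))].

Definition genus_surface (R : realType) (g : nat) := quot (@gluing R g).

(* Hyperboloid model: [(x, y)] stands for the point
   [(sqrt (1 + x^2 + y^2), x, y)] of the upper sheet of
   [- t^2 + x^2 + y^2 = -1], so that the carrier is all of [R * R].
   Isometries are the Lorentz matrices preserving the upper sheet, those of
   determinant 1 being the orientation-preserving ones; geodesics are the
   sections of the sheet by planes through the origin. *)
Notation hplane R := (R * R)%type.

Section Hyperbolic.
Variable R : realType.
Implicit Types (A : 'M[R]_3) (L T : set 'M[R]_3).

Definition sheet (p : hplane R) : 'cV[R]_3 :=
  \col_i [:: Num.sqrt (1 + p.1 ^+ 2 + p.2 ^+ 2); p.1; p.2]`_i.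

Definition lorentz_form : 'M[R]_3 := diag_mx (\row_i [:: -1; 1; 1]`_i).

Definition mink (u v : 'cV[R]_3) : R := (u^T *m lorentz_form *m v) 0 0.

Definition isometry A : Prop :=
  A^T *m lorentz_form *m A = lorentz_form /\ 0 < A 0 0.

Definition act A (p : hplane R) : hplane R :=
  let u := A *m sheet p in (u 1 0, u 2 0).

Definition geodesic (p v : 'cV[R]_3) (s : R) : 'cV[R]_3 :=
  ((expR s + expR (- s)) / 2) *: p + ((expR s - expR (- s)) / 2) *: v.

Definition translation A : Prop :=
  [/\ isometry A, \det A = 1 &
      exists p v l, [/\ mink p p = -1, mink v v = 1, mink p v = 0, l != 0 &
        forall s, A *m geodesic p v s = geodesic p v (s + l)]].

Inductive generated T : set 'M[R]_3 :=
| gen_in A : T A -> generated T A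
| gen_one : generated T 1%:M
| gen_mul A B : generated T A -> generated T B -> generated T (A *m B)
| gen_inv A : generated T A -> generated T (invmx A).

Definition orbit_rel L (p q : hplane R) : Prop := exists2 A, L A & q = act A p.

Definition surface L := quot (orbit_rel L).

Definition cover L : hplane R -> surface L := @quot_map _ (orbit_rel L).

Definition lattice L : Prop :=
  [/\ exists2 T, T `<=` translation & L = generated T,
      \forall A \near (1%:M : 'M[R]_3), L A -> A = 1%:M,
      forall p, exists2 U, open_nbhs p U &
        forall A, L A -> A <> 1%:M -> act A @` U `&` U = set0
    & exists2 g, (2 <= g)%N & homeomorphic (surface L) (genus_surface R g)].

(* [lattice_sub L1 L2] is the inclusion of [L1] in [L2] in the sense of
   crystallography: periodicity under [L1] implies periodicity under [L2].
   As groups of isometries the inclusion goes the other way. *)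
Definition lattice_sub L1 L2 : Prop := L2 `<=` L1.

Definition unit_cell L (C : set (hplane R)) : Prop :=
  [/\ compact C, connected C, C `<=` closure (interior C),
      \bigcup_(A in L) (act A @` C) = setT
    & forall A, L A -> A <> 1%:M ->
        (act A @` interior C) `&` interior C = set0].

(* The sign tells on which side of the oriented line [a b] the point [c] lies. *)
Definition orient (a b c : hplane R) : R :=
  \det (\matrix_(i < 3, j < 3) sheet (nth a [:: a; b; c] j) i 0).

Section Polygon.
Variables (n : nat) (v : 'I_n -> hplane R).

(* The vertices are listed in counterclockwise order. *)
Definition convex_polygon : Prop := (3 <= n)%N /\
  forall i k, k != i -> k != ordS i -> 0 < orient (v i) (v (ordS i)) (v k).

Definition polygon : set (hplane R) :=
  [set p | forall i, 0 <= orient (v i) (v (ordS i)) p].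

Definition polygon_interior : set (hplane R) :=
  [set p | forall i, 0 < orient (v i) (v (ordS i)) p].

Definition edge (i : 'I_n) : set (hplane R) :=
  [set p | polygon p /\ orient (v i) (v (ordS i)) p = 0].

Definition side_reflection : set 'M[R]_3 :=
  [set A | [/\ isometry A, \det A = -1 &
    exists i, act A (v i) = v i /\ act A (v (ordS i)) = v (ordS i)]].

Definition reflection_group := generated side_reflection.

Definition kaleidoscopic_tiling : Prop :=
  [/\ convex_polygon,
      \bigcup_(A in reflection_group) (act A @` polygon) = setT
    & forall A B, reflection_group A -> reflection_group B ->
        act A @` polygon_interior `&` act B @` polygon_interior !=set0 ->
        act A @` polygon = act B @` polygon].

Definition tiling_edges : set (set (hplane R)) :=
  [set E | exists A i, reflection_group A /\ E = act A @` edge i].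

Definition quadrivalent : Prop :=
  forall A i, reflection_group A ->
    ([set E | tiling_edges E /\ E (act A (v i))] #= `I_4)%card.

(* Opposite edges [i] and [i + n/2] share their direction when [n] is even. *)
Definition direction (i : 'I_n) : nat := if odd n then val i else (i %% n./2)%N.

End Polygon.

End Hyperbolic.

Definition II (R : realType) : Type := `[(-1 : R), 1]%classic.

Section Weaves.
Variable R : realType.
Implicit Types (L : set 'M[R]_3) (W : set (hplane R * II R)).

Definition height (X : Type) (p : X * II R) : R := set_val p.2.

(* A link is an embedding of finitely many circles in the interior of [X * I]. *)
Definition link (X : topologicalType) (m : nat) (c : 'I_m -> R -> X * II R) :=
  [/\ forall i, closed_curve (c i),
      forall i s j t, c i s = c j t <->
        i = j /\ exists k : int, s = t + k%:~R
    & forall i t, -1 < height (c i t) < 1].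

Definition cover3 L (p : hplane R * II R) : surface L * II R :=
  (cover L p.1, p.2).

Definition thread L (c : R -> surface L * II R) (tau : R -> hplane R * II R) :=
  continuous tau /\ cover3 L \o tau = c.

Definition unknotted (tau : R -> hplane R * II R) : Prop :=
  injective (fst \o tau).

(* Having the same direction is expressed through the edges of the tiling that
   the threads run along once the projection has been carried onto the tiling
   by the isotopy [F]. *)
Definition weave_link L (W : set (surface L * II R)) : Prop :=
  exists (m : nat) (c : 'I_m -> R -> surface L * II R),
  [/\ link c,
      W = \bigcup_i range (c i),
      forall i, essential (c i),
      forall i tau, thread (c i) tau -> unknotted tau
    & exists (n : nat) (v : 'I_n -> hplane R) (F : R -> hplane R -> hplane R)
             (N : nat) (family : 'I_m -> 'I_N),
      [/\ kaleidoscopic_tiling v /\ quadrivalent v,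
          ambient_isotopy F /\
            F 1 @` (fst @` (cover3 L @^-1` W)) =
            \bigcup_(E in tiling_edges v) E,
          (2 <= N)%N,
          forall k, exists i, family i = k
        & forall i i' tau tau' A A' j j',
            thread (c i) tau -> thread (c i') tau' ->
            reflection_group v A -> reflection_group v A' ->
            act A @` edge v j `<=` F 1 @` range (fst \o tau) ->
            act A' @` edge v j' `<=` F 1 @` range (fst \o tau') ->
            family i = family i' <-> direction j = direction j']].

Definition weave_equivalent (W W' : set (hplane R * II R)) : Prop :=
  exists F : R -> hplane R * II R -> hplane R * II R,
    ambient_isotopy F /\ F 1 @` W = W'.

End Weaves.

(* [dset] is the underlying curve, with its crossings seen as mere double
   points; [dover c] is the strand that passes over at the crossing [c]. Only
   the germ of [dover c] at [c], for [c] a crossing, is meaningful. *)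
Record diagram (X : Type) := Diagram { dset : set X; dover : X -> set X }.

Definition dpull (X Y : Type) (f : X -> Y) (D : diagram Y) : diagram X :=
  Diagram (f @^-1` dset D) (fun c => f @^-1` dover D (f c)).

Section Diagrams.
Variables (R : realType) (X : topologicalType).
Implicit Types D : diagram X.

Definition simple_point D (x : X) : Prop :=
  exists e : R * R -> X, [/\ open_embedding e, e (0, 0) = x &
    forall u, dset D (e u) <-> u.2 = 0].

Definition crossing D (x : X) : Prop :=
  exists e : R * R -> X, [/\ open_embedding e, e (0, 0) = x &
    forall u, (dset D (e u) <-> u.1 * u.2 = 0) /\
              (dover D x (e u) <-> u.2 = 0)].

Definition is_diagram D : Prop :=
  closed (dset D) /\ forall x, dset D x -> simple_point D x \/ crossing D x.

Definition deq_on (B : set X) D D' : Prop :=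
  forall x, B x -> (dset D x <-> dset D' x) /\
    (crossing D x -> \forall y \near x, dover D x y <-> dover D' x y).

Definition deq D D' : Prop := deq_on setT D D'.

Definition diagram_of (W : set (X * II R)) D : Prop :=
  [/\ is_diagram D,
      dset D = fst @` W,
      forall x, simple_point D x -> exists! z, W (x, z)
    & forall x, crossing D x -> exists z1 z2 : II R,
      [/\ set_val z1 < set_val z2,
          forall z, W (x, z) <-> z = z1 \/ z = z2,
          \forall p \near (x, z2), W p -> dover D x p.1
        & \forall p \near (x, z1), W p -> dover D x p.1 -> p.1 = x]].

End Diagrams.

Arguments crossing R {X} D x.
Arguments is_diagram R {X} D.
Arguments deq_on R {X} B D D'.
Arguments deq R {X} D D'.

Section Models.
Variable R : realType.
Local Notation plane := (R * R)%type.

(* The diagram in the plane made of superposed strands, the topmost first. *)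
Fixpoint top_strand (s : seq (set plane)) (c : plane) : set plane :=
  if s is a :: s' then
    [set p | (a c /\ a p) \/ (~ a c /\ top_strand s' c p)]
  else set0.

Definition layers (s : seq (set plane)) : diagram plane :=
  Diagram (foldr setU set0 s) (top_strand s).

Definition hline (a : R) : set plane := [set p | p.2 = a].
Definition diag1 : set plane := [set p | p.2 = p.1].
Definition diag2 : set plane := [set p | p.2 = - p.1].

(* The line [y = a], pushed to the height [y = b] for [|x| <= w]. *)
Definition bump (a b w : R) : set plane :=
  [set p | [\/ w <= `|p.1| /\ p.2 = a,
               `|p.1| = w /\ (p.2 - a) * (p.2 - b) <= 0
             | `|p.1| <= w /\ p.2 = b]].

(* The kink follows the polygonal line through (-oo,0), (1,0), (1,1), (0,1),
   (0,-1), (2,-1), (2,0), (+oo,0), which crosses itself at (0,0); [kink_in] is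
   its piece from (0,1) to (0,-1) and [kink_out] is the rest. *)
Definition kink_in : set plane := [set p | p.1 = 0 /\ -1 <= p.2 <= 1].
Definition kink_out : set plane :=
  [set p | (p.2 = 0 /\ (p.1 <= 1 \/ 2 <= p.1)) \/
    [\/ p.1 = 1 /\ 0 <= p.2 <= 1, p.2 = 1 /\ 0 <= p.1 <= 1,
        p.2 = -1 /\ 0 <= p.1 <= 2 | p.1 = 2 /\ -1 <= p.2 <= 0]].

(* Local pictures of the moves, which agree outside the box [|x|, |y| <= 3].
   The other variants are obtained from these by a change of chart, for
   instance by [(x, y) |-> (- x, y)], which exchanges [diag1] and [diag2]. *)
Inductive reidemeister_model : diagram plane -> diagram plane -> Prop :=
| R1_in :
    reidemeister_model (layers [:: hline 0]) (layers [:: kink_in; kink_out])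
| R1_out :
    reidemeister_model (layers [:: hline 0]) (layers [:: kink_out; kink_in])
| R2_over :
    reidemeister_model (layers [:: hline 1; hline 0])
                       (layers [:: bump 1 (-1) 1; hline 0])
| R2_under :
    reidemeister_model (layers [:: hline 0; hline 1])
                       (layers [:: hline 0; bump 1 (-1) 1])
| R3_top :
    reidemeister_model (layers [:: bump 0 1 3; diag1; diag2])
                       (layers [:: bump 0 (-1) 3; diag1; diag2])
| R3_middle :
    reidemeister_model (layers [:: diag1; bump 0 1 3; diag2])
                       (layers [:: diag1; bump 0 (-1) 3; diag2])
| R3_bottom :
    reidemeister_model (layers [:: diag1; diag2; bump 0 1 3])
                       (layers [:: diag1; diag2; bump 0 (-1) 3]).

Definition box : set plane := [set p | `|p.1| <= 3 /\ `|p.2| <= 3].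

Variable X : topologicalType.
Implicit Types D : diagram X.

Definition reidemeister_move D D' : Prop :=
  exists (e : plane -> X) (M M' : diagram plane),
    [/\ open_embedding e, reidemeister_model M M',
        deq R (dpull e D) M, deq R (dpull e D') M'
      & deq_on R (~` (e @` box)) D D'].

Definition isotopy_move D D' : Prop :=
  exists F : R -> X -> X, ambient_isotopy F /\ deq R D (dpull (F 1) D').

(* [a] parametrizes an open annulus by [(theta, r)], with [theta] modulo 1; the
   twist is supported in the closed annulus [0 <= r <= 1]. *)
Definition dehn_twist (h : X -> X) : Prop :=
  exists a : plane -> X,
    [/\ continuous a, forall U, open U -> open (a @` U),
        forall u w, a u = a w <->
          u.2 = w.2 /\ exists k : int, u.1 = w.1 + k%:~R
      & homeomorphism h /\
        (forall u, h (a u) = a (u.1 + Num.max 0 (Num.min 1 u.2), u.2)) /\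
        (forall x, ~ range a x -> h x = x)].

Definition dehn_move D D' : Prop :=
  exists h : X -> X, dehn_twist h /\ deq R D (dpull h D').

Definition move D D' : Prop :=
  [/\ is_diagram R D, is_diagram R D' &
    [\/ reidemeister_move D D', isotopy_move D D' | dehn_move D D']].

Definition related_by_moves := clos_refl_sym_trans (diagram X) move.

End Models.

Arguments related_by_moves R {X} _ _.

Section Motifs.
Variable R : realType.
Implicit Types L : set 'M[R]_3.

Definition weaving_motif L (D : diagram (surface L)) : Prop :=
  exists2 W, weave_link W & diagram_of W D.

Definition quotient_diagram L (Dinf : diagram (hplane R))
    (D : diagram (surface L)) : Prop :=
  deq R Dinf (dpull (cover L) D).

Definition weaving_diagram (Winf : set (hplane R * II R))
    (Dinf : diagram (hplane R)) : Prop :=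
  exists L (W : set (surface L * II R)) (D : diagram (surface L)),
    [/\ lattice L, weave_link W, Winf = cover3 L @^-1` W,
        diagram_of W D & is_diagram R Dinf /\ quotient_diagram Dinf D].

(* Some unit cell of [L2] is a union of unit cells of [L1], each of which
   carries in [D2] a copy of [D1]. *)
Definition adjacent_copies L1 L2 (D1 : diagram (surface L1))
    (D2 : diagram (surface L2)) : Prop :=
  exists (C : set (hplane R)) (s : seq 'M[R]_3),
    [/\ unit_cell L1 C,
        [set` s] `<=` L1,
        unit_cell L2 (\bigcup_(A in [set` s]) (act A @` C))
      & forall A, A \in s ->
          deq_on R C (dpull (cover L1) D1) (dpull (cover L2 \o act A) D2)].

Definition scale_equivalent_via L1 L2 (Dinf : diagram (hplane R))
    (D1 : diagram (surface L1)) (D2 : diagram (surface L2)) : Prop :=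
  [/\ weaving_motif D2, adjacent_copies D1 D2,
      quotient_diagram Dinf D1 & quotient_diagram Dinf D2].

End Motifs.

(* Main.v *)
Require Import Defs.
From HB Require Import structures.
From Stdlib Require Import Relation_Operators.
From mathcomp Require Import all_boot all_order all_algebra.
From mathcomp Require Import generic_quotient.
From mathcomp Require Import all_classical all_reals all_analysis.
From mathcomp Require Import ring lra.

Set Implicit Arguments.
Unset Strict Implicit.
Unset Printing Implicit Defensive.

Import Order.TTheory GRing.Theory Num.Theory.
Import numFieldNormedType.Exports.

Local Open Scope classical_set_scope.
Local Open Scope quotient_scope.
Local Open Scope ring_scope.

(* A diagram determines the link it represents up to a vertical isotopy: over each
   point of the plane the heights of two links with the same diagram are matched by
   an increasing map of the line, the admissible maps form a convex set, and a
   partition of unity gives a continuous choice. It remains to follow the moves on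
   the quotient surface. An isotopy of the surface thickens and lifts to the plane.
   A Dehn twist is the identity near some point, hence has a lift that is the
   identity near a point of the plane, and this lift is isotopic to the identity by
   Alexander's trick. For a Reidemeister move, a vertical isotopy makes the link
   agree over the chart with a model tangle, which is carried onto the model tangle
   of the other side by a compactly supported composite of shears; this isotopy of
   the thickened surface lifts to the thickened plane. *)


(** A Dehn twist is in general not isotopic to the identity on the surface, so along the moves two
    links are compared only through their pullbacks to the plane. This is why isotopies downstairs
    are lifted, by homotopy lifting for coverings, and why the lift of a twist is wanted together
    with a point near which it is the identity: rescaling about that point then tends to the
    identity. Diagrams are purely topological, a crossing being a chart onto two axes. Links are
    therefore handled as closed sets instead of parametrized curves; strands have continuous heights
    because these range in a compact interval, and the intermediate value theorem replaces
    differential arguments when simple points are told from crossings. The partition of unity lives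
    on the plane only: it compares two links over the same infinite diagram, whatever lattices they
    come from, and it works inside a chart, whose domain is the whole plane. The tangle isotopies
    are made of shears along the axes, because a continuous shear is a homeomorphism as soon as it
    is increasing with bounded displacement on each line of its direction. *)

Section ContinuityRules.
Variables (R : realType) (T : topologicalType).
Implicit Types f g : T -> R.

Lemma cont_cst (U : topologicalType) (c : U) : continuous (fun _ : T => c).
Proof. by move=> x; apply: cvg_cst. Qed.

Lemma cont_id : continuous (fun x : T => x).
Proof. by move=> x A. Qed.

Lemma cont_comp (U V : topologicalType) (f : U -> V) (g : T -> U) :
  continuous f -> continuous g -> continuous (fun x => f (g x)).
Proof. by move=> cf cg x; apply: continuous_comp; [apply: cg|apply: cf]. Qed.

Lemma cont_pair (U V : topologicalType) (f : T -> U) (g : T -> V) :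
  continuous f -> continuous g -> continuous (fun x => (f x, g x)).
Proof. by move=> cf cg x; apply: cvg_pair; [apply: cf|apply: cg]. Qed.

Lemma cont_fst (U V : topologicalType) (f : T -> U * V) :
  continuous f -> continuous (fun x => (f x).1).
Proof. move=> cf; apply: cont_comp cf => x; exact: cvg_fst. Qed.

Lemma cont_snd (U V : topologicalType) (f : T -> U * V) :
  continuous f -> continuous (fun x => (f x).2).
Proof. move=> cf; apply: cont_comp cf => x; exact: cvg_snd. Qed.

Lemma cont_add f g :
  continuous f -> continuous g -> continuous (fun x => f x + g x).
Proof. by move=> cf cg x; apply: continuousD; [apply: cf|apply: cg]. Qed.

Lemma cont_opp f : continuous f -> continuous (fun x => - f x).
Proof. by move=> cf x; apply: continuousN; apply: cf. Qed.

Lemma cont_mul f g :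
  continuous f -> continuous g -> continuous (fun x => f x * g x).
Proof. by move=> cf cg x; apply: continuousM; [apply: cf|apply: cg]. Qed.

Lemma cont_inv f : (forall x, f x != 0) -> continuous f ->
  continuous (fun x => (f x)^-1).
Proof. by move=> f0 cf x; apply: continuousV; [apply: f0|apply: cf]. Qed.

Lemma cont_max f g :
  continuous f -> continuous g -> continuous (fun x => Num.max (f x) (g x)).
Proof. by move=> cf cg x; apply: continuous_max; [apply: cf|apply: cg]. Qed.

Lemma cont_min f g :
  continuous f -> continuous g -> continuous (fun x => Num.min (f x) (g x)).
Proof. by move=> cf cg x; apply: continuous_min; [apply: cf|apply: cg]. Qed.

Lemma cont_norm f : continuous f -> continuous (fun x => `|f x|).
Proof. by move=> cf; apply: cont_comp cf => x; apply: norm_continuous. Qed.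

End ContinuityRules.

Lemma contP (X Y : topologicalType) (f : X -> Y) :
  (forall x A, nbhs (f x) A -> nbhs x [set y | A (f y)]) -> continuous f.
Proof. by move=> h x A /h. Qed.

Lemma cont_nbhs (X Y : topologicalType) (f : X -> Y) x A :
  {for x, continuous f} -> nbhs (f x) A -> nbhs x [set y | A (f y)].
Proof. by move=> cf /cf. Qed.

Section Clamp.
Variable R : realType.
Definition clamp (a b x : R) := Num.max a (Num.min b x).

Lemma cont_clamp (T : topologicalType) a b (f : T -> R) :
  continuous f -> continuous (fun x => clamp a b (f x)).
Proof. by move=> cf; apply: cont_max; [apply: cont_cst|apply: cont_min => //; apply: cont_cst]. Qed.

End Clamp.

(** The cases without a binder catch eta-contracted functions; the last one applies only when the
    body does not mention the variable. *)
Ltac ct1 := lazymatch goal with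
  | |- continuous (fun x => (@?f x, @?g x)) => apply: cont_pair
  | |- continuous (fun x => GRing.add (@?f x) (@?g x)) => apply: cont_add
  | |- continuous (fun x => GRing.mul (@?f x) (@?g x)) => apply: cont_mul
  | |- continuous (fun x => GRing.opp (@?f x)) => apply: cont_opp
  | |- continuous (fun x => Num.max (@?f x) (@?g x)) => apply: cont_max
  | |- continuous (fun x => Num.min (@?f x) (@?g x)) => apply: cont_min
  | |- continuous (fun x => Num.norm (@?f x)) => apply: cont_norm
  | |- continuous (fun x => clamp _ _ (@?f x)) => apply: cont_clamp
  | |- continuous (fun x => x) => apply: cont_id
  | |- continuous (fun x => fst (@?f x)) => apply: cont_fst
  | |- continuous (fun x => snd (@?f x)) => apply: cont_snd
  | |- continuous fst => move=> ?; apply: cvg_fst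
  | |- continuous snd => move=> ?; apply: cvg_snd
  | |- continuous (pair ?c) => apply: (cont_pair (@cont_cst _ _ _) (@cont_id _))
  | |- continuous Num.norm => move=> ?; apply: norm_continuous
  | |- continuous (GRing.add ?c) => apply: (cont_add (@cont_cst _ _ _) (@cont_id _))
  | |- continuous (GRing.mul ?c) => apply: (cont_mul (@cont_cst _ _ _) (@cont_id _))
  | |- continuous GRing.opp => apply: (cont_opp (@cont_id _))
  | |- continuous id => apply: cont_id
  | |- continuous (fun x => ?c) => apply: cont_cst
  end.

Ltac ct := repeat first [ ct1 | assumption ].

Section Plane.
Variable R : realType.
Implicit Types u v : R * R.

Lemma nbhs_lineP (x : R) (A : set R) :
  nbhs x A <-> exists2 e, 0 < e & forall y, `|y - x| < e -> A y.
Proof.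
split=> [/nbhs_ballP[e e0 eA]|[e e0 eA]].
  by exists e => // y yx; apply: eA; rewrite /ball/= distrC.
by apply/nbhs_ballP; exists e => // y; rewrite /ball/= distrC; apply: eA.
Qed.

Lemma nbhs_planeP u (A : set (R * R)) :
  nbhs u A <->
  exists2 e, 0 < e &
    forall v, `|v.1 - u.1| < e -> `|v.2 - u.2| < e -> A v.
Proof.
split=> [/nbhs_ballP[e e0 eA]|[e e0 eA]].
  by exists e => // v v1 v2; apply: eA; split; rewrite /ball/= distrC.
apply/nbhs_ballP; exists e => // v [] /=; rewrite /ball/= !(distrC u.1, distrC u.2).
exact: eA.
Qed.

End Plane.

Section Homeo.
Variables X Y Z : topologicalType.

Lemma homeo_inv (f : X -> Y) : homeomorphism f ->
  exists2 g : Y -> X, homeomorphism g & cancel f g /\ cancel g f.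
Proof. by move=> [cf [g [cg fg gf]]]; exists g => //; split=> //; exists f. Qed.

Lemma homeo_comp (f : X -> Y) (g : Y -> Z) :
  homeomorphism f -> homeomorphism g -> homeomorphism (fun x => g (f x)).
Proof.
move=> [cf [f' [cf' ff' f'f]]] [cg [g' [cg' gg' g'g]]]; split.
  exact: cont_comp.
exists (fun z => f' (g' z)); split; first exact: cont_comp.
  by move=> x; rewrite gg' ff'.
by move=> x; rewrite f'f g'g.
Qed.

Lemma homeo_id : homeomorphism (fun x : X => x).
Proof. by split; [ct|exists id; split=> //; ct]. Qed.

Definition open_map (f : X -> Y) :=
  forall x A, nbhs x A -> nbhs (f x) (f @` A).

Definition local_homeo (f : X -> Y) :=
  [/\ continuous f, open_map f &
      forall x, exists2 U, open_nbhs x U & {in U &, injective f}].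

Lemma open_mapP (f : X -> Y) :
  open_map f <-> forall U, open U -> open (f @` U).
Proof.
split=> [fo U oU|fo x A].
  rewrite openE => _ [x Ux <-]; apply: (filterS _ (fo x U _)) => //.
  exact: open_nbhs_nbhs.
rewrite nbhsE => -[U [oU Ux] UA]; rewrite nbhsE.
exists (f @` U); last by move=> _ [y /UA Ay <-]; exists y.
by split; [apply: fo|exists x].
Qed.

Lemma homeo_embed (f : X -> Y) : homeomorphism f -> open_embedding f.
Proof.
move=> [cf [g [cg fg gf]]]; split=> //; first exact: can_inj fg.
move=> U oU; have -> : f @` U = g @^-1` U.
  by apply/seteqP; split=> [_ [x Ux <-]|y Uy]; [rewrite /= fg|exists (g y)].
by apply: open_comp => // y _; apply: cg.
Qed.

Lemma embed_local (f : X -> Y) : open_embedding f -> local_homeo f.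
Proof.
move=> [cf fi fo]; split=> //; first exact/open_mapP.
by move=> x; exists setT; [split=> //; exact: openT|move=> a b _ _; apply: fi].
Qed.

Lemma embed_comp (f : X -> Y) (g : Y -> Z) :
  open_embedding f -> open_embedding g -> open_embedding (fun x => g (f x)).
Proof.
move=> [cf fi fo] [cg gi go]; split; first exact: cont_comp.
  by move=> a b /gi /fi.
by move=> U /fo /go; rewrite image_comp.
Qed.

Lemma open_map_cont (f : X -> Y) (g : Y -> Z) x :
  open_map f -> {for x, continuous (fun x => g (f x))} ->
  {for f x, continuous g}.
Proof.
move=> fo cgf A /cgf /= /(fo x); apply: filterS => _ [y Ay <-] //.
Qed.

Lemma near_cont (f g : X -> Y) x :
  (\forall y \near x, f y = g y) -> {for x, continuous g} ->
  {for x, continuous f}.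
Proof.
move=> fg cg A; rewrite /= (nbhs_singleton fg) => /cg gA.
by rewrite /=; apply: filterS2 fg gA => y; rewrite /= => ->.
Qed.

End Homeo.

Lemma open_map_prod (X Y Z T : topologicalType) (f : X -> Y) (g : Z -> T) :
  open_map f -> open_map g -> open_map (fun p : X * Z => (f p.1, g p.2)).
Proof.
move=> fo go [x z] A [[B C] /= [xB zC] BCA].
exists (f @` B, g @` C); first by split; [apply: fo|apply: go].
by move=> [_ _] /= [[a Ba <-] [c Cc <-]]; exists (a, c) => //; apply: BCA.
Qed.

Lemma open_map_id (X : topologicalType) : open_map (fun x : X => x).
Proof. by move=> x A; rewrite image_id. Qed.

Lemma open_map_comp (X Y Z : topologicalType) (f : X -> Y) (g : Y -> Z) :
  open_map f -> open_map g -> open_map (fun x => g (f x)).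
Proof. by move=> fo go x A /fo /go; rewrite image_comp. Qed.

(** * Increasing maps of the line *)

Section MonotoneLine.
Variable R : realType.

Lemma incr_open_map (f : R -> R) :
  continuous f -> {homo f : x y / x < y} -> open_map f.
Proof.
move=> cf fi x A /nbhs_lineP[e e0 eA].
have e20 : 0 < e / 2 by rewrite divr_gt0.
pose a := f (x - e / 2); pose b := f (x + e / 2).
have ax : a < f x by apply: fi; lra.
have xb : f x < b by apply: fi; lra.
apply/nbhs_lineP; exists (Num.min (f x - a) (b - f x)).
  by rewrite lt_min !subr_gt0 ax.
move=> y; rewrite lt_min !ltr_norml => /andP[/andP[h1 h2] /andP[h3 h4]].
have [|||c] := @IVT R f (x - e / 2) (x + e / 2) y.
- lra.
- exact: continuous_subspaceT.
- by rewrite -/a -/b ge_min le_max; apply/andP; split; apply/orP; [left|right]; lra.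
rewrite in_itv /= => /andP[c1 c2] <-; exists c => //; apply: eA.
rewrite ltr_norml; apply/andP; split; lra.
Qed.

(* A continuous family of increasing bijections of the line has a continuous
   family of inverses: [s - e < n p y < s + e] says [m p (s - e) < y < m p (s + e)]. *)
Lemma monotone_homeo (Q : topologicalType) (m : Q -> R -> R) :
  continuous (fun p : Q * R => m p.1 p.2) ->
  (forall q, {homo m q : x y / x < y}) ->
  (forall q y, exists x, m q x = y) ->
  homeomorphism (fun p : Q * R => (p.1, m p.1 p.2)).
Proof.
move=> cm mi ms; split; first by ct.
have [n nE] : exists n : Q -> R -> R, forall q y, m q (n q y) = y.
  have h (p : Q * R) : exists x, m p.1 x = p.2 by apply: ms.
  by have [n nP] := choice h; exists (fun q y => n (q, y)) => q y; apply: (nP (q, y)).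
have mle q : {mono m q : x y / x <= y} by apply: le_mono; apply: mi.
have mlt q : {mono m q : x y / x < y} by apply: leW_mono; apply: mle.
have nK q x : n q (m q x) = x.
  by apply/le_anti; rewrite -[X in X && _](mle q) -[X in _ && X](mle q) nE lexx.
exists (fun p => (p.1, n p.1 p.2)); split; last 2 first.
- by move=> [q x] /=; rewrite nK.
- by move=> [q x] /=; rewrite nE.
apply: cont_pair; first by ct.
apply: contP => -[q0 y0] A /= /nbhs_lineP[e e0 eA].
have e20 : 0 < e / 2 by rewrite divr_gt0.
pose s := n q0 y0.
have c1 : continuous (fun p : Q * R => m p.1 (s - e / 2) - p.2).
  by ct; apply: (@cont_comp _ _ _ (fun p : Q * R => m p.1 p.2) (fun p : Q * R => (p.1, s - e / 2))) => //; ct.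
have c2 : continuous (fun p : Q * R => m p.1 (s + e / 2) - p.2).
  by ct; apply: (@cont_comp _ _ _ (fun p : Q * R => m p.1 p.2) (fun p : Q * R => (p.1, s + e / 2))) => //; ct.
have h1 : \forall p \near (q0, y0), m p.1 (s - e / 2) - p.2 < 0.
  apply: (c1 (q0, y0) [set t | t < 0]); apply: open_nbhs_nbhs; split; first exact: open_lt.
  by rewrite /= subr_lt0 -[X in _ < X](nE q0 y0) mlt; rewrite /s; lra.
have h2 : \forall p \near (q0, y0), 0 < m p.1 (s + e / 2) - p.2.
  apply: (c2 (q0, y0) [set t | 0 < t]); apply: open_nbhs_nbhs; split; first exact: open_gt.
  by rewrite /= subr_gt0 -[X in X < _](nE q0 y0) mlt; rewrite /s; lra.
near=> p; apply: eA; rewrite -/s.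
have : m p.1 (s - e / 2) < p.2 by rewrite -subr_lt0; near: p.
have : p.2 < m p.1 (s + e / 2) by rewrite -subr_gt0; near: p.
rewrite -{1 2}[p.2](nE p.1) !mlt ltr_norml => a b; apply/andP; split; lra.
Unshelve. all: by end_near. Qed.

(** Bounded displacement puts [y] between the values at [y - C] and [y + C]. *)
Lemma incr_surj (m : R -> R) (C : R) :
  continuous m -> (forall x, `|m x - x| <= C) -> forall y, exists x, m x = y.
Proof.
move=> cm mC y.
have C0 : 0 <= C by apply: le_trans (mC 0).
have [|||c _ <-] := @IVT R m (y - C) (y + C) y; last by exists c.
- lra.
- exact: continuous_subspaceT.
have := mC (y - C); have := mC (y + C); rewrite !ler_norml => /andP[a b] /andP[c d].
by rewrite ge_min le_max; apply/andP; split; apply/orP; [left|right]; lra.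
Qed.

End MonotoneLine.

(** * Charts of diagrams *)

Section Charts.
Variable R : realType.
Local Notation plane := (R * R)%type.

(** An increasing homeomorphism of the line onto []-d, d[] that vanishes only at 0. Precomposing a
    chart with it shrinks the image while the domain stays the whole plane and the axes are
    preserved. *)
Definition squeeze1 (d x : R) : R := d * (x / (1 + `|x|)).

Lemma squeeze1_den (x : R) : 0 < 1 + `|x|.
Proof. by rewrite ltr_pwDl. Qed.

Lemma cont_squeeze1 d : continuous (squeeze1 d).
Proof.
change (continuous (fun x : R => d * (x * (1 + `|x|)^-1))); ct.
by apply: cont_inv => [x|]; [rewrite gt_eqF ?squeeze1_den|ct].
Qed.

Lemma squeeze1_incr d : 0 < d -> {homo squeeze1 d : x y / x < y}.
Proof.
move=> d0 x y xy; rewrite /squeeze1 ltr_pM2l // ltr_pdivrMr ?squeeze1_den //.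
rewrite mulrAC ltr_pdivlMr ?squeeze1_den //.
have [hx|hx] := lerP 0 x; have [hy|hy] := lerP 0 y;
  rewrite ?(ger0_norm hx) ?(ger0_norm hy) ?(ltr0_norm hx) ?(ltr0_norm hy); nra.
Qed.

Lemma squeeze1_lt d x : 0 < d -> `|squeeze1 d x| < d.
Proof.
move=> d0; rewrite /squeeze1 !normrM normfV (gtr0_norm d0).
rewrite (gtr0_norm (squeeze1_den x)) -[X in _ < X]mulr1 ltr_pM2l //.
by rewrite ltr_pdivrMr ?squeeze1_den // mul1r ltrDr.
Qed.

Lemma squeeze1_eq0 d x : 0 < d -> (squeeze1 d x = 0) <-> (x = 0).
Proof.
move=> d0; split=> [/eqP|->]; last by rewrite /squeeze1 mul0r mulr0.
by rewrite !mulf_eq0 invr_eq0 (gt_eqF d0) (gt_eqF (squeeze1_den x)) orbF => /eqP.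
Qed.

Definition squeeze (d : R) (u : plane) : plane :=
  (squeeze1 d u.1, squeeze1 d u.2).

Lemma squeeze0 d : 0 < d -> squeeze d (0, 0) = (0, 0).
Proof. by move=> d0; congr (_, _); apply/squeeze1_eq0. Qed.

Lemma squeeze_embed d : 0 < d -> open_embedding (squeeze d).
Proof.
move=> d0.
have inj1 : injective (squeeze1 d).
  by apply: inc_inj; apply: le_mono; apply: squeeze1_incr.
split.
- by apply: cont_pair; apply: (cont_comp (@cont_squeeze1 d)); ct.
- by move=> [a b] [a' b'] [/inj1 -> /inj1 ->].
- apply/open_mapP; apply: open_map_prod; apply: incr_open_map;
    by [apply: cont_squeeze1|apply: squeeze1_incr].
Qed.

Lemma chart_shrink (X : topologicalType) (c : plane -> X) (O : set X) :
  continuous c -> nbhs (c (0, 0)) O ->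
  exists2 d, 0 < d & forall u, O (c (squeeze d u)).
Proof.
move=> cc /(cc (0, 0)) /nbhs_planeP[d d0 dO]; exists d => // u.
by apply: dO; rewrite /= subr0 squeeze1_lt.
Qed.

Lemma squeeze2_eq0 d u : 0 < d -> (squeeze d u).2 = 0 <-> u.2 = 0.
Proof. exact: squeeze1_eq0. Qed.

Lemma squeeze12_eq0 d u : 0 < d ->
  (squeeze d u).1 * (squeeze d u).2 = 0 <-> u.1 * u.2 = 0.
Proof.
move=> d0; split=> /eqP; rewrite mulf_eq0 => /orP[] /eqP.
- by move/(squeeze1_eq0 _ d0) => ->; rewrite mul0r.
- by move/(squeeze1_eq0 _ d0) => ->; rewrite mulr0.
- by move/(squeeze1_eq0 _ d0) => /= ->; rewrite mul0r.
- by move/(squeeze1_eq0 _ d0) => /= ->; rewrite mulr0.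
Qed.

Section LocalHomeo.
Variables (X Y : topologicalType) (f : Y -> X).
Hypothesis lf : local_homeo f.

(** A local homeomorphism need not be injective on the image of [e]; the chart is shrunk into a
    neighbourhood where it is. *)
Lemma chart_push (e : plane -> Y) : open_embedding e ->
  exists2 d, 0 < d & open_embedding (fun u => f (e (squeeze d u))).
Proof.
case: lf => cf fo fi [ce ei eo].
have [U Uy Ui] := fi (e (0, 0)).
have [d d0 dU] := chart_shrink ce (open_nbhs_nbhs Uy); exists d => //.
have [cs si so] := squeeze_embed d0.
split.
- by apply: cont_comp cf _; apply: cont_comp.
- by move=> a b /Ui; rewrite !inE => /(_ (dU _) (dU _)) /ei /si.
- apply/open_mapP; apply: open_map_comp fo.
  by apply: open_map_comp; apply/open_mapP.
Qed.

(** Once the chart is shrunk into the image of a neighbourhood [U] on which [f] is injective, the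
    lift is the section with values in [U]; its continuity comes from the openness of [f]. *)
Lemma chart_lift (y : Y) (e : plane -> X) : open_embedding e ->
  e (0, 0) = f y ->
  exists d (g : plane -> Y), [/\ 0 < d, open_embedding g, g (0, 0) = y &
    forall u, f (g u) = e (squeeze d u)].
Proof.
case: lf => cf fo fi [ce ei eo] e0.
have [U [oU Uy] Ui] := fi y.
have fU : nbhs (e (0, 0)) (f @` U) by rewrite e0; apply: fo; apply: open_nbhs_nbhs.
have [d d0 dU] := chart_shrink ce fU.
have dU' u : exists y, U y /\ f y = e (squeeze d u) by have [z Uz zE] := dU u; exists z.
have [g gP] := choice dU'.
have gU u : U (g u) by case: (gP u).
have fg u : f (g u) = e (squeeze d u) by case: (gP u).
have [cs si so] := squeeze_embed d0.
have inU a b : U a -> U b -> f a = f b -> a = b.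
  by move=> Ua Ub; apply: Ui; rewrite inE.
exists d, g; split=> //.
- split.
  + apply: contP => t A gA.
    have fA : nbhs (e (squeeze d t)) (f @` (A `&` U)).
      rewrite -fg; apply: fo; apply: filterI => //.
      by apply: open_nbhs_nbhs.
    have ces : continuous (fun u => e (squeeze d u)) by apply: cont_comp.
    apply: (filterS _ (cont_nbhs (ces t) fA)) => s /= [a [Aa Ua]].
    by rewrite -fg => /(inU _ _ Ua (gU s)) <-.
  + by move=> a b ab; apply: si; apply: ei; rewrite -!fg ab.
  + move=> V oV; have -> : g @` V = U `&` f @^-1` (e @` (squeeze d @` V)).
      apply/seteqP; split=> [_ [v Vv <-]|a [Ua [_ [v Vv <-] vE]]].
        by split=> //; exists (squeeze d v) => //; exists v.
      by exists v => //; apply: (inU) => //; rewrite fg.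
    apply: openI => //; apply: open_comp => [z _|]; first exact: cf.
    by apply: eo; apply: so.
- by apply: inU => //; rewrite fg squeeze0.
Qed.

Lemma simple_pull (D : diagram X) y :
  simple_point R (dpull f D) y <-> simple_point R D (f y).
Proof.
split=> -[e [ee e0 eS]].
  have [d d0 ed] := chart_push ee.
  exists (fun u => f (e (squeeze d u))); split=> //; first by rewrite squeeze0 // e0.
  by move=> u; rewrite -(squeeze2_eq0 u d0); apply: eS.
have [d [g [d0 gg g0 fg]]] := chart_lift ee e0.
by exists g; split=> // u; rewrite /= fg eS squeeze2_eq0.
Qed.

Lemma crossing_pull (D : diagram X) y :
  crossing R (dpull f D) y <-> crossing R D (f y).
Proof.
split=> -[e [ee e0 eS]].
  have [d d0 ed] := chart_push ee.
  exists (fun u => f (e (squeeze d u))); split=> //; first by rewrite squeeze0 // e0.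
  move=> u; rewrite -(squeeze2_eq0 u d0) -(squeeze12_eq0 u d0); apply: eS.
have [d [g [d0 gg g0 fg]]] := chart_lift ee e0.
exists g; split=> // u; rewrite /= fg -(squeeze2_eq0 u d0) -(squeeze12_eq0 u d0).
exact: eS.
Qed.

Lemma is_diagram_pull (D : diagram X) : is_diagram R D -> is_diagram R (dpull f D).
Proof.
case: lf => cf _ _ [cD DP]; split.
  by apply: closed_comp => // z _; apply: cf.
by move=> y /DP[h|h]; [left; apply/simple_pull|right; apply/crossing_pull].
Qed.

End LocalHomeo.

(** The values at 1 and -1 have opposite signs: otherwise the smaller one in absolute value would be
    taken again on the other side of 0, by the intermediate value theorem. All values between them
    are then attained. *)
Lemma injective_line_range (h : R -> R) : continuous h -> injective h ->
  h 0 = 0 -> exists2 e, 0 < e & forall y, `|y| < e -> exists x, h x = y.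
Proof.
move=> ch hi h0.
have cw (a b : R) : {within `[a, b], continuous h} by apply: continuous_subspaceT.
have hn0 (x : R) : x != 0 -> h x != 0 by apply: contra => /eqP; rewrite -h0 => /hi ->; rewrite h0.
have opp : h 1 * h (-1) < 0.
  rewrite lt_neqAle mulf_neq0 ?hn0 ?oppr_eq0 ?oner_eq0 //= leNgt; apply/negP => hh.
  have [[x hx x0]|[x hx x0]] : (exists2 x, h x = h 1 & x <= 0) \/
      (exists2 x, h x = h (-1) & 0 <= x).
    have [a b] : h 1 != 0 /\ h (-1) != 0 by rewrite !hn0 ?oppr_eq0 ?oner_eq0.
    have [le|le] := lerP `|h 1| `|h (-1)|; [left|right].
      have [|//||x] := @IVT R h (-1) 0 (h 1); first by lra.
        rewrite h0 ge_min le_max; move: le; rewrite ler_norml.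
        case: (ltrP 0 (h 1)) => h1; case: (ltrP 0 (h (-1))) => h2.
        * rewrite (gtr0_norm h2); move=> /andP[_ ->]; rewrite (ltW h1) orbT //.
        * nra.
        * nra.
        * by rewrite (ler0_norm h2) opprK !orbT andbT => /andP[-> _].
      by rewrite in_itv /= => /andP[_ x0] hx; exists x.
    have [|//||x] := @IVT R h 0 1 (h (-1)); first by lra.
      rewrite h0 ge_min le_max; move/ltW: le; rewrite ler_norml.
      case: (ltrP 0 (h 1)) => h1; case: (ltrP 0 (h (-1))) => h2.
      * rewrite (gtr0_norm h1); move=> /andP[_ ->]; rewrite (ltW h2) orbT //.
      * nra.
      * nra.
      * by rewrite (ler0_norm h1) opprK => /andP[-> _]; rewrite orbT.
    by rewrite in_itv /= => /andP[x0 _] hx; exists x.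
  - by move: hx x0 => /hi ->; rewrite ler10.
  - by move: hx x0 => /hi ->; rewrite oppr_ge0 ler10.
exists (Num.min `|h 1| `|h (-1)|).
  by rewrite lt_min !normr_gt0 !hn0 ?oppr_eq0 ?oner_eq0.
move=> y; rewrite lt_min => /andP[]; rewrite !ltr_norml => yl yr.
have [|//||x _ <-] := @IVT R h (-1) 1 y; [by lra| |by exists x].
rewrite ge_min le_max.
move: yl yr; case: (ltrP 0 (h 1)) => h1; last first.
  have h2 : 0 < h (-1) by nra.
  rewrite (ler0_norm h1) (gtr0_norm h2) opprK => /andP[h3 h4] /andP[h5 h6].
  by rewrite (ltW h3) (ltW h6) !orbT.
have h2 : h (-1) < 0 by nra.
rewrite (gtr0_norm h1) (ltr0_norm h2) opprK => /andP[h3 h4] /andP[h5 h6].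
by rewrite (ltW h5) (ltW h4) !orbT.
Qed.

(* A chart in which the curve is a line turns the four branches at a crossing
   into four disjoint intervals of the line ending at the same point. *)
Lemma simple_not_crossing (X : topologicalType) (D : diagram X) x :
  simple_point R D x -> ~ crossing R D x.
Proof.
move=> [e [ee e0 eS]] [e' [ee' e0' eS']].
have [|d [g [d0 [cg gi _] g0 gE]]] := chart_lift (embed_local ee) (y := (0, 0)) ee'.
  by rewrite e0.
have gS u : (g u).2 = 0 <-> u.1 * u.2 = 0.
  by rewrite -eS gE; have [-> _] := eS' (squeeze d u); apply: squeeze12_eq0.
have ch : continuous (fun s => (g (s, 0)).1) by ct; apply: cont_comp cg _; ct.
have cv : continuous (fun s => (g (0, s)).1) by ct; apply: cont_comp cg _; ct.
have hg s : g (s, 0) = ((g (s, 0)).1, 0).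
  by rewrite [LHS]surjective_pairing; congr (_, _); apply/gS; rewrite mulr0.
have vg s : g (0, s) = ((g (0, s)).1, 0).
  by rewrite [LHS]surjective_pairing; congr (_, _); apply/gS; rewrite mul0r.
have [||a a0 aP] := injective_line_range ch _ _.
- by move=> s t /= st; have /gi[] : g (s, 0) = g (t, 0) by rewrite (hg s) (hg t) st.
- by rewrite g0.

have : nbhs (0 : R) [set s | `|(g (0, s)).1| < a].
  apply: (cont_nbhs (A := [set y | `|y| < a]) (cv 0)); rewrite /= g0.
  by apply/nbhs_lineP; exists a => // y; rewrite subr0.
move=> /nbhs_lineP[b b0 /(_ (b / 2))]; rewrite subr0 gtr0_norm ?divr_gt0 //.
have b20 : b / 2 < b by lra.
move=> /(_ b20) /aP [s sE].
have /gi [_] : g (s, 0) = g (0, b / 2) by rewrite hg sE -vg.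
lra.
Qed.

Lemma simple_germ (X : topologicalType) (D D' : diagram X) x :
  (\forall y \near x, dset D y <-> dset D' y) ->
  simple_point R D x -> simple_point R D' x.
Proof.
move=> DD [e [ee e0 eS]].
have [d d0 dO] : exists2 d, 0 < d & forall u, dset D (e (squeeze d u)) <-> dset D' (e (squeeze d u)).
  by case: ee => ce _ _; apply: (chart_shrink ce (O := [set y | dset D y <-> dset D' y])); rewrite e0.
exists (fun u => e (squeeze d u)); split.
- exact: embed_comp (squeeze_embed d0) ee.
- by rewrite squeeze0.
- by move=> u; rewrite -dO eS squeeze2_eq0.
Qed.

Lemma crossing_germ (X : topologicalType) (D D' : diagram X) x :
  (\forall y \near x, dset D y <-> dset D' y) ->
  (\forall y \near x, dover D x y <-> dover D' x y) ->
  crossing R D x -> crossing R D' x.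
Proof.
move=> DD OO [e [ee e0 eS]].
have [d d0 dO] : exists2 d, 0 < d &
    forall u, [set y | (dset D y <-> dset D' y) /\ (dover D x y <-> dover D' x y)]
      (e (squeeze d u)).
  by case: ee => ce _ _; apply: (chart_shrink ce); rewrite e0; apply: filterI.
exists (fun u => e (squeeze d u)); split.
- exact: embed_comp (squeeze_embed d0) ee.
- by rewrite squeeze0.
- move=> u; have [h1 h2] := dO u; have [h3 h4] := eS (squeeze d u).
  by rewrite -h1 -h2 h3 h4 squeeze12_eq0 // squeeze2_eq0.
Qed.

End Charts.

(** * Links presenting a diagram *)

Section Presents.
Variable R : realType.

Section Definitions.
Variable X : topologicalType.
Implicit Types (W : set (X * R)) (D : diagram X).

(* Links are subsets of [X * R] with heights in ]-1, 1[ rather than subsets of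
   [X * II R], so that isotopies need not care about the boundary of [II R]. *)
Definition crosses W D x := exists z1 z2 : R,
  [/\ z1 < z2, forall z, W (x, z) <-> z = z1 \/ z = z2,
      \forall p \near (x, z2), W p -> dover D x p.1
    & \forall p \near (x, z1), W p -> dover D x p.1 -> p.1 = x].

Definition presents_at W D x :=
  [/\ dset D x <-> exists z, W (x, z),
      simple_point R D x -> exists z0, forall z, W (x, z) <-> z = z0
    & crossing R D x -> crosses W D x].

Definition slab W := closed W /\ forall p, W p -> `|p.2| < 1.

Definition presents W D :=
  [/\ slab W, is_diagram R D & forall x, presents_at W D x].

(** Over strands are compared only at crossings of the second diagram, which is what transporting a
    presentation from [D] to [D'] requires. *)
Definition germ_eq D D' x :=
  (\forall y \near x, dset D y <-> dset D' y) /\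
  (crossing R D' x -> \forall y \near x, dover D x y <-> dover D' x y).

Lemma iff_near (P Q : X -> Prop) (x : X) :
  (\forall y \near x, P y <-> Q y) -> \forall y \near x, Q y <-> P y.
Proof. by apply: filterS => y [? ?]. Qed.

Lemma presents_at_germ W W' D D' x :
  germ_eq D D' x -> (\forall y \near x, forall z, W (y, z) <-> W' (y, z)) ->
  presents_at W D x -> presents_at W' D' x.
Proof.
move=> [DD OO] WW [h1 h2 h3]; have WWx := nbhs_singleton WW; split.
- rewrite -(nbhs_singleton DD) h1.
  by split=> -[z]; [rewrite WWx|rewrite -WWx] => ?; exists z.
- move=> /(simple_germ (iff_near DD)) /h2 [z0 z0P].
  by exists z0 => z; rewrite -WWx z0P.
- move=> c; have OOc := OO c.
  have /h3[z1 [z2 [z12 zP n2 n1]]] := crossing_germ (iff_near DD) (iff_near OOc) c.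
  have cf z : {for (x, z), continuous (@fst X R)} by exact: cvg_fst.
  exists z1, z2; split=> //.
  + by move=> z; rewrite -WWx zP.
  + have a1 := cont_nbhs (cf z2) WW; have a2 := cont_nbhs (cf z2) OOc.
    apply: filterS3 n2 a1 a2 => -[y z] /= k1 k2 k3 /k2 /k1; by rewrite k3.
  + have a1 := cont_nbhs (cf z1) WW; have a2 := cont_nbhs (cf z1) OOc.
    apply: filterS3 n1 a1 a2 => -[y z] /= k1 k2 k3 /k2 /k1; by rewrite k3.
Qed.

(** [deq_on] compares over strands at crossings of [D], [germ_eq] at crossings of [D']. A crossing
    of [D'] is a simple point or a crossing of [D], and the first case would make it simple for [D']
    as well. *)
Lemma deq_on_germ B D D' x : nbhs x B -> deq_on R B D D' -> is_diagram R D ->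
  germ_eq D D' x.
Proof.
move=> xB DD [_ DP].
have e : \forall y \near x, dset D y <-> dset D' y.
  by apply: filterS xB => y /DD[].
split=> // c; have Bx := nbhs_singleton xB; have [ds dc] := DD _ Bx.
have Dx' : dset D' x by case: c => f [_ <- /(_ (0, 0)) [fS _]]; apply/fS; rewrite mulr0.
have [s|/dc //] := DP _ (ds.2 Dx').
by case: (simple_not_crossing (simple_germ e s)).
Qed.

Lemma deq_on_germ_sym B D D' x : nbhs x B -> deq_on R B D D' -> germ_eq D' D x.
Proof.
move=> xB DD; split.
  by apply: filterS xB => y /DD[h _]; apply: iff_sym.
by move=> c; have [_ /(_ c)] := DD _ (nbhs_singleton xB); apply: iff_near.
Qed.

Lemma presents_deq W D D' : deq R D D' -> is_diagram R D' ->
  presents W D -> presents W D'.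
Proof.
move=> DD dD' [sW dD WD]; split=> // x; apply: presents_at_germ (WD x).
  by apply: deq_on_germ DD dD; apply: filterT.
by apply: filterE.
Qed.

Lemma presents_deq_sym W D D' : deq R D D' -> is_diagram R D ->
  presents W D' -> presents W D.
Proof.
move=> DD dD [sW dD' WD]; split=> // x; apply: presents_at_germ (WD x).
  by apply: deq_on_germ_sym DD; apply: filterT.
by apply: filterE.
Qed.

End Definitions.

Section Pull.
Variables (X Y : topologicalType) (f : Y -> X).
Hypothesis lf : local_homeo f.

Definition wpull (W : set (X * R)) : set (Y * R) := [set p | W (f p.1, p.2)].

Lemma presents_at_pull W D y :
  presents_at (wpull W) (dpull f D) y <-> presents_at W D (f y).
Proof.
have [cf fo fi] := lf.
have fo2 : open_map (fun p : Y * R => (f p.1, p.2)).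
  exact: (open_map_prod fo (@open_map_id R)).
have cf2 : continuous (fun p : Y * R => (f p.1, p.2)).
  by apply: cont_pair; [apply: cont_comp cf _|]; ct.
split=> -[h1 h2 h3]; split.
- by rewrite -[dset D (f y)]/(dset (dpull f D) y) h1.
- by move=> /(simple_pull R lf) /h2.
- move=> /(crossing_pull R lf) /h3 [z1 [z2 [z12 zP n2 n1]]].
  exists z1, z2; split=> //.
  + by apply: filterS (fo2 _ _ n2) => _ [[a z] /= aP <-] /aP.
  + by apply: filterS (fo2 _ _ n1) => _ [[a z] /= aP <-] /= /aP k /k ->.
- by rewrite -[dset (dpull f D) y]/(dset D (f y)) h1.
- by move=> /(simple_pull R lf) /h2.
- move=> /(crossing_pull R lf) /h3 [z1 [z2 [z12 zP n2 n1]]].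
  exists z1, z2; split=> //.
  + by apply: filterS (cont_nbhs (cf2 (y, z2)) n2) => -[a z] /= aP /aP.
  (* The condition on the under strand only yields [f a = f y]; it gives [a = y] inside a
     neighbourhood on which [f] is injective. *)
  + have [U Uy Ui] := fi y.
    have Un : \forall p \near (y, z1), U p.1.
      by apply: (@cvg_fst _ _ (nbhs y) (nbhs z1)); apply: open_nbhs_nbhs.
    apply: filterS2 Un (cont_nbhs (cf2 (y, z1)) n1) => -[a z] /= Ua aP Wa Oa.
    by apply: Ui; rewrite ?inE //; [case: Uy|apply: aP].
Qed.

Lemma presents_pull W D : presents W D -> presents (wpull W) (dpull f D).
Proof.
move=> [[cW sW] dD WD]; split; [split| |].
- apply: closed_comp => // z _.
  case: lf => cf _ _; move: z; change (continuous (fun p : Y * R => (f p.1, p.2))).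
  by apply: cont_pair; [apply: cont_comp cf _|]; ct.
- by move=> p /sW.
- exact: is_diagram_pull.
- by move=> y; apply/presents_at_pull.
Qed.

End Pull.

Section Isotopy.
Variable X : topologicalType.
Implicit Types (W : set (X * R)) (F : R -> X * R -> X * R).

(** Above and below the slab only the heights are fixed, not the points: an isotopy of the surface,
    thickened to all heights, must qualify. This suffices to restrict to heights in [[-1, 1]]. *)
Definition slab_isotopy F :=
  [/\ continuous (fun p : R * (X * R) => F p.1 p.2),
      forall t, homeomorphism (F t), forall p, F 0 p = p,
      forall t p, 1 <= `|p.2| -> (F t p).2 = p.2
    & forall t p, `|p.2| < 1 -> `|(F t p).2| < 1].

Definition slab_equiv W W' := exists2 F, slab_isotopy F & W' = F 1 @` W.

Lemma slab_equiv_refl W : slab_equiv W W.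
Proof.
exists (fun _ p => p); last by rewrite image_id.
by split=> // [|_]; [ct|exact: homeo_id].
Qed.

Lemma slab_equiv_trans W1 W2 W3 :
  slab_equiv W1 W2 -> slab_equiv W2 W3 -> slab_equiv W1 W3.
Proof.
move=> [F [cF hF F0 Fh Fs] ->] [G [cG hG G0 Gh Gs] ->].
exists (fun t p => G t (F t p)); last by rewrite image_comp.
split=> //.
- apply: (cont_comp cG (g := fun p => (p.1, F p.1 p.2))).
  by apply: cont_pair => //; ct.
- by move=> t; apply: homeo_comp.
- by move=> p; rewrite F0 G0.
- by move=> t p hp; rewrite Gh Fh.
- by move=> t p hp; apply: Gs; apply: Fs.
Qed.

(* Run the isotopy backwards, starting from the inverse of its final stage. *)
Lemma slab_equiv_sym W W' : slab_equiv W W' -> slab_equiv W' W.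
Proof.
move=> [F [cF hF F0 Fh Fs] ->].
have [g hg [Fg gF]] := homeo_inv (hF 1).
have gs p : 1 <= `|p.2| -> 1 <= `|(g p).2|.
  by rewrite leNgt => np; rewrite leNgt; apply: contra np => /(Fs 1); rewrite gF.
exists (fun t p => F (1 - t) (g p)); last first.
  rewrite image_comp subrr -[LHS]image_id; apply: eq_imagel => p _ /=.
  by rewrite F0 Fg.
split.
- apply: (cont_comp cF (g := fun p : R * (X * R) => (1 - p.1, g p.2))).
  apply: cont_pair; first by ct.
  by case: hg => cg _; apply: cont_comp cg _; ct.
- by move=> t; apply: homeo_comp.
- by move=> p; rewrite subr0 gF.
- move=> t p hp; rewrite Fh ?gs // -{2}[p]gF Fh // gs //.
- move=> t p hp; apply: Fs; rewrite ltNge; apply/negP => ngp.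
  by have := Fh 1 _ ngp; rewrite gF => pE; move: ngp; rewrite -pE leNgt hp.
Qed.

Lemma slab_image F W : slab_isotopy F -> slab W -> slab (F 1 @` W).
Proof.
move=> [cF hF F0 Fh Fs] [cW sW]; split; last by move=> _ [p /sW hp <-]; apply: Fs.
have [_ [g [cg Fg gF]]] := hF 1.
have -> : F 1 @` W = g @^-1` W.
  by apply/seteqP; split=> [_ [p Wp <-]|p Wp]; [rewrite /= Fg|exists (g p)].
by apply: closed_comp => // z _; apply: cg.
Qed.

End Isotopy.

End Presents.

(** * Gluing along a chart, and piecewise linear maps of the line *)

Section Extension.
Variables U Y T : Type.

Definition extend (e : U -> Y) (f : U -> T) (d : Y -> T) (y : Y) : T :=
  if pselect (exists u, e u = y) is left h then f (projT1 (cid h)) else d y.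

Lemma extend_in e f d u : injective e -> extend e f d (e u) = f u.
Proof.
move=> ei; rewrite /extend; case: pselect => [h|[]]; last by exists u.
by case: cid => /= v /ei ->.
Qed.

Lemma extend_out e f d y : ~ (exists u, e u = y) -> extend e f d y = d y.
Proof. by move=> h; rewrite /extend; case: pselect. Qed.

End Extension.

Lemma glue_cont (U Y Z T : topologicalType) (e : U -> Y) (K : set U) (f : U * Z -> T) (d g : Y * Z -> T) :
  hausdorff_space Y -> open_embedding e -> compact K ->
  continuous f -> continuous d ->
  (forall u z, g (e u, z) = f (u, z)) ->
  (forall y z, ~ (e @` K) y -> g (y, z) = d (y, z)) -> continuous g.
Proof.
move=> hY [ce ei eo] cK cf cd gf gd [y z].
have [[u uy]|yu] := pselect (exists u, e u = y).
  rewrite -uy.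
  have fo : open_map (fun p : U * Z => (e p.1, p.2)).
    by apply: (open_map_prod _ (@open_map_id Z)); apply/open_mapP.
  apply: (open_map_cont (x := (u, z)) fo).
  have -> : (fun x : U * Z => g (e x.1, x.2)) = f.
    by apply/funext => -[v w]; rewrite gf.
  exact: cf.
have oK : open (~` (e @` K)).
  apply: closed_openC; apply: compact_closed => //.
  by apply: continuous_compact => //; apply: continuous_subspaceT.
apply: near_cont (cd (y, z)).
have yK : (~` (e @` K)) y by move=> [u _ uy]; apply: yu; exists u.
have : \forall p \near (y, z), (~` (e @` K)) p.1.
  by apply: (@cvg_fst _ _ (nbhs y) (nbhs z)); apply: open_nbhs_nbhs.
by apply: filterS => -[v w] /= vK; apply: gd.
Qed.

Lemma hausdorff_plane (R : realType) : hausdorff_space (R * R)%type.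
Proof. exact: norm_hausdorff. Qed.

Section PiecewiseLinear.
Variable R : realType.

Variant clamp_spec (a b x : R) : R -> Prop :=
| ClampLo of x <= a : clamp_spec a b x a
| ClampId of a <= x & x <= b : clamp_spec a b x x
| ClampHi of b <= x : clamp_spec a b x b.

Lemma clampP (a b x : R) : a <= b -> clamp_spec a b x (clamp a b x).
Proof.
move=> ab; rewrite /clamp; have [xb|bx] := leP b x.
  by rewrite (max_idPr ab); apply: ClampHi.
by have [ax|xa] := leP a x; [apply: ClampId => //; apply: ltW|apply: ClampLo; apply: ltW].
Qed.

Lemma clamp_le (a b x y : R) : a <= b -> x <= y -> clamp a b x <= clamp a b y.
Proof. by move=> ab xy; case: (clampP x ab) => *; case: (clampP y ab) => *; lra. Qed.

Lemma clamp_lip (a b x y : R) : a <= b -> x <= y ->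
  clamp a b y - clamp a b x <= y - x.
Proof. by move=> ab xy; case: (clampP x ab) => *; case: (clampP y ab) => *; lra. Qed.

Lemma clamp_in (a b x : R) : a <= b -> a <= clamp a b x <= b.
Proof. by move=> ab; case: (clampP x ab) => *; apply/andP; split; lra. Qed.

Lemma clamp_id (a b x : R) : a <= x <= b -> clamp a b x = x.
Proof.
move=> /andP[ax xb]; have ab : a <= b by lra.
by case: (clampP x ab) => *; lra.
Qed.

Lemma clamp_lo (a b x : R) : a <= b -> x <= a -> clamp a b x = a.
Proof. by move=> ab xa; case: (clampP x ab) => *; lra. Qed.

Lemma clamp_hi (a b x : R) : a <= b -> b <= x -> clamp a b x = b.
Proof. by move=> ab xa; case: (clampP x ab) => *; lra. Qed.

Lemma clamp_split (a b c d x : R) : a <= b -> b <= c -> c <= d ->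
  clamp a d x = clamp a b x + (clamp b c x - b) + (clamp c d x - c).
Proof.
move=> ab bc cd; have ad : a <= d by lra.
have [xa|/ltW ax] := leP x a; first by rewrite !(@clamp_lo _ _ x); lra.
have [xb|/ltW bx] := leP x b.
  rewrite (@clamp_id a d x) ?(@clamp_id a b x) ?(@clamp_lo b c x) ?(@clamp_lo c d x);
    rewrite ?ax ?xb /=; lra.
have [xc|/ltW cx] := leP x c.
  rewrite (@clamp_id a d x) ?(@clamp_hi a b x) ?(@clamp_id b c x) ?(@clamp_lo c d x);
    rewrite ?ax ?bx ?xc /=; lra.
rewrite (@clamp_hi a b x) ?(@clamp_hi b c x) //; case: (clampP x cd) => *;
  case: (clampP x ad) => *; lra.
Qed.

(* The piecewise linear map fixing the complement of ]-1, 1[ and sending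
   [a] to [a'] and [b] to [b']. *)
Definition pl (a b a' b' z : R) : R :=
  (z - clamp (-1) 1 z) +
  (-1 + (1 + a') / (1 + a) * (clamp (-1) a z + 1) +
   (b' - a') / (b - a) * (clamp a b z - a) +
   (1 - b') / (1 - b) * (clamp b 1 z - b)).

Definition pl_ok (a b a' b' : R) :=
  [/\ -1 < a, a < b, b < 1 & [/\ -1 < a', a' < b' & b' < 1]].

Lemma pl_incr a b a' b' : pl_ok a b a' b' -> {homo pl a b a' b' : x y / x < y}.
Proof.
move=> [ha hab hb [ha' hab' hb']] x y xy; rewrite /pl.
have s0 : 0 < (1 + a') / (1 + a) by apply: divr_gt0; lra.
have s1 : 0 < (b' - a') / (b - a) by apply: divr_gt0; lra.
have s2 : 0 < (1 - b') / (1 - b) by apply: divr_gt0; lra.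
move: s0 s1 s2; set p := _ / _; set q := _ / _; set r := _ / _ => s0 s1 s2.
have sx := @clamp_split (-1) a b 1 x (ltW ha) (ltW hab) (ltW hb).
have sy := @clamp_split (-1) a b 1 y (ltW ha) (ltW hab) (ltW hb).
have A := clamp_le (ltW ha) (ltW xy); have B := clamp_le (ltW hab) (ltW xy).
have C := clamp_le (ltW hb) (ltW xy).
have E := @clamp_lip (-1) 1 x y _ (ltW xy).
move: A B C E sx sy; set x0 := clamp (-1) a x; set x1 := clamp a b x.
set x2 := clamp b 1 x; set y0 := clamp (-1) a y; set y1 := clamp a b y.
set y2 := clamp b 1 y; set xx := clamp _ _ x; set yy := clamp _ _ y.
move=> A B C E sx sy.
have {}E : yy - xx <= y - x by apply: E; lra.
clearbody p q r x0 x1 x2 y0 y1 y2 xx yy.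
have A' : p * x0 <= p * y0 by rewrite ler_pM2l.
have B' : q * x1 <= q * y1 by rewrite ler_pM2l.
have C' : r * x2 <= r * y2 by rewrite ler_pM2l.
(* The increments over the three pieces add up to that of the clamp to [[-1, 1]]. If one is positive
   its slope makes the sum grow; if all vanish, the growth comes from the part outside [[-1, 1]]. *)
have [A1|A1] := ltP x0 y0.
  by have A2 : p * x0 < p * y0; [rewrite ltr_pM2l|lra].
have [B1|B1] := ltP x1 y1.
  by have B2 : q * x1 < q * y1; [rewrite ltr_pM2l|lra].
have [C1|C1] := ltP x2 y2.
  by have C2 : r * x2 < r * y2; [rewrite ltr_pM2l|lra].
lra.
Qed.

Lemma pl_out a b a' b' z : pl_ok a b a' b' -> 1 <= `|z| -> pl a b a' b' z = z.
Proof.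
move=> [ha hab hb [ha' hab' hb']].
have u0 : 1 + a != 0 by apply: lt0r_neq0; lra.
have u1 : b - a != 0 by apply: lt0r_neq0; lra.
have u2 : 1 - b != 0 by apply: lt0r_neq0; lra.
by rewrite ler_normr => /orP[h|h]; rewrite /pl;
  [rewrite !(@clamp_hi _ _ z)|rewrite !(@clamp_lo _ _ z)];
  first [lra|field; rewrite u0 u1 u2].
Qed.

Lemma pl_a a b a' b' : pl_ok a b a' b' -> pl a b a' b' a = a'.
Proof.
move=> [ha hab hb [ha' hab' hb']].
have u0 : 1 + a != 0 by apply: lt0r_neq0; lra.
have u1 : b - a != 0 by apply: lt0r_neq0; lra.
have u2 : 1 - b != 0 by apply: lt0r_neq0; lra.
rewrite /pl (@clamp_id (-1) 1 a) ?(@clamp_hi (-1) a a) ?(@clamp_lo a b a) ?(@clamp_lo b 1 a);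
  try lra.
by field; rewrite u0 u1 u2.
Qed.

Lemma pl_b a b a' b' : pl_ok a b a' b' -> pl a b a' b' b = b'.
Proof.
move=> [ha hab hb [ha' hab' hb']].
have u0 : 1 + a != 0 by apply: lt0r_neq0; lra.
have u1 : b - a != 0 by apply: lt0r_neq0; lra.
have u2 : 1 - b != 0 by apply: lt0r_neq0; lra.
rewrite /pl (@clamp_id (-1) 1 b) ?(@clamp_hi (-1) a b) ?(@clamp_hi a b b) ?(@clamp_lo b 1 b);
  try lra.
by field; rewrite u0 u1 u2.
Qed.

Lemma cont_pl (T : topologicalType) (a b a' b' z : T -> R) :
  continuous a -> continuous b -> continuous a' -> continuous b' ->
  continuous z -> (forall t, -1 < a t) -> (forall t, a t < b t) ->
  (forall t, b t < 1) -> continuous (fun t => pl (a t) (b t) (a' t) (b' t) (z t)).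
Proof.
move=> ca cb ca' cb' cz h1 h2 h3; rewrite /pl /clamp.
have d1 t : 1 + a t != 0 by apply: lt0r_neq0; have := h1 t; lra.
have d2 t : b t - a t != 0 by apply: lt0r_neq0; have := h2 t; lra.
have d3 t : 1 - b t != 0 by apply: lt0r_neq0; have := h3 t; lra.
by ct; apply: cont_inv => //; ct.
Qed.

End PiecewiseLinear.

(** * Matching two links with the same diagram *)

Section Heights.
Variables (R : realType) (X : topologicalType).
Local Notation plane := (R * R)%type.
Implicit Types (W : set (X * R)) (D : diagram X).

(** The tube lemma: heights range in the compact [[-1, 1]] and [W] is closed, so the fibres of [W]
    are upper semicontinuous. *)
Lemma fiber_usc W (O : set R) x : slab W ->
  (forall z, W (x, z) -> nbhs z O) ->
  \forall y \near x, forall z, W (y, z) -> O z.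
Proof.
move=> [cW sW] WO.
have /compact_near_coveringP cK : compact `[(-1 : R), 1] by apply: segment_compact.
have := cK _ (nbhs x) (fun y z => W (y, z) -> O z) _ _.
have h : forall z : R, `[-1, 1]%classic z ->
    \forall z' \near z & y \near x, W (y, z') -> O z'.
  move=> z _; have [Wz|nWz] := pselect (W (x, z)).
    exists (O, setT); first by split; [exact: WO|exact: filterT].
    by move=> [z' y] /= [].
  have : nbhs (x, z) (~` W) by apply: open_nbhs_nbhs; split; [exact: closed_openC|].
  by case=> -[A B] /= [xA zB] AB; exists (B, A) => // -[z' y] /= [Bz Ay] /(AB (y, z')) [].
move=> /(_ _ h) ; apply: filterS => y yP z Wz; apply: (yP z) => //=.
by rewrite in_itv /= -ler_norml ltW // (sW _ Wz).
Qed.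

(** Where the fibre is a single point, upper semicontinuity of the fibres is continuity of any
    choice of heights. *)
Lemma height_cont W (T : topologicalType) (c : T -> X) (k : T -> R) t :
  slab W -> {for t, continuous c} -> (forall z, W (c t, z) -> z = k t) ->
  (forall s, W (c s, k s)) -> {for t, continuous k}.
Proof.
move=> sW cc Wt Wk A kA.
have h z : W (c t, z) -> nbhs z A by move=> /Wt ->.
by apply: (filterS _ (cont_nbhs cc (fiber_usc sW h))) => s /= /(_ _ (Wk s)).
Qed.

Lemma slanted_embed (s d : R) : 0 < d ->
  open_embedding (fun v : plane => (s + squeeze1 d v.1, v.2)).
Proof.
move=> d0.
have ci : continuous (fun x => s + squeeze1 d x).
  by ct; apply: cont_squeeze1.
have ii : {homo (fun x => s + squeeze1 d x) : x y / x < y}.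
  by move=> x y xy /=; rewrite ltrD2l squeeze1_incr.
split.
- by apply: cont_pair; [apply: (cont_comp ci)|]; ct.
- move=> [a b] [a' b'] /= [/addrI h ->]; congr (_, _).
  by move: h; apply: inc_inj; apply: le_mono; apply: squeeze1_incr.
- apply/open_mapP; apply: (@open_map_prod _ _ _ _ (fun x => s + squeeze1 d x) (fun x => x)).
    exact: incr_open_map.
  exact: open_map_id.
Qed.

Lemma swap_embed : open_embedding (fun v : plane => (v.2, v.1)).
Proof.
apply: homeo_embed; split; first by ct.
by exists (fun v => (v.2, v.1)); split; [ct|case|case].
Qed.

Lemma branch_point (s x : R) : s != 0 -> s + squeeze1 `|s| x != 0.
Proof.
move=> s0; have d0 : 0 < `|s| by rewrite normr_gt0.
have := squeeze1_lt x d0; apply: contraTneq => h.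
have -> : squeeze1 `|s| x = - s by lra.
by rewrite normrN ltxx.
Qed.

(** The chart centred at parameter [s] of one branch only uses parameters at distance less than
    [|s|] from [s], so it never meets the other branch. *)
Lemma branch_simple D (e : plane -> X) : open_embedding e ->
  (forall u, dset D (e u) <-> u.1 * u.2 = 0) ->
  forall s, s != 0 -> simple_point R D (e (s, 0)) /\ simple_point R D (e (0, s)).
Proof.
move=> ee eS s s0; have d0 : 0 < `|s| by rewrite normr_gt0.
have z0 : s + squeeze1 `|s| 0 = s by rewrite /squeeze1 mul0r mulr0 addr0.
split.
  exists (fun v => e (s + squeeze1 `|s| v.1, v.2)); split.
  - exact: embed_comp (slanted_embed s d0) ee.
  - by rewrite /= z0.
  - move=> u; rewrite eS /=; split=> [/eqP|->]; last by rewrite mulr0.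
    by rewrite mulf_eq0 (negbTE (branch_point _ s0)) => /eqP.
exists (fun v => e (v.2, s + squeeze1 `|s| v.1)); split.
- exact: embed_comp (embed_comp (slanted_embed s d0) swap_embed) ee.
- by rewrite /= z0.
- move=> u; rewrite eS /=; split=> [/eqP|->]; last by rewrite mul0r.
  by rewrite mulf_eq0 (negbTE (branch_point _ s0)) orbF => /eqP.
Qed.

Lemma simple_heights W D (e : plane -> X) : presents W D ->
  open_embedding e -> (forall u, dset D (e u) <-> u.2 = 0) ->
  exists2 k : R -> R, continuous k &
    forall u z, W (e u, z) <-> u.2 = 0 /\ z = k u.1.
Proof.
move=> [sW dD WD] ee eS.
have h s : exists z0, forall z, W (e (s, 0), z) <-> z = z0.
  have [_ + _] := WD (e (s, 0)); apply.
  exists (fun v => e (s + v.1, v.2)); split; last by move=> u; rewrite eS.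
    apply: embed_comp ee; apply: homeo_embed; split; first by ct.
    by exists (fun v => (v.1 - s, v.2)); split; [ct| |] => -[a b] /=; congr (_, _); lra.
  by rewrite addr0.
have [k kP] := choice h.
have ec : continuous (fun s : R => e (s, 0)).
  by case: ee => ce _ _; apply: cont_comp ce _; ct.
exists k.
  move=> s; apply: height_cont sW (ec s) _ _ => //; first by move=> z /kP.
  by move=> t; apply/kP.
move=> [a b] z; split=> [Wz|[/= -> ->]]; last exact/kP.
have b0 : b = 0.
  apply/(eS (a, b)); have [-> _ _] := WD (e (a, b)); by exists z.
by split=> //=; apply/kP; rewrite -b0.
Qed.

Lemma crossing_heights W D (x : X) (e : plane -> X) : presents W D ->
  open_embedding e -> e (0, 0) = x ->
  (forall u, (dset D (e u) <-> u.1 * u.2 = 0) /\ (dover D x (e u) <-> u.2 = 0)) ->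
  exists ko ku : R -> R, [/\ continuous ko, continuous ku, ku 0 < ko 0 &
    forall u z, W (e u, z) <->
      (u.2 = 0 /\ z = ko u.1) \/ (u.1 = 0 /\ z = ku u.2)].
Proof.
move=> [sW dD WD] ee e0 eS.
have eS1 u : dset D (e u) <-> u.1 * u.2 = 0 by case: (eS u).
have eS2 u : dover D x (e u) <-> u.2 = 0 by case: (eS u).
have cx : crossing R D x by exists e.
have [_ _ /(_ cx) [z1 [z2 [z12 zP n2 n1]]]] := WD x.
have [ce ei eo] := ee.
have ec1 : continuous (fun s : R => e (s, 0)) by apply: cont_comp ce _; ct.
have ec2 : continuous (fun s : R => e (0, s)) by apply: cont_comp ce _; ct.
have br := branch_simple ee eS1.
(* Over the crossing the fibre has two heights; the upper one is assigned to the over strand here,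
   and the lower one to the under strand in [h2]. *)
have h1 s : exists z0, W (e (s, 0), z0) /\
    if s == 0 then z0 = z2 else forall z, W (e (s, 0), z) <-> z = z0.
  have [->|s0] := eqVneq s 0; first by exists z2; split=> //; rewrite e0; apply/zP; right.
  have [_ /(_ (br s s0).1) [z0 z0P] _] := WD (e (s, 0)).
  by exists z0; split=> //; apply/z0P.
have h2 s : exists z0, W (e (0, s), z0) /\
    if s == 0 then z0 = z1 else forall z, W (e (0, s), z) <-> z = z0.
  have [->|s0] := eqVneq s 0; first by exists z1; split=> //; rewrite e0; apply/zP; left.
  have [_ /(_ (br s s0).2) [z0 z0P] _] := WD (e (0, s)).
  by exists z0; split=> //; apply/z0P.
have [ko koP] := choice h1; have [ku kuP] := choice h2.
have koW s : W (e (s, 0), ko s) by case: (koP s).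
have kuW s : W (e (0, s), ku s) by case: (kuP s).
have ko0 : ko 0 = z2 by case: (koP 0); rewrite eqxx.
have ku0 : ku 0 = z1 by case: (kuP 0); rewrite eqxx.
have kos s : s != 0 -> forall z, W (e (s, 0), z) <-> z = ko s.
  by move=> s0; case: (koP s); rewrite (negbTE s0).
have kus s : s != 0 -> forall z, W (e (0, s), z) <-> z = ku s.
  by move=> s0; case: (kuP s); rewrite (negbTE s0).
exists ko, ku; split.
- move=> s; have [->|s0] := eqVneq s 0; last first.
    by apply: height_cont sW (ec1 s) _ _ => // z /kos; apply.
  (* The fibre over the crossing is not a single point, so [height_cont] does not apply. Heights of
     the over strand near the crossing could only approach [z2] or [z1], and [n1] excludes [z1]:
     near it, only [x] itself projects into the over strand. *)
  move=> A; rewrite ko0 => zA.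
  case: n1 => -[B C] /= [xB zC] BC.
  have h z : W (e (0, 0), z) -> nbhs z (A `|` C).
    by rewrite e0 => /zP[] ->; [apply: filterS zC => t; right|apply: filterS zA => t; left].
  have a1 := cont_nbhs (ec1 0) (fiber_usc sW h).
  have a2 : nbhs (0 : R) [set s | B (e (s, 0))] by apply: cont_nbhs (ec1 0) _; rewrite e0.
  change (nbhs (0 : R) [set t | A (ko t)]).
  apply: filterS2 a1 a2 => t /= /(_ _ (koW t)) [//|Ct Bt].
  have [->|t0] := eqVneq t 0; first by rewrite ko0; apply: nbhs_singleton.
  have : (e (t, 0), ko t).1 = x by apply: BC => //; apply/eS2.
  by rewrite /= -e0 => /ei[] t0'; rewrite t0' eqxx in t0.
- move=> s; have [->|s0] := eqVneq s 0; last first.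
    by apply: height_cont sW (ec2 s) _ _ => // z /kus; apply.
  (* Here [n2] excludes the upper height: near it, every point of the link projects into the over
     strand, which the other branch meets only at the crossing. *)
  move=> A; rewrite ku0 => zA.
  case: n2 => -[B C] /= [xB zC] BC.
  have h z : W (e (0, 0), z) -> nbhs z (A `|` C).
    by rewrite e0 => /zP[] ->; [apply: filterS zA => t; left|apply: filterS zC => t; right].
  have a1 := cont_nbhs (ec2 0) (fiber_usc sW h).
  have a2 : nbhs (0 : R) [set s | B (e (0, s))] by apply: cont_nbhs (ec2 0) _; rewrite e0.
  change (nbhs (0 : R) [set t | A (ku t)]).
  apply: filterS2 a1 a2 => t /= /(_ _ (kuW t)) [//|Ct Bt].
  have : dover D x (e (0, t), ku t).1 by apply: BC.
  by move=> /eS2 /= ->; rewrite ku0; apply: nbhs_singleton.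
- by rewrite ku0 ko0.
- move=> [a b] z; split=> /=; last by move=> [[-> ->]|[-> ->]].
  move=> Wz; have /eqP : a * b = 0.
    by apply/(eS1 (a, b)); have [-> _ _] := WD (e (a, b)); exists z.
  rewrite mulf_eq0; have [a0|a0] := eqVneq a 0; last first.
    by move=> /= /eqP b0; left; split=> //; apply/kos => //; rewrite -b0.
  move=> _; have [b0|b0] := eqVneq b 0.
    by move: Wz; rewrite a0 b0 e0 => /zP[] ->; [right|left]; rewrite ?ko0 ?ku0.
  by right; split=> //; apply/kus => //; rewrite -a0.
Qed.

End Heights.

Section Vertical.
Variable R : realType.
Local Notation plane := (R * R)%type.

Definition sup_norm (u : plane) : R := Num.max `|u.1| `|u.2|.

Lemma cont_sup_norm (T : topologicalType) (f : T -> plane) : continuous f ->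
  continuous (fun t => sup_norm (f t)).
Proof. by move=> cf; rewrite /sup_norm; ct. Qed.

Lemma sup_norm_le u a : (sup_norm u <= a) = (`|u.1| <= a) && (`|u.2| <= a).
Proof. by rewrite /sup_norm ge_max. Qed.

Lemma sup_norm_lt u a : (sup_norm u < a) = (`|u.1| < a) && (`|u.2| < a).
Proof. by rewrite /sup_norm gt_max. Qed.

Lemma compact_square (a : R) : compact [set u : plane | sup_norm u <= a].
Proof.
have -> : [set u : plane | sup_norm u <= a] = `[- a, a]%classic `*` `[- a, a]%classic.
  by apply/seteqP; split=> -[x y] /=; rewrite sup_norm_le !in_itv /= !ler_norml;
    [move=> /andP[-> ->]|move=> [-> ->]].
by apply: compact_setX; apply: segment_compact.
Qed.

Variables (W W' : set (plane * R)) (D : diagram plane).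
Hypotheses (WD : presents W D) (WD' : presents W' D).

(** Used on points of the link: it separates the two strands at a crossing and holds for the single
    strand at a simple point, so one matching rule serves both cases. *)
Let top (V : set (plane * R)) x z := forall y, V (x, y) -> y <= z.

(* The set of admissible maps at a point is convex, which allows one to glue
   the local constructions with a partition of unity. *)
Let admissible x (phi : R -> R) :=
  [/\ {homo phi : a b / a < b}, forall z, 1 <= `|z| -> phi z = z &
    forall z z', W (x, z) -> W' (x, z') -> (top W x z <-> top W' x z') ->
      phi z = z'].

(** A weight [w] with the unnormalized product [psi = w * phi]. Such pairs can be added, and
    [psi / w] is admissible wherever [w] is positive, so the partition of unity never has to be
    normalized beforehand. *)
Let datum (w : plane -> R) (psi : plane -> R -> R) :=
  [/\ continuous w, continuous (fun p : plane * R => psi p.1 p.2) &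
    forall x, (w x = 0 /\ forall z, psi x z = 0) \/
      (0 < w x /\ exists2 phi, admissible x phi & forall z, psi x z = w x * phi z)].

Let datum_ge0 w psi x : datum w psi -> 0 <= w x.
Proof. by move=> [_ _ /(_ x) [[-> _]|[/ltW]]]. Qed.

Let datum0 : datum (fun=> 0) (fun _ _ => 0).
Proof. by split; [ct|ct|left]. Qed.

Let datum_scale (c : plane -> R) w psi : continuous c -> (forall x, 0 <= c x) ->
  datum w psi -> datum (fun x => c x * w x) (fun x z => c x * psi x z).
Proof.
move=> cc c0 [cw cpsi wP]; split; [by ct| |].
  by apply: cont_mul => //; apply: cont_comp cc _; ct.
move=> x; have [[w0 p0]|[w0 [phi phiA phiE]]] := wP x.
  by left; split=> [|z]; rewrite ?w0 ?p0 mulr0.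
have := c0 x; rewrite le_eqVlt => /orP[/eqP <-|c1].
  by left; split=> [|z]; rewrite mul0r.
by right; split; [rewrite mulr_gt0|exists phi => // z; rewrite phiE mulrA].
Qed.

Let datum_add w psi w' psi' : datum w psi -> datum w' psi' ->
  datum (fun x => w x + w' x) (fun x z => psi x z + psi' x z).
Proof.
move=> [cw cpsi wP] [cw' cpsi' wP']; split; [by ct|by ct|].
move=> x; have [[w0 p0]|[w0 [phi [phi1 phi2 phi3] phiE]]] := wP x.
  have [[w0' p0']|[w0' [phi' phiA' phiE']]] := wP' x.
    by left; split=> [|z]; rewrite ?w0 ?w0' ?p0 ?p0' addr0.
  by right; rewrite w0 add0r; split=> //; exists phi' => // z; rewrite p0 add0r.
have [[w0' p0']|[w0' [phi' [phi1' phi2' phi3'] phiE']]] := wP' x.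
  by right; rewrite w0' addr0; split=> //; exists phi => // z; rewrite p0' addr0.
right; split; first exact: addr_gt0.
have s0 : w x + w' x != 0 by rewrite gt_eqF // addr_gt0.
exists (fun z => (w x * phi z + w' x * phi' z) / (w x + w' x)); last first.
  by move=> z; rewrite phiE phiE' mulrCA divff // mulr1.
split.
- move=> a b ab; rewrite ltr_pM2r ?invr_gt0 ?addr_gt0 //.
  by apply: ltrD; rewrite ltr_pM2l //; [apply: phi1|apply: phi1'].
- by move=> z z1; rewrite phi2 // phi2' // -mulrDl mulrC mulKf.
- by move=> z z' a b c; rewrite (phi3 _ _ a b c) (phi3' _ _ a b c) -mulrDl mulrC mulKf.
Qed.

Let datum_sum n (w : nat -> plane -> R) (psi : nat -> plane -> R -> R) :
  (forall i, datum (w i) (psi i)) ->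
  datum (fun x => \sum_(i < n) w i x) (fun x z => \sum_(i < n) psi i x z).
Proof.
move=> wP; elim: n => [|n IHn].
  have := datum0; congr datum; first by apply/funext => x; rewrite big_ord0.
  by apply/funext => x; apply/funext => z; rewrite big_ord0.
have := datum_add IHn (wP n).
congr datum; first by apply/funext => x; rewrite big_ord_recr.
by apply/funext => x; apply/funext => z; rewrite big_ord_recr.
Qed.

(** The weight is a pyramid of height [d] in the chart, extended by 0; its support is a compact
    square, as gluing requires. *)
Let chart_datum (e : plane -> plane) (m : plane -> R -> R) (d : R) :
  open_embedding e -> 0 < d -> continuous (fun p : plane * R => m p.1 p.2) ->
  (forall u, sup_norm u < d -> admissible (e u) (m u)) ->
  exists w psi, datum w psi /\ 0 < w (e (0, 0)).
Proof.
move=> ee d0 cm mA; have [ce ei eo] := ee.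
pose b (u : plane) : R := Num.max 0 (d - sup_norm u).
have cb : continuous b by rewrite /b; ct; apply: cont_sup_norm; ct.
have b0 u : d <= sup_norm u -> b u = 0.
  by move=> h; apply/max_idPl; rewrite subr_le0.
have bpos u : sup_norm u < d -> 0 < b u by rewrite lt_max subr_gt0 orbC => ->.
pose w := extend e b (fun=> 0).
pose psi := extend e (fun u z => b u * m u z) (fun _ _ => 0).
have out (y : plane) : ~ (e @` [set u | sup_norm u <= d]) y ->
    (exists2 u, e u = y & d <= sup_norm u) \/ ~ exists u, e u = y.
  move=> h; have [[u uy]|nu] := pselect (exists u, e u = y); [left|by right].
  by exists u => //; rewrite leNgt; apply/negP => /ltW h'; apply: h; exists u.
(* The second factor is a dummy, present only to fit [glue_cont]; it is removed along the
   diagonal. *)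
have cw2 : continuous (fun p : plane * plane => w p.1).
  apply: (@glue_cont _ _ _ _ e [set u | sup_norm u <= d]
    (fun p => b p.1) (fun=> 0)) => //.
  - exact: compact_square.
  - by apply: cont_comp cb _; ct.
  - by ct.
  - by move=> u z; rewrite /w extend_in.
  - by move=> y z /out [[u <- ud]|ny]; rewrite /w ?extend_in ?b0 ?extend_out.
have cw : continuous w.
  by apply: (cont_comp cw2 (g := fun x => (x, x))); ct.
exists w, psi; split; last first.
  by rewrite /w extend_in //; apply: bpos; rewrite sup_norm_lt /= normr0 d0.
split=> //.
- apply: (@glue_cont _ _ _ _ e [set u | sup_norm u <= d]
    (fun p => b p.1 * m p.1 p.2) (fun=> 0)) => //.
  + exact: compact_square.
  + by apply: cont_mul => //; apply: cont_comp cb _; ct.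
  + by ct.
  + by move=> u z; rewrite /psi extend_in.
  + by move=> y z /out [[u <- ud]|ny]; rewrite /psi ?extend_in ?b0 ?mul0r ?extend_out.
- move=> x; have [[u <-]|nx] := pselect (exists u, e u = x); last first.
    by left; split=> [|z]; rewrite ?/w ?/psi extend_out.
  rewrite /w /psi !extend_in //; have [ud|du] := ltP (sup_norm u) d.
    by right; split; [apply: bpos|exists (m u) => //; apply: mA].
  by left; rewrite (b0 _ du); split=> // z; rewrite mul0r.
Qed.

Let local_datum_out x : ~ dset D x -> exists w psi, datum w psi /\ 0 < w x.
Proof.
move=> nx; have [_ [cD _] Wx] := WD.
have : nbhs x (~` dset D) by apply: open_nbhs_nbhs; split; [exact: closed_openC|].
move=> /nbhs_planeP[d d0 dP].
pose e (u : plane) : plane := (x.1 + u.1, x.2 + u.2).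
have e0 : e (0, 0) = x by rewrite /e !addr0; case: x {nx dP e}.
rewrite -e0; apply: (chart_datum (m := fun _ z => z) (d := d)) => //.
- apply: homeo_embed; split; first by rewrite /e; ct.
  exists (fun v => (v.1 - x.1, v.2 - x.2)).
  by split; [ct| |] => -[a b]; rewrite /e /=; congr (_, _); lra.
- by ct.
- move=> u; rewrite sup_norm_lt => /andP[u1 u2]; split=> // z z' Wz _ _.
  have [h _ _] := Wx (e u).
  case: (dP (e u)); [by rewrite /e /= addrC addKr|by rewrite /e /= addrC addKr|].
  by apply/h; exists z.
Qed.

(** The breakpoints of [pl] are known to be ordered only near the centre of the chart; composing
    with this retraction onto a square makes them ordered everywhere. *)
Let clampu (d : R) (u : plane) : plane := (clamp (- d) d u.1, clamp (- d) d u.2).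

Let clampu_in d u : 0 < d -> sup_norm (clampu d u) <= d.
Proof.
move=> d0; rewrite sup_norm_le /= !ler_norml.
by rewrite !clamp_in //; lra.
Qed.

Let clampu_id d u : sup_norm u < d -> clampu d u = u.
Proof.
rewrite sup_norm_lt !ltr_norml => /andP[/andP[a b] /andP[a' b']].
by rewrite /clampu !clamp_id ?(ltW a, ltW b, ltW a', ltW b') //; case: u {a b a' b'}.
Qed.

Let heights_lt (V : set (plane * R)) E x z : presents V E -> V (x, z) -> -1 < z < 1.
Proof. by move=> [[_ sV] _ _] /sV; rewrite ltr_norml. Qed.

(** The local admissible map sends the heights [a < b] of one link to the heights [a' < b'] of the
    other, piecewise linearly, hence continuously in the parameters. *)
Let pl_datum (e : plane -> plane) (a b a' b' : plane -> R) :
  open_embedding e ->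
  continuous a -> continuous b -> continuous a' -> continuous b' ->
  (forall u, -1 < a u) -> (forall u, b u < 1) ->
  (forall u, -1 < a' u) -> (forall u, b' u < 1) ->
  a (0, 0) < b (0, 0) -> a' (0, 0) < b' (0, 0) ->
  (forall u z z', W (e u, z) -> W' (e u, z') -> (top W (e u) z <-> top W' (e u) z') ->
     z = a u /\ z' = a' u \/ z = b u /\ z' = b' u) ->
  exists w psi, datum w psi /\ 0 < w (e (0, 0)).
Proof.
move=> ee ca cb ca' cb' a1 b1 a1' b1' ab ab' match_.
have near_lt (f g : plane -> R) : continuous f -> continuous g ->
    f (0, 0) < g (0, 0) -> exists2 d, 0 < d & forall u, sup_norm u <= d -> f u < g u.
  move=> cf cg fg.
  have : nbhs ((0, 0) : plane) [set u | 0 < g u - f u].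
    have h : continuous (fun u => g u - f u) by ct.
    apply: (cont_nbhs (A := [set x : R | 0 < x]) (h (0, 0))).
    by apply: open_nbhs_nbhs; split; [exact: open_gt|rewrite /= subr_gt0].
  move=> /nbhs_planeP[d d0 dP]; exists (d / 2); first by lra.
  move=> u; rewrite sup_norm_le => /andP[u1 u2]; rewrite -subr_gt0.
  by apply: dP; rewrite /= subr0; lra.
have [d1 d10 abd] := near_lt _ _ ca cb ab.
have [d2 d20 abd'] := near_lt _ _ ca' cb' ab'.
pose d := Num.min d1 d2.
have d0 : 0 < d by rewrite lt_min d10.
have cc : continuous (clampu d) by rewrite /clampu; ct.
have ok u : pl_ok (a (clampu d u)) (b (clampu d u)) (a' (clampu d u)) (b' (clampu d u)).
  have := clampu_in u d0; rewrite {2}/d le_min => /andP[h1 h2].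
  by split; [exact: a1|exact: abd|exact: b1|split; [exact: a1'|exact: abd'|exact: b1']].
apply: (chart_datum (m := fun u => pl (a (clampu d u)) (b (clampu d u))
                                      (a' (clampu d u)) (b' (clampu d u)))
                    (d := d)) => //.
- have cc' : continuous (fun p : plane * R => clampu d p.1) by apply: cont_comp cc _; ct.
  apply: cont_pl; first [by apply: cont_comp cc' |by ct |by move=> p; case: (ok p.1)].
- move=> u ud; split.
  + exact: pl_incr.
  + by move=> z; apply: pl_out.
  + move=> z z' Wz Wz' tt; have := ok u; rewrite clampu_id // => oku.
    by case: (match_ u z z' Wz Wz' tt) => -[-> ->]; [apply: pl_a|apply: pl_b].
Qed.

Let local_datum x : exists w psi, datum w psi /\ 0 < w x.
Proof.
have [Dx|] := pselect (dset D x); last exact: local_datum_out.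
have [_ [_ /(_ x Dx) [[e [ee <- eS]]|[e [ee e0 eS]]]] _] := WD.
  have [k ck kP] := simple_heights WD ee eS.
  have [k' ck' kP'] := simple_heights WD' ee eS.
  have k1 s : -1 < k s < 1 by apply: (heights_lt (x := e (s, 0)) WD); apply/kP.
  have k1' s : -1 < k' s < 1 by apply: (heights_lt (x := e (s, 0)) WD'); apply/kP'.
  have ck2 : continuous (fun u : plane => k u.1) by apply: cont_comp ck _; ct.
  have ck2' : continuous (fun u : plane => k' u.1) by apply: cont_comp ck' _; ct.
  (* There is one strand only; the second breakpoint is a filler, halfway between the strand and
     height 1. *)
  apply: (@pl_datum e (fun u => k u.1) (fun u => (1 + k u.1) / 2)
    (fun u => k' u.1) (fun u => (1 + k' u.1) / 2)) => //.
  - by ct.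
  - by ct.
  - by move=> u; case/andP: (k1 u.1).
  - by move=> u; case/andP: (k1 u.1) => *; lra.
  - by move=> u; case/andP: (k1' u.1).
  - by move=> u; case/andP: (k1' u.1) => *; lra.
  - by case/andP: (k1 0) => *; lra.
  - by case/andP: (k1' 0) => *; lra.
  - by move=> u z z' /kP[_ ->] /kP'[_ ->] _; left.
rewrite -{1}e0.
have [ko [ku [cko cku k0 kP]]] := crossing_heights WD ee e0 eS.
have [ko' [ku' [cko' cku' k0' kP']]] := crossing_heights WD' ee e0 eS.
have ko1 s : -1 < ko s < 1 by apply: (heights_lt (x := e (s, 0)) WD); apply/kP; left.
have ku1 s : -1 < ku s < 1 by apply: (heights_lt (x := e (0, s)) WD); apply/kP; right.
have ko1' s : -1 < ko' s < 1 by apply: (heights_lt (x := e (s, 0)) WD'); apply/kP'; left.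
have ku1' s : -1 < ku' s < 1 by apply: (heights_lt (x := e (0, s)) WD'); apply/kP'; right.
apply: (@pl_datum e (fun u => ku u.2) (fun u => ko u.1)
    (fun u => ku' u.2) (fun u => ko' u.1)) => //.
- by apply: cont_comp cku _; ct.
- by apply: cont_comp cko _; ct.
- by apply: cont_comp cku' _; ct.
- by apply: cont_comp cko' _; ct.
- by move=> u; case/andP: (ku1 u.2).
- by move=> u; case/andP: (ko1 u.1).
- by move=> u; case/andP: (ku1' u.2).
- by move=> u; case/andP: (ko1' u.1).
(* An over strand can face an under strand in the matching only above the crossing itself, where
   comparing [top] on the two sides excludes it. *)
have topo : top W (e (0, 0)) (ko 0).
  by move=> y /kP /= [[_ ->]|[_ ->]] //; apply: ltW.
have topo' : top W' (e (0, 0)) (ko' 0).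
  by move=> y /kP' /= [[_ ->]|[_ ->]] //; apply: ltW.
have topu : ~ top W (e (0, 0)) (ku 0).
  by move=> /(_ (ko 0)) h; move: k0; rewrite ltNge h //; apply/kP; left.
have topu' : ~ top W' (e (0, 0)) (ku' 0).
  by move=> /(_ (ko' 0)) h; move: k0'; rewrite ltNge h //; apply/kP'; left.
move=> [u1 u2] z z' /kP /= [] [u0 ->] /kP' /= [] [u0' ->] tt;
  [by right| | |by left]; move: tt; rewrite u0 u0' => tt.
- by case: topu'; apply/tt.
- by case: topu; apply/tt.
Qed.

Let square_datum (n : nat) :
  exists w psi, datum w psi /\ forall x, sup_norm x <= n%:R -> 0 < w x.
Proof.
have [w wP] := choice local_datum; have [psi pP] := choice wP.
have [t tP] : exists t : seq plane, forall x, sup_norm x <= n%:R ->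
    exists2 y, y \in t & 0 < w y x.
  (* The filter of properties that hold for all finite sequences containing a given one. The
     near-covering form of compactness, applied to it, extracts a finite subcover. *)
  pose F : set_system (seq plane) :=
    [set P | exists s : seq plane, forall t : seq plane, {subset s <= t} -> P t].
  have FF : Filter F.
    split; first by exists [::].
    - move=> P Q [s sP] [t tQ]; exists (s ++ t) => r str; split.
        by apply: sP => y ys; apply: str; rewrite mem_cat ys.
      by apply: tQ => y yt; apply: str; rewrite mem_cat yt orbT.
    - by move=> P Q PQ [s sP]; exists s => t /sP /PQ.
  have /compact_near_coveringP cK := @compact_square n%:R.
  have [] := cK _ F (fun s x => exists2 y, y \in s & 0 < w y x) FF.
    move=> x _; have [[cw _ _] wx] := pP x.
    exists ([set y | 0 < w x y], [set s : seq plane | x \in s]); last first.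
      by move=> [y s] /= [wy xs]; exists x.
    split; last by exists [:: x] => s /= h; apply: h; rewrite inE.
    apply: (cont_nbhs (A := [set z : R | 0 < z]) (cw x)).
    by apply: open_nbhs_nbhs; split; [exact: open_gt|].
  by move=> t /(_ t (fun _ h => h)) tP; exists t.
pose v i := nth (fun=> 0) (map w t) i.
pose q i := nth (fun _ _ => 0) (map psi t) i.
have vP i : datum (v i) (q i).
  rewrite /v /q; have [it|it] := ltnP i (size t).
    by rewrite !(nth_map (0, 0)) //; case: (pP (nth (0, 0) t i)).
  by rewrite !nth_default ?size_map.
exists (fun x => \sum_(i < size t) v i x), (fun x z => \sum_(i < size t) q i x z).
split; first exact: datum_sum.
move=> x /tP [y yt wy].
have yt' : (index y t < size t)%N by rewrite index_mem.
rewrite (bigD1 (Ordinal yt')) //= ltr_pwDl //.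
  by rewrite /v (nth_map (0, 0)) // nth_index.
by apply: sumr_ge0 => i _; apply: datum_ge0 (vP i).
Qed.

Lemma vertical_matching : exists m : plane -> R -> R,
  [/\ continuous (fun p : plane * R => m p.1 p.2),
      forall x, {homo m x : a b / a < b},
      forall x z, 1 <= `|z| -> m x z = z
    & forall x z, W (x, z) <-> W' (x, m x z)].
Proof.
have [w wP] := choice square_datum; have [psi pP] := choice wP.
(* Tents in the variable [sup_norm x], centred at the integers, make the sum locally finite. The
   shift to [n.+1] below ensures that the weight is positive on the whole support of the tent. *)
pose c (n : nat) (x : plane) : R := Num.max 0 (1 - `|sup_norm x - n%:R|).
have cc n : continuous (c n) by rewrite /c; ct; apply: cont_sup_norm; ct.
have c0 n x : 0 <= c n x by rewrite le_max lexx.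
pose v n x := c n x * w n.+1 x; pose q n x z := c n x * psi n.+1 x z.
have vP n : datum (v n) (q n) by apply: datum_scale => //; case: (pP n.+1).
pose V M x := \sum_(i < M) v i x; pose Q M x z := \sum_(i < M) q i x z.
have VP M : datum (V M) (Q M) by apply: datum_sum.
have cut M x : sup_norm x <= M%:R -> forall i, (M < i)%N -> c i x = 0.
  move=> xM i Mi; apply/max_idPl; rewrite subr_le0 distrC ler_normr.
  by apply/orP; left; have : M.+1%:R <= i%:R :> R; [rewrite ler_nat|rewrite -natr1; lra].
have stable M N x : sup_norm x <= M%:R -> (M < N)%N ->
    V N x = V M.+1 x /\ forall z, Q N x z = Q M.+1 x z.
  move=> xM; elim: N => // N IHN; rewrite ltnS leq_eqVlt => /orP[/eqP ->|MN] //.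
  have [h1 h2] := IHN MN; rewrite /V /Q big_ord_recr /= {2}/v (cut M) // mul0r addr0.
  by split=> [|z]; [exact: h1|rewrite big_ord_recr /= {2}/q (cut M) // mul0r addr0; exact: h2].
have sn0 x : 0 <= sup_norm x by rewrite le_max normr_ge0.
have Vpos M x : sup_norm x < M%:R -> 0 < V M x.
  move=> xM; pose n := Num.truncn (sup_norm x).
  have /andP[n1 n2] := truncn_itv (sn0 x); rewrite -/n in n1 n2.
  have nM : (n < M)%N by rewrite -(ltr_nat R); apply: le_lt_trans xM.
  rewrite /V (bigD1 (Ordinal nM)) //= ltr_pwDl //; last first.
    by apply: sumr_ge0 => i _; apply: datum_ge0 (vP i).
  rewrite mulr_gt0 //; last by have [_ h] := pP n.+1; apply: h; apply: ltW.
  by rewrite lt_max subr_gt0 ger0_norm ?subr_ge0 // ltrBlDl natr1 n2 orbT.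
(* [sup_norm x] is less than its integer part plus one, so by [stable] the partial sums no longer
   change at [x] from this index on. *)
pose N x := (Num.truncn (sup_norm x)).+2.
have NP x M : sup_norm x < M%:R -> V M.+1 x = V (N x) x /\ forall z, Q M.+1 x z = Q (N x) x z.
  move=> xM; have /andP[n1 n2] := truncn_itv (sn0 x).
  have le1 : (Num.truncn (sup_norm x) < M)%N by rewrite -(ltr_nat R); apply: le_lt_trans xM.
  apply: stable; first exact: ltW.
  by [].
pose m x z := Q (N x) x z / V (N x) x.
have Nlt x : sup_norm x < (N x)%:R.
  have /andP[_ n2] := truncn_itv (sn0 x); apply: lt_trans n2 _.
  by rewrite ltr_nat.
have adm x : admissible x (m x).
  have [_ _ /(_ x) [[h]|[h [phi phiA phiE]]]] := VP (N x).
    by have := Vpos _ _ (Nlt x); rewrite h ltxx.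
  suff -> : m x = phi by [].
  by apply/funext => z; rewrite /m phiE mulrC mulKf // gt_eqF.
exists m; split.
- move=> [x z].
  have [cV cQ _] := VP (N x).+1.
  have Vx := Vpos (N x).+1 x (lt_trans (Nlt x) _).
  have near_x : \forall p \near (x, z), sup_norm p.1 < (N x)%:R.
    have cs : continuous (fun p : plane * R => (N x)%:R - sup_norm p.1).
      by ct; apply: cont_sup_norm; ct.
    have : nbhs (x, z) [set p : plane * R | 0 < (N x)%:R - sup_norm p.1].
      apply: (cont_nbhs (A := [set t : R | 0 < t]) (cs (x, z))).
      by apply: open_nbhs_nbhs; split; [exact: open_gt|rewrite /= subr_gt0].
    by apply: filterS => p /=; rewrite subr_gt0.
  apply: (near_cont (g := fun p => Q (N x).+1 p.1 p.2 / V (N x).+1 p.1)).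
    by apply: filterS near_x => -[y t] /= /NP [-> h]; rewrite h.
  apply: continuousM; first exact: cQ.
  apply: continuousV; first by rewrite /= gt_eqF // Vx // ltr_nat.
  by apply: (continuous_comp (f := fst)); [exact: cvg_fst|exact: cV].
- by move=> x; case: (adm x).
- by move=> x; case: (adm x).
- move=> x z; have [mi _ mm] := adm x.
  have [_ dD W1] := WD; have [_ _ W1'] := WD'.
  have [W1x W2x W3x] := W1 x; have [W1x' W2x' W3x'] := W1' x.
  have inj : injective (m x) by apply: inc_inj; apply: le_mono.
  (* Admissibility only says where matched pairs go; an equivalence also needs every point of either
     link to have a partner with the same [top] status. *)
  have tot z0 : dset D x -> (W (x, z0) -> exists z', W' (x, z') /\ (top W x z0 <-> top W' x z')) /\
      (W' (x, z0) -> exists z', W (x, z') /\ (top W x z' <-> top W' x z0)).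
    move=> Dx; have [s|cr] := dD.2 _ Dx.
      have [a aP] := W2x s; have [a' aP'] := W2x' s.
      have ta : top W x a by move=> y /aP ->.
      have ta' : top W' x a' by move=> y /aP' ->.
      by split=> [/aP ->|/aP' ->]; [exists a'|exists a]; split; by [apply/aP|apply/aP'|].
    have [a [b [ab aP _ _]]] := W3x cr; have [a' [b' [ab' aP' _ _]]] := W3x' cr.
    have tb : top W x b by move=> y /aP [] ->; [apply: ltW|].
    have tb' : top W' x b' by move=> y /aP' [] ->; [apply: ltW|].
    have ta : ~ top W x a by move=> /(_ b) h; move: ab; rewrite ltNge h //; apply/aP; right.
    have ta' : ~ top W' x a' by move=> /(_ b') h; move: ab'; rewrite ltNge h //; apply/aP'; right.
    split=> [/aP|/aP'] [] ->.
    - by exists a'; split; [apply/aP'; left|].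
    - by exists b'; split; [apply/aP'; right|].
    - by exists a; split; [apply/aP; left|].
    - by exists b; split; [apply/aP; right|].
  split=> [Wz|W'z].
    have Dx : dset D x by apply/W1x; exists z.
    have [/(_ Wz) [z' [Wz' tt]] _] := tot z Dx.
    by rewrite (mm _ _ Wz Wz' tt).
  have Dx : dset D x by apply/W1x'; exists (m x z).
  have [_ /(_ W'z) [z' [Wz' tt]]] := tot (m x z) Dx.
  by rewrite -(inj _ _ (mm _ _ Wz' W'z tt)).
Qed.

End Vertical.

(** * Lattices of the hyperbolic plane *)

Section Lorentz.
Variable R : realType.
Implicit Types (A B : 'M[R]_3) (u v : 'cV[R]_3) (p q r : hplane R).

Lemma minkE u v :
  mink u v = - (u 0 0 * v 0 0) + u 1 0 * v 1 0 + u 2 0 * v 2 0.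
Proof.
rewrite /mink /lorentz_form mul_mx_diag mxE !big_ord_recl big_ord0 !mxE /= addr0.
have -> : lift ord0 ord0 = 1 :> 'I_3 by apply/val_inj.
have -> : lift ord0 (lift ord0 ord0) = 2 :> 'I_3 by apply/val_inj.
by rewrite mulr1 mulrN1 mulNr mulr1 addrA.
Qed.

Lemma sheetE p : [/\ sheet p 0 0 = Num.sqrt (1 + p.1 ^+ 2 + p.2 ^+ 2),
  sheet p 1 0 = p.1 & sheet p 2 0 = p.2].
Proof. by rewrite /sheet !mxE. Qed.

Lemma lorentz_sqr : lorentz_form R *m lorentz_form R = 1%:M.
Proof.
apply/matrixP => i j; rewrite /lorentz_form mul_mx_diag !mxE.
by case: i => [[|[|[|i]]] hi] //; case: j => [[|[|[|j]]] hj] //=;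
  rewrite ?mulr0n ?mulr1n ?mul0r ?mulr1 ?mulrNN ?mulr1.
Qed.

Lemma mink_isometry A u v : Defs.isometry A -> mink (A *m u) (A *m v) = mink u v.
Proof.
move=> [hA _]; rewrite /mink trmx_mul -!mulmxA (mulmxA (lorentz_form R)).
by rewrite (mulmxA A^T) (mulmxA A^T) hA.
Qed.

Lemma isometry_inverse A : Defs.isometry A ->
  A *m (lorentz_form R *m A^T *m lorentz_form R) = 1%:M.
Proof.
move=> [hA _]; apply: mulmx1C.
by rewrite -!mulmxA (mulmxA A^T) hA lorentz_sqr.
Qed.

Lemma isometry_unit A : Defs.isometry A -> A \in unitmx.
Proof. by move=> /isometry_inverse /mulmx1_unit []. Qed.

Lemma isometry_invmx A : Defs.isometry A ->
  invmx A = lorentz_form R *m A^T *m lorentz_form R.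
Proof.
move=> hA; rewrite -[LHS]mulmx1 -(isometry_inverse hA).
by rewrite mulKmx // isometry_unit.
Qed.

Lemma isometry_row A : Defs.isometry A -> A 0 0 ^+ 2 = 1 + A 0 1 ^+ 2 + A 0 2 ^+ 2.
Proof.
move=> hA; have : A *m lorentz_form R *m A^T = lorentz_form R.
  have := isometry_inverse hA; rewrite !mulmxA => /(congr1 (fun M => M *m lorentz_form R)).
  by rewrite -!mulmxA lorentz_sqr mulmx1 mul1mx !mulmxA.
move=> /matrixP/(_ 0 0); rewrite /lorentz_form mul_mx_diag mxE !big_ord_recl big_ord0 !mxE /=.
have -> : lift ord0 ord0 = 1 :> 'I_3 by apply/val_inj.
have -> : lift ord0 (lift ord0 ord0) = 2 :> 'I_3 by apply/val_inj.
rewrite !expr2 mulr1n; lra.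
Qed.

Definition upper u := mink u u = -1 /\ 0 < u 0 0.

Lemma sheet_upper p : upper (sheet p).
Proof.
have [h0 h1 h2] := sheetE p.
have s0 : 0 < 1 + p.1 ^+ 2 + p.2 ^+ 2 by rewrite -addrA ltr_pwDl // addr_ge0 // sqr_ge0.
split; last by rewrite h0 sqrtr_gt0.
by rewrite minkE h0 h1 h2 -expr2 sqr_sqrtr ?ltW // !expr2; lra.
Qed.

Lemma upper_sheet u : upper u -> u = sheet (u 1 0, u 2 0).
Proof.
move=> [hu u0]; have [h0 h1 h2] := sheetE (u 1 0, u 2 0).
have e0 : u 0 0 = sheet (u 1 0, u 2 0) 0 0.
  rewrite h0 /=; move: hu; rewrite minkE => hu.
  have -> : 1 + u 1 0 ^+ 2 + u 2 0 ^+ 2 = u 0 0 ^+ 2 by rewrite !expr2; lra.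
  by rewrite sqrtr_sqr gtr0_norm.
apply/matrixP => i j; rewrite (ord1 j).
case: i => [[|[|[|i]]] hi] //.
- by rewrite (_ : Ordinal hi = 0) ?e0 //; apply/val_inj.
- by rewrite (_ : Ordinal hi = 1) ?h1 //; apply/val_inj.
- by rewrite (_ : Ordinal hi = 2) ?h2 //; apply/val_inj.
Qed.

(** The first row [(a, b, c)] of [A] and the vector [(x, y, z)] satisfy [a^2 = 1 + b^2 + c^2] and
    [x^2 = 1 + y^2 + z^2] with [a], [x] positive, so by Cauchy-Schwarz [a x] dominates
    [b y + c z]. *)
Lemma isometry_upper A u : Defs.isometry A -> upper u -> upper (A *m u).
Proof.
move=> hA [hu u0]; split; first by rewrite mink_isometry.
have r := isometry_row hA; case: (hA) => _ a0.
move: hu; rewrite minkE => hu.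
have -> : (A *m u) 0 0 = A 0 0 * u 0 0 + (A 0 1 * u 1 0 + A 0 2 * u 2 0).
  rewrite mxE !big_ord_recl big_ord0 addr0.
  have -> : lift ord0 ord0 = 1 :> 'I_3 by apply/val_inj.
  by have -> : lift ord0 (lift ord0 ord0) = 2 :> 'I_3 by apply/val_inj.
move: r a0 u0 hu; rewrite !expr2.
set a := A 0 0; set b := A 0 1; set c := A 0 2.
set x := u 0 0; set y := u 1 0; set z := u 2 0 => r a0 x0 hu.
have ax : 0 < a * x by apply: mulr_gt0.
rewrite ltNge; apply/negP => h.
have h2 : (a * x) ^+ 2 <= (b * y + c * z) ^+ 2.
  by rewrite -(sqrrN (b * y + c * z)) ler_sqr ?nnegrE; lra.
have e : (a * x) ^+ 2 = (1 + b * b + c * c) * (1 + y * y + z * z).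
  by rewrite exprMn !expr2 r; congr (_ * _); lra.
have cs : (b * y + c * z) ^+ 2 + (b * z - c * y) ^+ 2 = (b * b + c * c) * (y * y + z * z).
  by ring.
have s : 0 <= (b * z - c * y) ^+ 2 by rewrite sqr_ge0.
have sb : 0 <= b * b by rewrite -expr2 sqr_ge0.
have sc : 0 <= c * c by rewrite -expr2 sqr_ge0.
have sy : 0 <= y * y by rewrite -expr2 sqr_ge0.
have sz : 0 <= z * z by rewrite -expr2 sqr_ge0.
nra.
Qed.

Lemma sheet_act A p : Defs.isometry A -> sheet (act A p) = A *m sheet p.
Proof.
by move=> hA; rewrite [RHS](upper_sheet (isometry_upper hA (sheet_upper p))).
Qed.

Lemma isometry1 : Defs.isometry (1%:M : 'M[R]_3).
Proof. by split; [rewrite trmx1 mul1mx mulmx1|rewrite mxE]. Qed.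

Lemma isometryM A B : Defs.isometry A -> Defs.isometry B -> Defs.isometry (A *m B).
Proof.
move=> hA hB; split.
  case: hA hB => hA _ [hB _].
  by rewrite trmx_mul -!mulmxA (mulmxA (lorentz_form R)) (mulmxA A^T) (mulmxA A^T) hA mulmxA.
have [_] := isometry_upper hA (isometry_upper hB (sheet_upper (0, 0))).
congr (0 < _); rewrite mulmxA mxE !big_ord_recl big_ord0.
have [h0 h1 h2] := sheetE (0, 0).
have -> : lift ord0 ord0 = 1 :> 'I_3 by apply/val_inj.
have -> : lift ord0 (lift ord0 ord0) = 2 :> 'I_3 by apply/val_inj.
by rewrite h0 h1 h2 /= !mulr0 !addr0 !expr0n /= !addr0 sqrtr1 mulr1.
Qed.

Lemma isometryV A : Defs.isometry A -> Defs.isometry (invmx A).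
Proof.
move=> hA; have uA := isometry_unit hA; split; last first.
  rewrite isometry_invmx // /lorentz_form mul_mx_diag mul_diag_mx !mxE /=.
  by case: hA => _; rewrite mulN1r mulrN1 opprK.
case: hA => hA _; rewrite -{1}hA trmx_inv -!mulmxA mulmxV // mulmx1.
by rewrite mulmxA mulVmx ?mul1mx // unitmx_tr.
Qed.

Lemma act1 p : act 1%:M p = p.
Proof. by rewrite /act mul1mx; have [_ -> ->] := sheetE p; case: p. Qed.

Lemma actM A B p : Defs.isometry A -> Defs.isometry B -> act (A *m B) p = act A (act B p).
Proof. by move=> hA hB; rewrite {2}/act sheet_act // mulmxA. Qed.

Lemma cont_act A : continuous (act A).
Proof.
have cs : continuous (fun p : hplane R => Num.sqrt (1 + p.1 ^+ 2 + p.2 ^+ 2)).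
  apply: (cont_comp (f := Num.sqrt)) => [x|]; first exact: sqrt_continuous.
  by rewrite (_ : (fun x : hplane R => _) = fun x => 1 + x.1 * x.1 + x.2 * x.2);
    [ct|apply/funext => x; rewrite !expr2].
have ce i : continuous (fun p => (A *m sheet p) i 0).
  have -> : (fun p => (A *m sheet p) i 0) = fun p : hplane R =>
      A i 0 * Num.sqrt (1 + p.1 ^+ 2 + p.2 ^+ 2) + (A i 1 * p.1 + A i 2 * p.2).
    apply/funext => p; have [h0 h1 h2] := sheetE p.
    rewrite mxE !big_ord_recl big_ord0 addr0.
    have -> : lift ord0 ord0 = 1 :> 'I_3 by apply/val_inj.
    have -> : lift ord0 (lift ord0 ord0) = 2 :> 'I_3 by apply/val_inj.
    by rewrite h0 h1 h2.
  by apply: cont_add; [apply: cont_mul => //; ct|ct].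
by apply: cont_pair; apply: ce.
Qed.

(* The hyperbolic cosine of the distance. *)
Definition coshd p q := - mink (sheet p) (sheet q).

Lemma coshd_act A p q : Defs.isometry A -> coshd (act A p) (act A q) = coshd p q.
Proof. by move=> hA; rewrite /coshd !sheet_act // mink_isometry. Qed.

Lemma coshdC p q : coshd p q = coshd q p.
Proof. by rewrite /coshd !minkE; lra. Qed.

(* The Gram determinant of three vectors is nonpositive in signature (2, 1). *)
Lemma coshd_triangle p q r :
  (coshd p r - coshd p q * coshd q r) ^+ 2 <=
  (coshd p q ^+ 2 - 1) * (coshd q r ^+ 2 - 1).
Proof.
have [hp _] := sheet_upper p; have [hq _] := sheet_upper q; have [hr _] := sheet_upper r.
rewrite /coshd; move: hp hq hr; rewrite !minkE.
set a := sheet p 0 0; set b := sheet p 1 0; set c := sheet p 2 0.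
set a' := sheet q 0 0; set b' := sheet q 1 0; set c' := sheet q 2 0.
set a2 := sheet r 0 0; set b2 := sheet r 1 0; set c2 := sheet r 2 0.
move=> hp hq hr; rewrite -subr_ge0.
set d := a * (b' * c2 - b2 * c') - a' * (b * c2 - b2 * c) + a2 * (b * c' - b' * c).
suff -> : (((- (- (a * a') + b * b' + c * c')) ^+ 2 - 1) *
     ((- (- (a' * a2) + b' * b2 + c' * c2)) ^+ 2 - 1) -
     (- (- (a * a2) + b * b2 + c * c2) -
       - (- (a * a') + b * b' + c * c') * - (- (a' * a2) + b' * b2 + c' * c2)) ^+ 2) = d ^+ 2.
  exact: sqr_ge0.
pose P := - (a * a) + b * b + c * c; pose Q := - (a' * a') + b' * b' + c' * c'.
pose S := - (a2 * a2) + b2 * b2 + c2 * c2.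
pose x := - (a * a') + b * b' + c * c'; pose y := - (a' * a2) + b' * b2 + c' * c2.
pose z := - (a * a2) + b * b2 + c * c2.
have gram : d ^+ 2 = - (P * (Q * S - y * y) - x * (x * S - y * z) + z * (x * y - Q * z)).
  by rewrite /d /P /Q /S /x /y /z; ring.
by rewrite gram -/x -/y -/z /P /Q /S hp hq hr; ring.
Qed.

(** The second bound compares hyperbolic and coordinate distances locally uniformly. It rests on a
    Lagrange identity expressing [(s t)^2], where [s] and [t] are the hyperbolic cosines of the
    distances of [p] and [q] to the origin. *)
Lemma coshd_ge1 p q : 1 <= coshd p q /\
  (q.1 - p.1) ^+ 2 + (q.2 - p.2) ^+ 2 <=
    4 * (1 + p.1 ^+ 2 + p.2 ^+ 2) * (coshd p q * (coshd p q - 1)).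
Proof.
rewrite /coshd minkE; have [hp p0] := sheet_upper p; have [hq q0] := sheet_upper q.
move: hp p0 hq q0; rewrite !minkE.
have [_ -> ->] := sheetE p; have [_ -> ->] := sheetE q; rewrite !expr2.
move: (sheet p 0 0) (sheet q 0 0) => s t; case: p q => [a b] [a' b'] /=.
move=> hs s0 ht t0; pose ab := a * a' + b * b'.
have st0 : 0 < s * t by apply: mulr_gt0.
have key : (s * t) ^+ 2 =
    (1 + ab) ^+ 2 + ((a' - a) ^+ 2 + (b' - b) ^+ 2) + (a * b' - b * a') ^+ 2.
  have -> : (s * t) ^+ 2 = (1 + a * a + b * b) * (1 + a' * a' + b' * b').
    have -> : 1 + a * a + b * b = s * s by lra.
    have -> : 1 + a' * a' + b' * b' = t * t by lra.
    by ring.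
  by rewrite /ab; ring.
have d0 : 0 <= (a' - a) ^+ 2 + (b' - b) ^+ 2 by rewrite addr_ge0 // sqr_ge0.
have x0 : 0 <= (a * b' - b * a') ^+ 2 by rewrite sqr_ge0.
have le1 : 1 + ab <= s * t.
  rewrite leNgt; apply/negP => h.
  have : (s * t) ^+ 2 < (1 + ab) ^+ 2 by rewrite ltr_sqr ?nnegrE; lra.
  lra.
pose B := s * t - ab.
have BE : - (- (s * t) + a * a' + b * b') = B by rewrite /B /ab; lra.
have B1 : 1 <= B by rewrite /B; lra.
rewrite BE; split=> //.
(* The triangle inequality through [p], weakened by [cosh (x + y) <= 2 cosh x cosh y]; it removes
   [q] from the bound. *)
have tB : t <= 2 * s * B.
  suff h : 2 * s * ab <= (2 * s * s - 1) * t by rewrite /B; nra.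
  have s1 : 1 <= s * s by have := sqr_ge0 a; have := sqr_ge0 b; rewrite !expr2; lra.
  have r0 : 0 <= (2 * s * s - 1) * t by apply: mulr_ge0; lra.
  rewrite leNgt; apply/negP => h.
  have h2 : ((2 * s * s - 1) * t) ^+ 2 < (2 * s * ab) ^+ 2 by rewrite ltr_sqr ?nnegrE; lra.
  have cs : ab ^+ 2 <= (s * s - 1) * (t * t - 1).
    have -> : (s * s - 1) * (t * t - 1) = (a * a + b * b) * (a' * a' + b' * b').
      by congr (_ * _); lra.
    by rewrite -subr_ge0; have -> : (a * a + b * b) * (a' * a' + b' * b') - ab ^+ 2
      = (a * b' - b * a') ^+ 2 by rewrite /ab; ring.
  have e1 : (2 * s * ab) ^+ 2 = 4 * (s * s) * ab ^+ 2 by ring.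
  have e2 : ((2 * s * s - 1) * t) ^+ 2 =
    4 * (s * s) * ((s * s - 1) * (t * t - 1)) + 4 * (s * s) * (s * s - 1) + t * t by ring.
  have : 4 * (s * s) * ab ^+ 2 <= 4 * (s * s) * ((s * s - 1) * (t * t - 1)).
    by rewrite ler_pM2l //; lra.
  have : 0 <= 4 * (s * s) * (s * s - 1) by apply: mulr_ge0; lra.
  have : 0 < t * t by apply: mulr_gt0.
  lra.
have f1 : (a' - a) ^+ 2 + (b' - b) ^+ 2 <= (B - 1) * (2 * (s * t)).
  have -> : (a' - a) ^+ 2 + (b' - b) ^+ 2 =
      (B - 1) * (2 * (s * t) - (B - 1)) - (a * b' - b * a') ^+ 2.
    by rewrite /B; move: key; rewrite !expr2; lra.
  have : 0 <= (B - 1) * (B - 1) by rewrite -expr2 sqr_ge0.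
  lra.
have f2 : (B - 1) * (2 * (s * t)) <= (B - 1) * (2 * (s * (2 * s * B))).
  apply: ler_wpM2l; first by lra.
  by rewrite ler_pM2l // ler_pM2l.
have f3 : (B - 1) * (2 * (s * (2 * s * B))) = 4 * (1 + a * a + b * b) * (B * (B - 1)).
  have -> : 1 + a * a + b * b = s * s by lra.
  by ring.
move: f1; rewrite !expr2; lra.
Qed.

Lemma coshd_self p : coshd p p = 1.
Proof. by rewrite /coshd; have [-> _] := sheet_upper p; rewrite opprK. Qed.

Lemma coshd_eq1 p q : coshd p q = 1 -> p = q.
Proof.
move=> h; have [_] := coshd_ge1 p q; rewrite h subrr !mulr0 => le.
have : (q.1 - p.1) ^+ 2 = 0 by apply/eqP; rewrite eq_le sqr_ge0 andbT (le_trans _ le) // lerDl sqr_ge0.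
have : (q.2 - p.2) ^+ 2 = 0 by apply/eqP; rewrite eq_le sqr_ge0 andbT (le_trans _ le) // lerDr sqr_ge0.
move=> /eqP; rewrite sqrf_eq0 subr_eq0 => /eqP e2 /eqP; rewrite sqrf_eq0 subr_eq0 => /eqP e1.
by rewrite [p]surjective_pairing [q]surjective_pairing e1 e2.
Qed.

Lemma cont_coshd p : continuous (coshd p).
Proof.
have -> : coshd p = fun q => sheet p 0 0 * Num.sqrt (1 + q.1 * q.1 + q.2 * q.2) -
    (sheet p 1 0 * q.1 + sheet p 2 0 * q.2).
  apply/funext => q; rewrite /coshd minkE; have [-> -> ->] := sheetE q.
  by rewrite !expr2; lra.
ct; apply: (cont_comp (f := Num.sqrt)) => [x|]; first exact: sqrt_continuous.
by ct.
Qed.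

Lemma nbhs_coshd p (N : set (hplane R)) : nbhs p N ->
  exists2 e, 0 < e & forall q, coshd p q < 1 + e -> N q.
Proof.
move=> /nbhs_planeP[d d0 dA].
pose C := 4 * (1 + p.1 ^+ 2 + p.2 ^+ 2).
have C0 : 0 < C.
  by rewrite /C mulr_gt0 // -addrA ltr_pwDl // addr_ge0 // sqr_ge0.
(* With [e <= 1] the factor [coshd p q] is below 2, so the bound of [coshd_ge1] is below
   [C * (2 * e)]. *)
pose e := Num.min 1 (d ^+ 2 / (2 * C)).
have e0 : 0 < e by rewrite lt_min ltr01 divr_gt0 ?exprn_gt0 //; lra.
have e1 : e <= 1 by rewrite ge_min lexx.
have eC : C * (2 * e) <= d ^+ 2.
  have : e <= d ^+ 2 / (2 * C) by rewrite ge_min lexx orbT.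
  by rewrite ler_pdivlMr; lra.
exists e => // q qe; have [B1 hB] := coshd_ge1 p q; rewrite -/C in hB.
have lt : C * (coshd p q * (coshd p q - 1)) < d ^+ 2.
  apply: lt_le_trans eC; rewrite ltr_pM2l //.
  by move: (coshd p q) B1 qe => B B1 qe; nra.
have s1 : 0 <= (q.1 - p.1) ^+ 2 by rewrite sqr_ge0.
have s2 : 0 <= (q.2 - p.2) ^+ 2 by rewrite sqr_ge0.
by apply: dA; rewrite -ltr_sqr ?nnegrE ?normr_ge0 ?(ltW d0) //
  -normrX ger0_norm //; lra.
Qed.

End Lorentz.

(** * Covering maps and the quotient of the plane by a lattice *)

Section Covering.
Variables E X : topologicalType.

(* Over a small open set [V] the map is trivialized by a locally constant
   labelling [l] of the sheets and by a section [s a] in the sheet labelled [a]. *)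
Definition covering (f : E -> X) := forall x, exists2 V, open_nbhs x V &
  exists (T : Type) (l : E -> T) (s : T -> X -> E),
    [/\ forall p, V (f p) -> s (l p) (f p) = p,
        forall p y, V (f p) -> V y -> f (s (l p) y) = y /\ l (s (l p) y) = l p,
        forall p y, V (f p) -> V y -> {for y, continuous (s (l p))}
      & forall p, V (f p) -> \forall q \near p, l q = l p].

End Covering.

Section LatticeCover.
Variables (R : realType) (L : set 'M[R]_3).
Hypothesis lat : lattice L.
Implicit Types (p q : hplane R).

Lemma lattice_isometry A : L A -> Defs.isometry A.
Proof.
have [[T sT ->] _ _ _] := lat; elim=> {A}.
- by move=> A /sT[].
- exact: isometry1.
- by move=> A B _ hA _ hB; apply: isometryM.
- by move=> A _ hA; apply: isometryV.
Qed.

Lemma lattice1 : L 1%:M.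
Proof. by have [[T sT ->] _ _ _] := lat; apply: gen_one. Qed.

Lemma latticeM A B : L A -> L B -> L (A *m B).
Proof. by have [[T sT ->] _ _ _] := lat; apply: gen_mul. Qed.

Lemma latticeV A : L A -> L (invmx A).
Proof. by have [[T sT ->] _ _ _] := lat; apply: gen_inv. Qed.

Lemma lattice_unit A : L A -> A \in unitmx.
Proof. by move=> /lattice_isometry /isometry_unit. Qed.

Lemma act_comp A B p : L A -> L B -> act A (act B p) = act (A *m B) p.
Proof. by move=> /lattice_isometry hA /lattice_isometry hB; rewrite actM. Qed.

Lemma actK A p : L A -> act (invmx A) (act A p) = p.
Proof.
move=> hA; rewrite act_comp ?mulVmx ?act1 //; first exact: lattice_unit.
exact: latticeV.
Qed.

Lemma actKV A p : L A -> act A (act (invmx A) p) = p.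
Proof.
move=> hA; rewrite act_comp ?mulmxV ?act1 //; first exact: lattice_unit.
exact: latticeV.
Qed.

Lemma act_open_map A : L A -> open_map (act A).
Proof.
move=> hA p N Np; have : nbhs (act A p) [set q | N (act (invmx A) q)].
  by apply: (cont_nbhs (f := act (invmx A)) (A := N)); [apply: cont_act|rewrite actK].
by apply: filterS => q Nq; exists (act (invmx A) q) => //; rewrite actKV.
Qed.

(** Since the lattice is a group, its orbit relation is already an equivalence and taking the
    closure adds nothing. *)
Lemma coverP p q : Defs.cover L p = Defs.cover L q <-> exists2 A, L A & q = act A p.
Proof.
split=> [|[A LA ->]]; last first.
  by apply/eqmodP => /=; apply/asboolP; apply: rst_step; exists A.
move=> /eqmodP /= /asboolP; elim=> {p q}.
- by move=> p q [A LA ->]; exists A.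
- by move=> p; exists 1%:M; [exact: lattice1|rewrite act1].
- move=> p q _ [A LA ->]; exists (invmx A); first exact: latticeV.
  by rewrite actK.
- move=> p q r _ [A LA ->] _ [B LB ->]; exists (B *m A); first exact: latticeM.
  by rewrite act_comp.
Qed.

Lemma cover_surj x : exists p, Defs.cover L p = x.
Proof. by exists (repr x); apply: reprK. Qed.

Lemma cont_cover : continuous (Defs.cover L).
Proof. exact: pi_continuous. Qed.

Lemma cover_open_map : open_map (Defs.cover L).
Proof.
apply/open_mapP => U oU.
change (open (Defs.cover L @^-1` (Defs.cover L @` U))).
rewrite openE => p [q Uq /coverP [A LA ->]].
have : nbhs (act A q) (act A @` U) by apply: act_open_map => //; apply: open_nbhs_nbhs.
apply: filterS => _ [r Ur <-]; exists r => //.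
by apply/coverP; exists A.
Qed.

Lemma wandering p : exists2 U, open_nbhs p U &
  forall A B u v, L A -> L B -> U u -> U v -> act A u = act B v -> A = B.
Proof.
have [_ _ /(_ p) [U Up UP] _] := lat; exists U => // A B u v LA LB Uu Uv uv.
apply: contrapT => AB.
have LBA : L (invmx B *m A) by apply: latticeM => //; apply: latticeV.
have n1 : invmx B *m A <> 1%:M.
  move=> /(congr1 (mulmx B)); rewrite mulmxA mulmxV ?mul1mx ?mulmx1 //.
  exact: lattice_unit.
have : (act (invmx B *m A) @` U `&` U) v.
  split=> //; exists u => //.
  by rewrite -act_comp ?uv ?actK //; apply: latticeV.
by rewrite UP.
Qed.

Lemma cover_local : local_homeo (Defs.cover L).
Proof.
split; [exact: cont_cover|exact: cover_open_map|].
move=> p; have [U Up UP] := wandering p; exists U => // u v.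
rewrite !inE => Uu Uv /coverP [A LA uv].
have := UP _ _ _ _ LA lattice1 Uu Uv; rewrite act1 -uv => /(_ erefl) A1.
by rewrite uv A1 act1.
Qed.

(** The sheets over the image of a wandering neighbourhood [U] are its translates, labelled by the
    elements of the lattice. *)
Lemma cover_covering : covering (Defs.cover L).
Proof.
move=> x; have [p0 <-] := cover_surj x.
have [U Up UP] := wandering p0; have [oU Up0] := Up.
have oV : open (Defs.cover L @` U) by apply: (open_mapP _).1 => //; exact: cover_open_map.
exists (Defs.cover L @` U); first by split=> //; exists p0.
have ex (y : surface L) : exists u, (Defs.cover L @` U) y -> U u /\ Defs.cover L u = y.
  have [[u Uu uy]|nU] := pselect ((Defs.cover L @` U) y); first by exists u.
  by exists p0 => /nU.
have [s sP] := choice ex.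
have sU y : (Defs.cover L @` U) y -> U (s y) by move=> /sP[].
have sc y : (Defs.cover L @` U) y -> Defs.cover L (s y) = y by move=> /sP[].
have exl p : exists A, L A /\ ((Defs.cover L @` U) (Defs.cover L p) -> p = act A (s (Defs.cover L p))).
  have [Vp|nV] := pselect ((Defs.cover L @` U) (Defs.cover L p)); last first.
    by exists 1%:M; split; [exact: lattice1|move=> /nV].
  by have [A LA pE] := (coverP _ _).1 (sc _ Vp); exists A; split=> // _.
have [l lP] := choice exl.
have Ll p : L (l p) by case: (lP p).
have lE p : (Defs.cover L @` U) (Defs.cover L p) -> p = act (l p) (s (Defs.cover L p)).
  by case: (lP p).
have luniq A u : L A -> U u -> l (act A u) = A.
  move=> LA Uu; have cu : Defs.cover L (act A u) = Defs.cover L u by apply/esym/coverP; exists A.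
  have Vu : (Defs.cover L @` U) (Defs.cover L (act A u)) by exists u.
  apply: (UP _ _ (s (Defs.cover L (act A u))) u) => //; first exact: sU.
  by rewrite -lE.
exists 'M[R]_3, l, (fun A y => act A (s y)); split.
- by move=> p /lE <-.
- move=> p y Vp Vy; split; last by apply: luniq => //; apply: sU.
  by rewrite -[RHS]sc //; apply/esym/coverP; exists (l p).
- move=> p y Vp Vy.
  apply: (@continuous_comp _ _ _ s (act (l p))); last exact: cont_act.
  move=> N Ns; have : nbhs y (Defs.cover L @` (N `&` U)).
    rewrite -[y]sc //; apply: cover_open_map; apply: filterI => //.
    by apply: open_nbhs_nbhs; split=> //; apply: sU.
  apply: filterS => _ [n [Nn Un] <-] /=.
  have Vn : (Defs.cover L @` U) (Defs.cover L n) by exists n.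
  have [A LA E] := (coverP _ _).1 (sc _ Vn).
  have := UP A 1%:M (s (Defs.cover L n)) n LA lattice1 (sU _ Vn) Un.
  by rewrite act1 -E => /(_ erefl) A1; move: E; rewrite A1 act1 => <-.
- move=> p Vp; have Us := sU _ Vp.
  have : nbhs (act (l p) (s (Defs.cover L p))) (act (l p) @` U).
    by apply: act_open_map => //; apply: open_nbhs_nbhs; split.
  by rewrite -lE //; apply: filterS => _ [u Uu <-]; rewrite luniq.
Qed.

(** At most one point of the orbit of [p] enters a wandering ball around [q], so this orbit stays at
    positive distance from [q]. Small balls around [p] and [q] then have disjoint images by the
    triangle inequality. *)
Lemma surface_hausdorff : hausdorff_space (surface L).
Proof.
rewrite open_hausdorff => x y; have [p <-] := cover_surj x.
have [q <-] := cover_surj y => /eqP pq.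
have ne A : L A -> act A p <> q.
  by move=> LA Apq; apply: pq; apply/coverP; exists A.
have [U Uq UP] := wandering q.
have [e e0 eU] := nbhs_coshd (open_nbhs_nbhs Uq).
have [e' e'0 e'P] : exists2 e', 0 < e' & forall A, L A -> 1 + e' <= coshd q (act A p).
  have [[A LA Ae]|nA] := pselect (exists2 A, L A & coshd q (act A p) < 1 + e).
    have ne1 : 1 < coshd q (act A p).
      rewrite lt_neqAle; have [-> _] := coshd_ge1 q (act A p); rewrite andbT.
      by apply/eqP => h; apply: (ne A LA); rewrite -(coshd_eq1 (esym h)).
    exists (coshd q (act A p) - 1); first by lra.
    move=> B LB; have [Be|] := ltP (coshd q (act B p)) (1 + e); last by lra.
    have UA := eU _ Ae; have UB := eU _ Be.
    suff -> : A = B by lra.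
    have LC : L (B *m invmx A) by apply: latticeM => //; apply: latticeV.
    have := UP _ _ _ _ LC lattice1 UA UB.
    rewrite act1 act_comp // -mulmxA mulVmx ?mulmx1; last exact: lattice_unit.
    move=> /(_ erefl) /(congr1 (mulmx^~ A)).
    by rewrite -mulmxA mulVmx ?mulmx1 ?mul1mx //; exact: lattice_unit.
  exists e => // A LA; rewrite leNgt; apply/negP => h; apply: nA; by exists A.
(* For two cosines [X'], [Y] in [[1, 1 + d[] with [d <= 1], each factor [X'^2 - 1], [Y^2 - 1] is at
   most [3 d], while [Z - X' Y] exceeds [e' - 3 d >= 5 d]: this contradicts [coshd_triangle]. *)
pose d := Num.min 1 (e' / 8).
have d0 : 0 < d by rewrite lt_min ltr01 /=; lra.
have d1 : d <= 1 by rewrite ge_min lexx.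
have d8 : d <= e' / 8 by rewrite ge_min lexx orbT.
have ob r : open [set r' | coshd r r' < 1 + d].
  by apply: (@open_comp _ _ (coshd r) [set t | t < 1 + d]) => [r' _|];
    [apply: cont_coshd|exact: open_lt].
have oc r : open (Defs.cover L @` [set r' | coshd r r' < 1 + d]).
  by apply: (open_mapP _).1 => //; exact: cover_open_map.
have self r : Defs.cover L r \in Defs.cover L @` [set r' | coshd r r' < 1 + d].
  by rewrite inE; exists r => //=; rewrite coshd_self; lra.
exists (Defs.cover L @` [set r' | coshd p r' < 1 + d], Defs.cover L @` [set r' | coshd q r' < 1 + d]).
  by [].
split; [exact: oc|exact: oc|apply/eqP]; rewrite -subset0 => _ [/= [p' pd <-] [q' qd qp]].
have [A LA qE] := (coverP _ _).1 (esym qp).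
have X1 := (coshd_ge1 q q').1.
have hY : coshd q' (act A p) = coshd p p'.
  by rewrite qE coshd_act; [exact: coshdC|exact: (lattice_isometry LA)].
have Y1 := (coshd_ge1 p p').1.
have := coshd_triangle q q' (act A p); rewrite hY.
have Z1 := e'P _ LA.
move: (coshd q (act A p)) (coshd q q') (coshd p p') Z1 X1 Y1 qd pd => Z X' Y Z1 X1 Y1 Xd Yd.
apply/negP; rewrite -ltNge.
have b1 : (X' ^+ 2 - 1) * (Y ^+ 2 - 1) <= (3 * d) ^+ 2.
  rewrite [leRHS]expr2; apply: ler_pM; rewrite ?expr2 ?subr_ge0; by [nra|].
apply: le_lt_trans b1 _.
have b2 : 3 * d < Z - X' * Y by nra.
by rewrite ltr_sqr ?nnegrE; lra.
Qed.

End LatticeCover.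

(** * Lifting isotopies *)

Section Lifting.
Variable R : realType.

(** If [P] failed somewhere, the set where it holds would have a supremum; the step taken at this
    supremum, from a point of the set just below it, goes beyond it. *)
Lemma real_induction (P : R -> Prop) :
  (forall b c, c <= b -> P b -> P c) -> (exists b, P b) ->
  (forall b, exists2 e, 0 < e & forall b', b - e < b' -> P b' -> P (b + e)) ->
  forall b, P b.
Proof.
move=> Pm [b0 Pb0] Ps c; apply: contrapT => nPc.
have ub : ubound [set b | P b] c.
  by move=> b Pb; rewrite leNgt; apply/negP => /ltW cb; apply: nPc; apply: Pm Pb.
have hs : has_sup [set b | P b] by split; [exists b0|exists c].
have [e e0 eP] := Ps (sup [set b | P b]).
have [b' Pb' b'e] := sup_adherent e0 hs.
have := ub_le_sup hs.2 (eP _ b'e Pb'); lra.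
Qed.

Variables (E X : topologicalType) (f : E -> X).
Hypotheses (cf : continuous f) (covf : covering f).

Lemma lift_unique (u v : R -> E) : continuous u -> continuous v ->
  (forall r, 0 <= r -> f (u r) = f (v r)) -> u 0 = v 0 ->
  forall r, 0 <= r -> u r = v r.
Proof.
move=> cu cv uv uv0.
suff h b : forall r, 0 <= r <= b -> u r = v r.
  by move=> r r0; apply: (h r); rewrite r0 lexx.
move: b; apply: real_induction.
- by move=> b c cb h r /andP[r0 rc]; apply: h; rewrite r0 (le_trans rc).
- by exists 0 => r /andP[r0 r1]; have -> : r = 0 by lra.
(* For negative [b] the step is chosen so that [b + e] is still negative, where nothing has to be
   checked. *)
move=> b; have [b0|b0] := ltP b 0.
  by exists (- b / 2); [lra|move=> b' _ _ r /andP[r0 r1]; exfalso; clear uv0; lra].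
have [V [oV Vb] [T [l [s [h1 h2 h3 h4]]]]] := covf (f (u b)).
have nV : \forall r \near b, V (f (u r)).
  apply: (cont_nbhs (f := fun r => f (u r))); last by apply: open_nbhs_nbhs.
  by apply: cont_comp.
have Vv : V (f (v b)) by rewrite -uv.
have nu : \forall r \near b, l (u r) = l (u b) := cont_nbhs (cu b) (h4 _ Vb).
have nv : \forall r \near b, l (v r) = l (v b) := cont_nbhs (cv b) (h4 _ Vv).
have [d d0 dP] := (nbhs_lineP _ _).1 (filterI nV (filterI nu nv)).
exists (d / 2); first by lra.
move=> b' bb' Pb'.
(* A time within the trivialized interval where the lifts already agree: it forces both to run in
   the same sheet there. *)
have [r0 [r00 r0b r0d ur0]] : exists r0, [/\ 0 <= r0, r0 <= b, `|r0 - b| < d & u r0 = v r0].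
  have [b'0|b'0] := leP 0 b'.
    exists (Num.min b b'); split; [by rewrite le_min b0|by rewrite ge_min lexx| |].
      by rewrite ltr_norml; have [] := leP b b' => *; apply/andP; split; lra.
    by apply: Pb'; rewrite le_min b0 b'0 ge_min lexx orbT.
  exists 0; split=> //; rewrite ltr_norml; apply/andP; split; lra.
have lb : l (u b) = l (v b).
  have [_ [<- <-]] : V (f (u r0)) /\ l (u r0) = l (u b) /\ l (v r0) = l (v b) by apply: dP.
  by rewrite ur0.
move=> r /andP[r1 r2]; have [rb'|rb'] := leP r b'; first by apply: Pb'; rewrite r1.
have [Vr [lu lv]] : V (f (u r)) /\ l (u r) = l (u b) /\ l (v r) = l (v b).
  by apply: dP; rewrite ltr_norml; apply/andP; split; lra.
by rewrite -(h1 _ Vr) lu lb -lv uv // h1 // -uv.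
Qed.

Lemma if_cont (U V : topologicalType) (P : U -> bool) (u v : U -> V) x :
  {for x, continuous u} -> {for x, continuous v} -> u x = v x ->
  {for x, continuous (fun y => if P y then u y else v y)}.
Proof.
move=> cu cv uv A /= Ax.
have Au : nbhs (u x) A by move: Ax; case: (P x) => //; rewrite -uv.
have Av : nbhs (v x) A by rewrite -uv.
have nu := cont_nbhs cu Au; have nv := cont_nbhs cv Av.
by apply: filterS2 nu nv => y /= Auy Avy; case: (P y).
Qed.

Section Homotopy.
Variables (Y : topologicalType) (G : Y * R -> X) (g0 : Y -> E).
Hypotheses (cG : continuous G) (cg0 : continuous g0).
Hypothesis g0G : forall y, f (g0 y) = G (y, 0).
Hypothesis G0 : forall y r, r <= 0 -> G (y, r) = G (y, 0).

(** Times range over the half-line [r < b], so that a lift is only ever prolonged at one end; [G] is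
    constant in negative time. *)
Let local_lift y0 b (N : set Y) (d : Y * R -> E) :=
  [/\ open_nbhs y0 N,
      forall y r, N y -> r < b -> {for (y, r), continuous d},
      forall y r, N y -> r < b -> f (d (y, r)) = G (y, r)
    & forall y, N y -> d (y, 0) = g0 y].

Let near_box y0 b V : nbhs (G (y0, b)) V -> exists2 N, open_nbhs y0 N &
  exists2 e, 0 < e & forall y r, N y -> `|r - b| < e -> V (G (y, r)).
Proof.
move=> GV; have [[A B] /= [Ay Bb] AB] := cont_nbhs (@cG (y0, b)) GV.
move: Ay; rewrite nbhsE => -[N Ny NA]; exists N => //.
move/nbhs_lineP: Bb => [e e0 eB]; exists e => // y r /NA Ay /eB Br.
exact: (AB (y, r)).
Qed.

Let local_lift_start y0 : exists2 b, 0 < b & exists N d, local_lift y0 b N d.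
Proof.
have [V oV [T [l [s [h1 h2 h3 h4]]]]] := covf (G (y0, 0)).
have Vy0 : V (f (g0 y0)) by rewrite g0G; case: oV.
have [N Ny [e e0 eP]] := near_box (open_nbhs_nbhs oV).
have := cont_nbhs (@cg0 y0) (h4 _ Vy0); rewrite nbhsE => -[N' N'y N'P].
exists e => //; exists (N `&` N'), (fun p => s (l (g0 y0)) (G p)).
have VG y r : N y -> r < e -> V (G (y, r)).
  move=> Nyy re; have [r0|r0] := leP r 0; last by apply: eP => //; rewrite subr0 gtr0_norm.
  by rewrite G0 //; apply: eP => //; rewrite subr0 normr0.
split.
- exact: open_nbhsI.
- move=> y r [Nyy _] re; apply: (@continuous_comp _ _ _ G); first exact: (@cG).
  by apply: h3 => //; apply: VG.
- by move=> y r [Nyy _] re; have [] := h2 (g0 y0) (G (y, r)) Vy0 (VG _ _ Nyy re).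
- move=> y [Nyy N'yy]; rewrite -g0G -(N'P _ N'yy) h1 // g0G; apply: VG => //.
Qed.

Lemma local_lift_ex y0 b : exists N d, local_lift y0 b N d.
Proof.
have mono c c' : c' <= c -> (exists N d, local_lift y0 c N d) ->
    exists N d, local_lift y0 c' N d.
  move=> cc [N [d [d1 d2 d3 d4]]]; exists N, d; split=> // y r Ny rc.
    by apply: d2 => //; apply: lt_le_trans cc.
  by apply: d3 => //; apply: lt_le_trans cc.
have [b0 b00 bP] := local_lift_start y0.
move: b; apply: real_induction => [c c'|| b]; [exact: mono|by exists b0|].
have [bb0|bb0] := ltP b b0.
  exists ((b0 - b) / 2); first by lra.
  by move=> _ _ _; apply: mono bP; lra.
have [V oV [T [l [s [h1 h2 h3 h4]]]]] := covf (G (y0, b)).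
have [N1 N1y [e1 e10 e1P]] := near_box (open_nbhs_nbhs oV).
(* Half of [e1] keeps [[b - e, b + e]] in the trivialized interval. Since [b >= b0], half of [b0]
   keeps the cut [b - e] positive, so the initial value at time 0 is untouched. *)
pose e := Num.min (e1 / 2) (b0 / 2).
have e0 : 0 < e by rewrite lt_min; apply/andP; split; lra.
have ee1 : e <= e1 / 2 by rewrite ge_min lexx.
have eb0 : e <= b0 / 2 by rewrite ge_min lexx orbT.
exists e => // b' be [N [d [oN dc dG d0]]].
pose c := b - e.
have cb' : c < b' by [].
have Ny0 : N y0 by case: oN.
have N1y0 : N1 y0 by case: N1y.
have Vc y r : N1 y -> c <= r -> r < b + e -> V (G (y, r)).
  by move=> N1yy cr rb; apply: e1P => //; rewrite /c in cr; rewrite ltr_norml; apply/andP; split; lra.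
have Vd y : N y -> N1 y -> V (f (d (y, c))).
  by move=> Nyy N1yy; rewrite dG //; apply: Vc => //; rewrite /c; lra.
have nl : nbhs y0 [set y | l (d (y, c)) = l (d (y0, c))].
  apply: (cont_nbhs (f := fun y => d (y, c)) (A := [set q | l q = l (d (y0, c))])).
    apply: (@continuous_comp _ _ _ (fun y => (y, c)) d); last exact: dc.
    by have h : continuous (fun y : Y => (y, c)) by [ct]; apply: h.
  by apply: h4; apply: Vd.
move: nl; rewrite nbhsE => -[N2 N2y N2P].
pose a := l (d (y0, c)).
have Va := Vd _ Ny0 N1y0.
(* On [N2] the points [d (y, c)] all lie in the sheet labelled [a], so the continuation inside this
   sheet agrees with [d] at time [c]. *)
exists (N `&` N1 `&` N2), (fun p => if p.2 <= c then d p else s a (G p)).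
have csG y r : N1 y -> c <= r -> r < b + e -> {for (y, r), continuous (fun p => s a (G p))}.
  move=> N1yy cr rb; apply: (@continuous_comp _ _ _ G); first exact: (@cG).
  by apply: h3 => //; apply: Vc.
have csnd (y : Y) (r : R) : {for (y, r), continuous (@snd Y R)} by exact: cvg_snd.
split.
- by apply: open_nbhsI => //; apply: open_nbhsI.
- move=> y r [[Nyy N1yy] N2yy] rb; have [rc|cr|rc] := ltgtP r c.
  + apply: near_cont (dc y r Nyy (lt_trans rc cb')).
    have nr : nbhs r [set r' | r' < c] by apply: open_nbhs_nbhs; split; [exact: open_lt|].
    by apply: filterS (cont_nbhs (csnd y r) nr) => p /= /ltW ->.
  + apply: near_cont (csG _ _ N1yy (ltW cr) rb).
    have nr : nbhs r [set r' | c < r'] by apply: open_nbhs_nbhs; split; [exact: open_gt|].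
    by apply: filterS (cont_nbhs (csnd y r) nr) => p /= h; rewrite leNgt h.
  + rewrite rc; apply: if_cont; first exact: dc.
      by apply: csG => //; rewrite /c; lra.
    by rewrite -dG // /a -(N2P _ N2yy) h1 //; apply: Vd.
- move=> y r [[Nyy N1yy] N2yy] rb /=; case: leP => [rc|cr].
    by apply: dG => //; apply: le_lt_trans cb'.
  by have [] := h2 (d (y0, c)) (G (y, r)) Va (Vc _ _ N1yy (ltW cr) rb).
- move=> y [[Nyy _] _] /=.
  by have -> : 0 <= c by [rewrite /c; lra]; apply: d0.
Qed.

Lemma lift_ex_aux : exists2 g : Y * R -> E, continuous g &
  (forall y r, 0 <= r -> f (g (y, r)) = G (y, r)) /\ forall y, g (y, 0) = g0 y.
Proof.
have exd (p : Y * R) : exists d, exists N, local_lift p.1 p.2 N d.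
  by have [N [d h]] := local_lift_ex p.1 p.2; exists d, N.
have [d dP] := choice exd; have [N NP] := choice dP.
pose m (r : R) := Num.max r 0.
have m0 r : 0 <= m r by rewrite le_max lexx orbT.
have cm : continuous m by rewrite /m; ct.
have mlt r : m r < `|r| + 1.
  by rewrite gt_max ltr_pwDr ?ler_norm //= ltr_wpDl.
(* Each point is lifted by the local lift chosen for that very point. Unique lifting along each time
   line shows that [g] coincides locally with a single local lift. *)
pose g (p : Y * R) := d (p.1, `|p.2| + 1) (p.1, m p.2).
have gE y0 b y r : N (y0, b) y -> m r < b -> g (y, r) = d (y0, b) (y, m r).
  move=> Ny mb; have [oN dc dG d0] := NP (y0, b).
  have [[_ Ny'] dc' dG' d0'] := NP (y, `|r| + 1).
  have cmin (k : Y * R -> E) c : m r < c ->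
      (forall t, t < c -> {for (y, t), continuous k}) ->
      continuous (fun t => k (y, Num.min t (m r))).
    move=> mc ck t; apply: (@continuous_comp _ _ _ (fun t => (y, Num.min t (m r))) k).
      by have h : continuous (fun t : R => (y, Num.min t (m r))) by [ct]; apply: h.
    by apply: ck; rewrite gt_min mc orbT.
  have := @lift_unique (fun t => d (y, `|r| + 1) (y, Num.min t (m r)))
    (fun t => d (y0, b) (y, Num.min t (m r))).
  move=> /(_ _ _ _ _ (m r) (m0 r)); rewrite /= minxx; apply.
  + by apply: (cmin _ (`|r| + 1)) => // t tr; apply: dc'.
  + by apply: (cmin _ b) => // t tr; apply: dc.
  + move=> t t0; have t1 : Num.min t (m r) < b by rewrite gt_min mb orbT.
    have t2 : Num.min t (m r) < `|r| + 1 by rewrite gt_min mlt orbT.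
    by rewrite dG ?dG'.
  + by rewrite min_l // d0 // d0'.
exists g.
- move=> [y0 r0].
  have [oN dc dG d0] := NP (y0, m r0 + 1).
  have md : m r0 < m r0 + 1 by lra.
  apply: (near_cont (g := fun p => d (y0, m r0 + 1) (p.1, m p.2))).
    have n1 : \forall p \near (y0, r0), N (y0, m r0 + 1) p.1.
      by apply: (@cvg_fst _ _ (nbhs y0) (nbhs r0)); apply: open_nbhs_nbhs.
    have n2 : \forall p \near (y0, r0), m p.2 < m r0 + 1.
      have h : continuous (fun p : Y * R => m p.2) by apply: cont_comp cm _; ct.
      apply: (cont_nbhs (A := [set t : R | t < m r0 + 1]) (h (y0, r0))).
      by apply: open_nbhs_nbhs; split; [exact: open_lt|].
    by apply: filterS2 n1 n2 => -[y r] /= n1 n2; apply: gE.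
  apply: (@continuous_comp _ _ _ (fun p => (p.1, m p.2)) (d (y0, m r0 + 1))).
    have h : continuous (fun p : Y * R => (p.1, m p.2)).
      by apply: cont_pair; [ct|apply: cont_comp cm _; ct].
    exact: h.
  by apply: dc => //; case: oN.
- have m_id r : 0 <= r -> m r = r by move=> r0; apply: max_l.
  split=> [y r r0|y]; rewrite /g /=.
    have [[_ Ny'] dc' dG' d0'] := NP (y, `|r| + 1).
    by rewrite dG' // m_id.
  have [[_ Ny'] dc' dG' d0'] := NP (y, `|0 : R| + 1).
  by rewrite m_id // d0'.
Qed.

End Homotopy.

Lemma homotopy_lift (Y : topologicalType) (G : Y * R -> X) (g0 : Y -> E) :
  continuous G -> continuous g0 -> (forall y, f (g0 y) = G (y, 0)) ->
  exists2 g : Y * R -> E, continuous g &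
  (forall y r, 0 <= r -> f (g (y, r)) = G (y, r)) /\ forall y, g (y, 0) = g0 y.
Proof.
move=> cG cg0 g0G.
have [||||g cg [gG g0E]] := @lift_ex_aux Y (fun p => G (p.1, Num.max p.2 0)) g0.
- by apply: cont_comp cG _; ct.
- by [].
- by move=> y /=; rewrite maxxx.
- by move=> y r r0 /=; rewrite maxxx max_r.
exists g => //; split=> // y r r0.
by rewrite gG //= max_l.
Qed.

End Lifting.

Section IsotopyLift.
Variables (R : realType) (E X : topologicalType) (f : E -> X).
Hypotheses (cf : continuous f) (covf : covering f).

Let f3 (p : E * R) : X * R := (f p.1, p.2).

Let cf3 : continuous f3.
Proof. by apply: cont_pair; [apply: cont_comp cf _|]; ct. Qed.

(* The inverse of the lift at time [t] lifts the reversed isotopy. *)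
Lemma isotopy_lift (F : R -> X * R -> X * R) : slab_isotopy F ->
  exists2 F' : R -> E * R -> E * R, slab_isotopy F' &
    forall W, wpull f (F 1 @` W) = F' 1 @` wpull f W.
Proof.
move=> [cF hF F0 Fh Fs].
pose G (p : (E * R) * R) := (F p.2 (f3 p.1)).1.
have cF3 : continuous (fun p : (E * R) * R => F p.2 (f3 p.1)).
  apply: (cont_comp cF (g := fun p : (E * R) * R => (p.2, f3 p.1))).
  by apply: cont_pair; [ct|apply: cont_comp cf3 _; ct].
have cG : continuous G by apply: cont_fst.
have [||g cg [gG g0]] := @homotopy_lift R E X f cf covf _ G fst cG.
- by ct.
- by move=> y; rewrite /G F0.
pose m (r : R) := Num.max r 0.
have m0 r : 0 <= m r by rewrite le_max lexx orbT.
have m_id r : 0 <= r -> m r = r by move=> r0; apply: max_l.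
have cm : continuous m by rewrite /m; ct.
(* Only the position needs lifting; the height is copied from the isotopy downstairs. *)
pose F' t (q : E * R) : E * R := (g (q, m t), (F (m t) (f3 q)).2).
have F'f t q : f3 (F' t q) = F (m t) (f3 q).
  by rewrite /f3 /F' /= gG // /G /= -surjective_pairing.
have F'h t q : 1 <= `|q.2| -> (F' t q).2 = q.2 by move=> q1; rewrite /F' /= Fh.
have F's t q : `|q.2| < 1 -> `|(F' t q).2| < 1 by move=> q1; apply: Fs.
have inv t : 0 <= t -> exists2 K : E * R -> E * R, continuous K &
    cancel (F' t) K /\ cancel K (F' t).
  move=> t0; have [_ [H [cH FH HF]]] := hF t.
  pose G2 (p : (E * R) * R) := (F (m (t - p.2)) (H (f3 p.1))).1.
  have cHf : continuous (fun q : E * R => H (f3 q)) by apply: cont_comp cH cf3.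
  have cG2 : continuous G2.
    apply: cont_fst.
    apply: (cont_comp cF (g := fun p : (E * R) * R => (m (t - p.2), H (f3 p.1)))).
    apply: cont_pair; [apply: cont_comp cm _; ct|].
    by apply: (cont_comp cHf); ct.
  have [||k ck [kG k0]] := @homotopy_lift R E X f cf covf _ G2 fst cG2.
  - by ct.
  - by move=> y; rewrite /G2 /= subr0 m_id // HF.
  pose K (q : E * R) : E * R := (k (q, t), (H (f3 q)).2).
  have Kf q : f3 (K q) = H (f3 q).
    by rewrite /f3 /K /= kG // /G2 /= subrr m_id // F0 -surjective_pairing.
  have cut (T : topologicalType) (u : (E * R) * R -> T) (w : R -> R) q :
      continuous u -> continuous w -> continuous (fun s => u (q, w s)).
    by move=> cu cw; apply: (cont_comp cu (g := fun s => (q, w s))); apply: cont_pair => //; ct.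
  have cmin : continuous (fun s : R => Num.min s t) by ct.
  have crev : continuous (fun s : R => m (t - s)) by apply: cont_comp cm _; ct.
  have minge s : 0 <= s -> 0 <= Num.min s t by move=> s0; rewrite le_min s0.
  have mm s : m (t - Num.min s t) = m (t - s).
    have [//|ts] := leP s t; rewrite subrr /m maxxx max_r //; lra.
  exists K.
    apply: cont_pair; last exact: cont_snd.
    by apply: (cont_comp ck (g := fun q : E * R => (q, t))); ct.
  split=> q.
  - have := @lift_unique R E X f cf covf (fun s => k (F' t q, Num.min s t))
      (fun s => g (q, m (t - s))) (cut _ k _ _ ck cmin) (cut _ g _ _ cg crev).
    move=> /(_ _ _ t t0); rewrite minxx subrr (m_id 0) // g0.
    move=> h; rewrite [RHS]surjective_pairing /K; congr (_, _); last first.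
      by rewrite F'f m_id // FH.
    apply: h => [r r0|]; last by rewrite min_l // k0 subr0.
    have e : H (f3 (F' t q)) = f3 q by rewrite F'f m_id // FH.
    by rewrite kG ?minge // gG // /G2 /G /= e mm.
  - have := @lift_unique R E X f cf covf (fun s => g (K q, Num.min s t))
      (fun s => k (q, m (t - s))) (cut _ g _ _ cg cmin) (cut _ k _ _ ck crev).
    move=> /(_ _ _ t t0); rewrite minxx subrr (m_id 0) // k0.
    move=> h; rewrite [RHS]surjective_pairing /F' m_id //; congr (_, _); last first.
      by rewrite Kf HF.
    apply: h => [r r0|]; last by rewrite min_l // g0 subr0 m_id.
    rewrite gG ?minge // kG // /G2 /G /= Kf; congr (F _ _).1.
    have [rt|tr] := leP r t; first by rewrite (m_id (t - r)) ?m_id; lra.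
    have -> : m (t - r) = 0 by rewrite /m max_r //; lra.
    by rewrite subr0 m_id.
exists F'.
- split=> //.
  + apply: cont_pair.
      apply: (cont_comp cg (g := fun p : R * (E * R) => (p.2, m p.1))).
      by apply: cont_pair; [ct|apply: cont_comp cm _; ct].
    apply: cont_snd; apply: (cont_comp cF3 (g := fun p : R * (E * R) => (p.2, m p.1))).
    by apply: cont_pair; [ct|apply: cont_comp cm _; ct].
  + move=> t; have [K cK [K1 K2]] := inv (m t) (m0 t).
    have -> : F' t = F' (m t) by rewrite /F' (m_id (m t)).
    split; last by exists K.
    apply: cont_pair.
      by apply: (cont_comp cg (g := fun p : E * R => (p, m (m t)))); ct.
    by apply: cont_snd; apply: (cont_comp cF3 (g := fun p : E * R => (p, m (m t)))); ct.
  + by move=> [p z]; rewrite /F' m_id // g0 F0.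
- move=> W; apply/seteqP; split=> [p|_ [q Wq <-]]; last first.
    by exists (f3 q) => //; have := F'f 1 q; rewrite m_id // => <-.
  move=> [w Ww wp]; have [K cK [K1 K2]] := inv 1 ler01.
  exists (K p); last exact: K2.
  have [_ [H [cH FH HF]]] := hF 1.
  suff -> : wpull f W (K p) = W w by [].
  rewrite /wpull /= -[(f _, _)]/(f3 (K p)); congr W.
  by rewrite -[LHS]FH -[w]FH wp -(m_id 1) // -F'f K2.
Qed.

End IsotopyLift.

(** * Lifting a Dehn twist to the plane *)

Section DehnLift.
Variables (R : realType) (X : topologicalType).
Local Notation plane := (R * R)%type.
Variable f : plane -> X.
Hypotheses (lf : local_homeo f) (covf : covering f) (sf : forall x, exists p, f p = x).

Let cf : continuous f. Proof. by case: lf. Qed.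

Let ray (p0 : plane) (p : plane * R) : plane :=
  (p0.1 + p.2 * (p.1.1 - p0.1), p0.2 + p.2 * (p.1.2 - p0.2)).

Let cont_ray p0 : continuous (ray p0).
Proof. by rewrite /ray; ct. Qed.

Let ray0 p0 p : ray p0 (p, 0) = p0.
Proof. by rewrite /ray /= !mul0r !addr0; case: p0. Qed.

Let ray1 p0 p : ray p0 (p, 1) = p.
Proof. by rewrite /ray /= !mul1r !subrKC; case: p. Qed.

Let ray_fix p0 t : ray p0 (p0, t) = p0.
Proof. by rewrite /ray /= !subrr !mulr0 !addr0; case: p0. Qed.

Let lift_map_unique (u v : plane -> plane) p0 : continuous u -> continuous v ->
  (forall p, f (u p) = f (v p)) -> u p0 = v p0 -> u =1 v.
Proof.
move=> cu cv uv uv0 p.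
have cr : continuous (fun t => ray p0 (p, t)) by apply: (cont_comp (@cont_ray p0)); ct.
have := @lift_unique R _ _ f cf covf (fun t => u (ray p0 (p, t)))
  (fun t => v (ray p0 (p, t))) (cont_comp cu cr) (cont_comp cv cr).
by move=> /(_ _ _ 1 ler01); rewrite !ray0 !ray1; apply.
Qed.

(** The plane is star-shaped about [p0]: contracting it along rays turns the lifting of a map into
    the lifting of a homotopy that starts at a constant. *)
Lemma lift_map (h : X -> X) p0 p1 : continuous h -> h (f p0) = f p1 ->
  exists2 h' : plane -> plane, continuous h' &
    (forall p, f (h' p) = h (f p)) /\ h' p0 = p1.
Proof.
move=> ch h01.
have cG : continuous (fun p => h (f (ray p0 p))).
  by apply: cont_comp ch _; apply: cont_comp cf _; apply: cont_ray.
have [||g cg [gG g0]] := @homotopy_lift R plane X f cf covf _ _ (fun=> p1) cG.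
- by ct.
- by move=> y; rewrite ray0.
exists (fun p => g (p, 1)); first by apply: cont_comp cg _; ct.
split=> [p|]; first by rewrite gG // ray1.
rewrite -(g0 p0).
have := @lift_unique R _ _ f cf covf (fun t => g (p0, t)) (fun t => g (p0, 0)).
move=> /(_ _ _ _ erefl 1 ler01); apply.
- by apply: cont_comp cg _; ct.
- by ct.
- by move=> r r0; rewrite !gG // !ray_fix.
Qed.

(** The lifts of [h] and of its inverse fixing [p0] compose to lifts of the identity fixing [p0],
    which are the identity by uniqueness. *)
Lemma lift_homeo (h : X -> X) p0 : homeomorphism h -> h (f p0) = f p0 ->
  exists2 h' : plane -> plane, homeomorphism h' &
    (forall p, f (h' p) = h (f p)) /\ h' p0 = p0.
Proof.
move=> [ch [k [ck hk kh]]] h0.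
have k0 : k (f p0) = f p0 by rewrite -{1}h0 hk.
have [h' ch' [h'f h'0]] := lift_map ch h0.
have [k' ck' [k'f k'0]] := lift_map ck k0.
exists h' => //; split=> //; exists k'; split=> //.
- apply: (@lift_map_unique (fun p => k' (h' p)) (fun p => p) p0) => [|||].
  + exact: cont_comp.
  + by ct.
  + by move=> p; rewrite k'f h'f hk.
  + by rewrite h'0 k'0.
- apply: (@lift_map_unique (fun p => h' (k' p)) (fun p => p) p0) => [|||].
  + exact: cont_comp.
  + by ct.
  + by move=> p; rewrite h'f k'f kh.
  + by rewrite k'0 h'0.
Qed.

(* Alexander's trick at the origin: a homeomorphism of the plane equal to the
   identity near a point is isotopic to the identity by rescaling. *)
Lemma scaling_isotopy (h : plane -> plane) (p0 : plane) : homeomorphism h ->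
  (\forall p \near p0, h p = p) ->
  exists F : R -> plane -> plane,
    [/\ continuous (fun p : R * plane => F p.1 p.2),
        forall t, homeomorphism (F t), forall p, F 0 p = p & F 1 =1 h].
Proof.
move=> hh /nbhs_planeP[e e0 eP].
pose rho (p : plane) : plane := ((h p).1 - p.1, (h p).2 - p.2).
pose c := clamp (0 : R) 1.
have c01 t : 0 <= c t <= 1 by apply: clamp_in; lra.
have cc : continuous c by rewrite /c; apply: cont_clamp; ct.
(* The conjugate of [h] by the homothety of ratio [t] about [p0], written through the displacement
   [rho]: with the convention that the inverse of 0 is 0, it is the identity at [t = 0]. Continuity
   there holds because [rho] vanishes near [p0]. *)
pose F0 (t : R) (p : plane) : plane :=
  (p.1 + t^-1 * (rho (ray p0 (p, t))).1, p.2 + t^-1 * (rho (ray p0 (p, t))).2).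
have crho : continuous rho by case: hh => ch _; rewrite /rho; ct.
have rho_near p : `|p.1 - p0.1| < e -> `|p.2 - p0.2| < e -> rho p = (0, 0).
  by move=> p1 p2; rewrite /rho eP // !subrr.
exists (fun t => F0 (c t)); split.
- have cF0 : continuous (fun p : R * plane => F0 p.1 p.2).
    have cr : continuous (fun p : R * plane => rho (ray p0 (p.2, p.1))).
      by apply: cont_comp crho _; apply: cont_comp (@cont_ray p0) _; ct.
    move=> [t p]; have [->|t0] := eqVneq t 0; last first.
      have ci : {for (t, p), continuous (fun p : R * plane => p.1^-1)}.
        by apply: (@continuous_comp _ _ _ fst (@GRing.inv R));
          [exact: cvg_fst|exact: inv_continuous].
      have c1 : continuous (fun p : R * plane => p.2.1) by ct.
      have c2 : continuous (fun p : R * plane => p.2.2) by ct.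
      have cr1 := @cont_fst _ _ _ _ cr; have cr2 := @cont_snd _ _ _ _ cr.
      have k1 : {for (t, p), continuous (fun q : R * plane =>
          q.2.1 + q.1^-1 * (rho (ray p0 (q.2, q.1))).1)}.
        by apply: continuousD; [exact: c1|apply: continuousM; [exact: ci|exact: cr1]].
      have k2 : {for (t, p), continuous (fun q : R * plane =>
          q.2.2 + q.1^-1 * (rho (ray p0 (q.2, q.1))).2)}.
        by apply: continuousD; [exact: c2|apply: continuousM; [exact: ci|exact: cr2]].
      exact: cvg_pair k1 k2.
    apply: (near_cont (g := snd)); last exact: cvg_snd.
    have n1 : continuous (fun q : R * plane => q.1 * (q.2.1 - p0.1)) by ct.
    have n2 : continuous (fun q : R * plane => q.1 * (q.2.2 - p0.2)) by ct.
    have small (k : R * plane -> R) : continuous k -> k (0, p) = 0 ->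
        \forall q \near ((0 : R), p), `|k q| < e.
      move=> ck k0; apply: (cont_nbhs (A := [set x : R | `|x| < e]) (ck (0, p))).
      by apply/nbhs_lineP; exists e => // y; rewrite k0 subr0.
    have m1 := small _ n1 (mul0r _); have m2 := small _ n2 (mul0r _).
    apply: filterS2 m1 m2 => -[s q] /= q1 q2.
    have r0 : rho (ray p0 (q, s)) = (0, 0).
      by apply: rho_near; rewrite /ray /= addrAC subrr add0r.
    by rewrite /F0 r0 /= !mulr0 !addr0; case: q {q1 q2 r0}.
  apply: (cont_comp cF0 (g := fun p : R * plane => (c p.1, p.2))).
  by apply: cont_pair; [apply: cont_comp cc _; ct|ct].
- move=> t; have [c0|c0] := eqVneq (c t) 0.
    rewrite c0; have -> : F0 0 = id; last exact: homeo_id.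
    by apply/funext => -[a b]; rewrite /F0 invr0 !mul0r !addr0.
  pose A (p : plane) := ray p0 (p, c t).
  pose B (p : plane) : plane := (p0.1 + (c t)^-1 * (p.1 - p0.1), p0.2 + (c t)^-1 * (p.2 - p0.2)).
  have cA : continuous A by apply: cont_comp (@cont_ray p0) _; ct.
  have cB : continuous B by rewrite /B; ct.
  have AB : cancel A B by move=> [a b]; rewrite /A /B /ray /=; congr (_, _); field.
  have BA : cancel B A by move=> [a b]; rewrite /A /B /ray /=; congr (_, _); field.
  have hA : homeomorphism A by split=> //; exists B.
  have hB : homeomorphism B by split=> //; exists A.
  have -> : F0 (c t) = fun p => B (h (A p)); last exact: homeo_comp (homeo_comp hA hh) hB.
  apply/funext => -[a b]; rewrite /F0 /rho -[ray _ _]/(A (a, b)) /B; congr (_, _).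
    by rewrite /A /ray /=; field.
  by rewrite /A /ray /=; field.
- have -> : c 0 = 0 by rewrite /c clamp_id // lexx ler01.
  by move=> [a b]; rewrite /F0 invr0 !mul0r !addr0.
- have -> : c 1 = 1 by rewrite /c clamp_id // lexx ler01.
  by move=> [a b]; rewrite /F0 ray1 /rho invr1 /= !mul1r !subrKC -surjective_pairing.
Qed.

Lemma dehn_lift (h : X -> X) : dehn_twist R h ->
  exists2 h' : plane -> plane, homeomorphism h' &
    (forall p, f (h' p) = h (f p)) /\
    exists F : R -> plane -> plane,
      [/\ continuous (fun p : R * plane => F p.1 p.2),
          forall t, homeomorphism (F t), forall p, F 0 p = p & F 1 =1 h'].
Proof.
move=> [a [ca ao aE [hh [ha _]]]].
have hfix u : 1 <= u.2 -> h (a u) = a u.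
  move=> u1; rewrite ha min_l // max_r //; apply/aE; split=> //=.
  by exists 1; rewrite mulr1z.
(* The point [(0, 2)] lies beyond the support of the twist in the parametrized annulus, where the
   angle is shifted by one full turn. *)
have [p0 p0E] := sf (a (0, 2)).
have [|h' hh' [h'f h'0]] := lift_homeo (p0 := p0) hh.
  by rewrite p0E hfix //=; lra.
exists h' => //; split=> //; apply: (scaling_isotopy (p0 := p0)) => //.
(* Near [p0], the points [p] and [h' p] have the same image and both lie in a neighbourhood where
   [f] is injective. *)
have [_ _ fi] := lf; have [U Up Ui] := fi p0.
have n1 : \forall p \near p0, U p by apply: open_nbhs_nbhs.
have n2 : \forall p \near p0, U (h' p).
  by case: hh' => ch' _; apply: (cont_nbhs (ch' p0)); rewrite h'0; apply: open_nbhs_nbhs.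
have n3 : nbhs p0 [set p | (a @` [set u | 1 < u.2]) (f p)].
  apply: (cont_nbhs (cf (x := p0))); rewrite p0E; apply: open_nbhs_nbhs; split.
    apply: ao; apply: (@open_comp _ _ snd [set t : R | 1 < t]) => [u _|].
      exact: cvg_snd.
    exact: open_gt.
  by exists (0, 2) => //=; lra.
apply: filterS3 n1 n2 n3 => p Upp Uhp [u /= u1 up].
by apply: Ui; rewrite ?inE // h'f -up hfix // ltW.
Qed.

End DehnLift.

(** * Model tangles *)

Section Tangles.
Variable R : realType.
Local Notation plane := (R * R)%type.
Local Notation space := ((R * R) * R)%type.
Implicit Types T : set space.

Definition compact_isotopy (rho : R) (F : R -> space -> space) :=
  [/\ continuous (fun p : R * space => F p.1 p.2),
      forall t, homeomorphism (F t), forall p, F 0 p = p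
    & forall t p, rho <= sup_norm p.1 \/ 1 <= `|p.2| -> F t p = p].

Definition tangle_equiv T T' :=
  exists rho F, compact_isotopy rho F /\ T' = F 1 @` T.

Lemma tangle_equiv_trans T1 T2 T3 :
  tangle_equiv T1 T2 -> tangle_equiv T2 T3 -> tangle_equiv T1 T3.
Proof.
move=> [r [F [[cF hF F0 Fs] ->]]] [r' [G [[cG hG G0 Gs] ->]]].
exists (Num.max r r'), (fun t p => G t (F t p)); split; last by rewrite image_comp.
split=> //.
- apply: (cont_comp cG (g := fun p => (p.1, F p.1 p.2))).
  by apply: cont_pair => //; ct.
- by move=> t; apply: homeo_comp.
- by move=> p; rewrite F0 G0.
- move=> t p hp; rewrite Fs ?Gs //; case: hp; rewrite ?ge_max; try by right.
    by move=> /andP[_ ?]; left.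
  by move=> /andP[? _]; left.
Qed.

Lemma tangle_equiv_sym T T' : tangle_equiv T T' -> tangle_equiv T' T.
Proof.
move=> [r [F [[cF hF F0 Fs] ->]]].
have [g hg [Fg gF]] := homeo_inv (hF 1).
exists r, (fun t p => F (1 - t) (g p)); split; last first.
  rewrite image_comp subrr -[LHS]image_id; apply: eq_imagel => p _ /=.
  by rewrite F0 Fg.
split.
- apply: (cont_comp cF (g := fun p : R * space => (1 - p.1, g p.2))).
  apply: cont_pair; first by ct.
  by case: hg => cg _; apply: cont_comp cg _; ct.
- by move=> t; apply: homeo_comp.
- by move=> p; rewrite subr0 gF.
- move=> t p hp; have -> : g p = p by rewrite -{1}(Fs 1 p hp) Fg.
  exact: Fs.
Qed.

(** The third hypothesis makes [x + D q x] increasing, and then also [x + c * D q x] for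
    [0 <= c <= 1]; the bound [C] makes it surjective. Thus the whole family consists of
    homeomorphisms. *)
Lemma shear_isotopy (Q : topologicalType) (D : Q -> R -> R) (C : R) :
  continuous (fun p : Q * R => D p.1 p.2) ->
  (forall q x, `|D q x| <= C) ->
  (forall q x y, x < y -> D q x - D q y < y - x) ->
  let S t (p : Q * R) := (p.1, p.2 + clamp 0 1 t * D p.1 p.2) in
  continuous (fun p : R * (Q * R) => S p.1 p.2) /\ forall t, homeomorphism (S t).
Proof.
move=> cD DC Dm S.
have cc : continuous (clamp (0 : R) 1) by apply: cont_clamp; ct.
split.
  have c1 : continuous (fun p : R * (Q * R) => clamp 0 1 p.1) by apply: cont_comp cc _; ct.
  have c2 : continuous (fun p : R * (Q * R) => D p.2.1 p.2.2).
    by apply: (cont_comp cD (g := fun p : R * (Q * R) => p.2)); ct.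
  by rewrite /S; ct.
move=> t; have /andP[c0 c1] : 0 <= clamp 0 1 t <= 1 by apply: clamp_in.
apply: (monotone_homeo (m := fun q x => x + clamp 0 1 t * D q x)).
- by ct.
- move=> q x y xy; have := Dm q _ _ xy.
  move: (clamp 0 1 t) c0 c1 (D q x) (D q y) => c c0 c1 a b h.
  by have [ab|ab] := leP a b; nra.
- move=> q y; apply: (incr_surj (C := C)).
    have cq : continuous (fun x => D q x) by apply: (cont_comp cD (g := pair q)); ct.
    by ct.
  move=> x; rewrite addrAC subrr add0r normrM ger0_norm //.
  by have := DC q x; have := normr_ge0 (D q x); nra.
Qed.

Lemma homeo_conj (U V : topologicalType) (i : U -> V) (j : V -> U) (S : V -> V) :
  continuous i -> continuous j -> cancel i j -> cancel j i -> homeomorphism S ->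
  homeomorphism (fun x => j (S (i x))).
Proof.
move=> ci cj ij ji hS.
have hi : homeomorphism i by split=> //; exists j.
have hj : homeomorphism j by split=> //; exists i.
exact: homeo_comp (homeo_comp hi hS) hj.
Qed.

Lemma shear_tangle (Q : topologicalType) (i : space -> Q * R) (j : Q * R -> space)
    (D : Q -> R -> R) (C rho : R) T :
  continuous i -> continuous j -> cancel i j -> cancel j i ->
  continuous (fun p : Q * R => D p.1 p.2) ->
  (forall q x, `|D q x| <= C) ->
  (forall q x y, x < y -> D q x - D q y < y - x) ->
  (forall p, rho <= sup_norm p.1 \/ 1 <= `|p.2| -> D (i p).1 (i p).2 = 0) ->
  tangle_equiv T ((fun p => j ((i p).1, (i p).2 + D (i p).1 (i p).2)) @` T).
Proof.
move=> ci cj ij ji cD DC Dm Ds; have [cS hS] := shear_isotopy cD DC Dm.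
exists rho, (fun t p => j ((i p).1, (i p).2 + clamp 0 1 t * D (i p).1 (i p).2)).
split; last first.
  by apply: eq_imagel => p _; rewrite clamp_id ?mul1r // lexx ler01.
split.
- apply: cont_comp cj _.
  apply: (cont_comp cS (g := fun p : R * space => (p.1, i p.2))).
  by apply: cont_pair; [ct|apply: cont_comp ci _; ct].
- by move=> t; apply: (homeo_conj ci cj ij ji (hS t)).
- by move=> p; rewrite clamp_id ?lexx ?ler01 // mul0r addr0 -surjective_pairing ij.
- by move=> t p /Ds ->; rewrite mulr0 addr0 -surjective_pairing ij.
Qed.

Section Shears.
Variables (D : R -> R -> R -> R) (C rho : R).
Hypothesis cD : continuous (fun p : space => D p.1.1 p.1.2 p.2).
Hypothesis DC : forall x y z, `|D x y z| <= C.
Hypothesis Ds : forall x y z,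
  rho <= `|x| \/ rho <= `|y| \/ 1 <= `|z| -> D x y z = 0.

Let Ds' (p : space) : rho <= sup_norm p.1 \/ 1 <= `|p.2| -> D p.1.1 p.1.2 p.2 = 0.
Proof.
move=> h; apply: Ds; move: h; rewrite /sup_norm le_max => -[/orP[h|h]|h];
  by [left|right; left|right; right].
Qed.

Lemma xshear T : (forall y z x x', x < x' -> D x y z - D x' y z < x' - x) ->
  tangle_equiv T ((fun p => ((p.1.1 + D p.1.1 p.1.2 p.2, p.1.2), p.2)) @` T).
Proof.
move=> Dm.
apply: (@shear_tangle plane (fun p => ((p.1.2, p.2), p.1.1))
  (fun q => ((q.2, q.1.1), q.1.2)) (fun q x => D x q.1 q.2) C rho).
- by ct.
- by ct.
- by move=> [[x y] z].
- by move=> [[x y] z].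
- by apply: (cont_comp cD (g := fun p : plane * R => ((p.2, p.1.1), p.1.2))); ct.
- by move=> q x; apply: DC.
- by move=> q x y; apply: Dm.
- by move=> [[x y] z] hp; apply: (@Ds' (x, y, z)).
Qed.

Lemma yshear T : (forall x z y y', y < y' -> D x y z - D x y' z < y' - y) ->
  tangle_equiv T ((fun p => ((p.1.1, p.1.2 + D p.1.1 p.1.2 p.2), p.2)) @` T).
Proof.
move=> Dm.
apply: (@shear_tangle plane (fun p => ((p.1.1, p.2), p.1.2))
  (fun q => ((q.1.1, q.2), q.1.2)) (fun q y => D q.1 y q.2) C rho).
- by ct.
- by ct.
- by move=> [[x y] z].
- by move=> [[x y] z].
- by apply: (cont_comp cD (g := fun p : plane * R => ((p.1.1, p.2), p.1.2))); ct.
- by move=> q x; apply: DC.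
- by move=> q x y; apply: Dm.
- by move=> [[x y] z] hp; apply: (@Ds' (x, y, z)).
Qed.

Lemma zshear T : (forall x y z z', z < z' -> D x y z - D x y z' < z' - z) ->
  tangle_equiv T ((fun p => (p.1, p.2 + D p.1.1 p.1.2 p.2)) @` T).
Proof.
move=> Dm.
apply: (@shear_tangle plane (fun p => p) (fun q => q) (fun q z => D q.1 q.2 z) C rho).
- by ct.
- by ct.
- by [].
- by [].
- by [].
- by move=> q x; apply: DC.
- by move=> q x y; apply: Dm.
- by move=> [[x y] z] hp; apply: (@Ds' (x, y, z)).
Qed.

End Shears.

Definition cutoff (a b x : R) : R := clamp 0 1 ((b - `|x|) / (b - a)).

Lemma cont_cutoff (U : topologicalType) (a b : R) (f : U -> R) :
  continuous f -> continuous (fun u => cutoff a b (f u)).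
Proof. by move=> cf; apply: cont_clamp; ct. Qed.

Lemma cutoff_in a b x : 0 <= cutoff a b x <= 1.
Proof. by apply: clamp_in. Qed.

Lemma cutoff1 a b x : a < b -> `|x| <= a -> cutoff a b x = 1.
Proof.
move=> ab xa; apply: clamp_hi => //.
by rewrite ler_pdivlMr; lra.
Qed.

Lemma cutoff0 a b x : a < b -> b <= `|x| -> cutoff a b x = 0.
Proof.
move=> ab bx; apply: clamp_lo => //.
by rewrite ler_pdivrMr; lra.
Qed.

Lemma clamp_lip_abs (a b x y : R) : a <= b -> `|clamp a b x - clamp a b y| <= `|x - y|.
Proof.
move=> ab; wlog xy : x y / x <= y.
  have [xy|/ltW yx] := leP x y; first exact.
  by rewrite distrC [leRHS]distrC; apply.
rewrite distrC [leRHS]distrC (ger0_norm (x := y - x)) ?subr_ge0 //.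
by rewrite ger0_norm ?subr_ge0 ?clamp_le // clamp_lip.
Qed.

Lemma cutoff_lip a b x y : a < b -> `|cutoff a b x - cutoff a b y| * (b - a) <= `|x - y|.
Proof.
move=> ab; have ba : 0 < b - a by lra.
rewrite -ler_pdivlMr //; apply: le_trans (clamp_lip_abs _ _ ler01) _.
rewrite -mulrBl normrM normfV (gtr0_norm ba) ler_pM2r ?invr_gt0 //.
have -> : b - `|x| - (b - `|y|) = `|y| - `|x| by lra.
by rewrite distrC ler_dist_dist.
Qed.

(** [L] is the inverse of a Lipschitz constant of the profile [g]; an amplitude below [L] keeps the
    shear increasing. *)
Lemma lip_shear (c x y : R) (g : R -> R) L : `|c| < L ->
  `|g x - g y| * L <= `|x - y| -> x < y -> c * g x - c * g y < y - x.
Proof.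
move=> cL gL xy; rewrite -mulrBr; apply: le_lt_trans (ler_norm _) _.
rewrite normrM; move: gL; rewrite (distrC x) (gtr0_norm (x := y - x)) ?subr_gt0 //.
have := normr_ge0 (g x - g y); have := normr_ge0 c.
move: (`|g x - g y|) (`|c|) cL => d e cL e0 d0 dL.
have [->|d1] := eqVneq d 0; first by rewrite mulr0 subr_gt0.
have : e * d < L * d by rewrite ltr_pM2r // lt_neqAle eq_sym d1.
lra.
Qed.

End Tangles.

(** * Pushing one strand within its own level *)

Section LevelBump.
Variable R : realType.
Local Notation plane := (R * R)%type.
Local Notation space := ((R * R) * R)%type.

(* [bump_path] is the image of the line [y = a] under a shear in [y], which lifts
   the segment [|x| <= w] to [y = b] with slanted sides, followed by a shear in
   [x], of direction [bump_xi], which makes the sides vertical. *)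
Definition bump_xi (w x : R) : R := clamp (-1) 1 (x / w) * cutoff 5 20 x.

(** The product of two functions bounded by 1, with Lipschitz constants [1 / w] and [1 / 15], has
    Lipschitz constant [1 / w + 1 / 15]. *)
Lemma bump_xi_lip (w x y : R) : 0 < w ->
  `|bump_xi w x - bump_xi w y| * (15 * w / (15 + w)) <= `|x - y|.
Proof.
move=> w0; rewrite /bump_xi.
have hu : `|clamp (-1) 1 (x / w) - clamp (-1) 1 (y / w)| * w <= `|x - y|.
  have le1 : (-1 : R) <= 1 by lra.
  rewrite -ler_pdivlMr //; apply: le_trans (clamp_lip_abs _ _ le1) _.
  by rewrite -mulrBl normrM normfV (gtr0_norm w0).
have hv : `|cutoff 5 20 x - cutoff 5 20 y| * 15 <= `|x - y|.
  have l520 : (5 : R) < 20 by lra.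
  by have := cutoff_lip x y l520; have -> : (20 - 5 : R) = 15 by lra.
have /andP[v0 v1] := cutoff_in 5 20 x.
have /andP[u0 u1] : -1 <= clamp (-1) 1 (y / w) <= 1 by apply: clamp_in; lra.
move: hu hv v0 v1 u0 u1; set u := clamp _ _ (x / w); set u' := clamp _ _ (y / w).
set v := cutoff 5 20 x; set v' := cutoff 5 20 y => hu hv v0 v1 u0 u1.
have le : `|u * v - u' * v'| <= `|u - u'| + `|v - v'|.
  have -> : u * v - u' * v' = (u - u') * v + u' * (v - v') by ring.
  apply: le_trans (ler_normD _ _) _; rewrite !normrM (ger0_norm v0).
  have n1 : `|u'| <= 1 by rewrite ler_norml u0.
  by apply: lerD; [rewrite ler_piMr|rewrite ler_piMl].
rewrite mulrA ler_pdivrMr; last by lra.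
have : `|u * v - u' * v'| * (15 * w) <= (`|u - u'| + `|v - v'|) * (15 * w).
  by rewrite ler_pM2r //; lra.
nra.
Qed.

Lemma bump_xi_in (w x : R) : 0 < w ->
  [/\ -1 <= bump_xi w x, bump_xi w x <= 1, 0 <= x -> 0 <= bump_xi w x
    & x <= 0 -> bump_xi w x <= 0].
Proof.
move=> w0; rewrite /bump_xi; have /andP[v0 v1] := cutoff_in 5 20 x.
have le1 : (-1 : R) <= 1 by lra.
have /andP[u0 u1] : -1 <= clamp (-1) 1 (x / w) <= 1 by apply: clamp_in.
split; [nra|nra|move=> x0|move=> x0].
- apply: mulr_ge0 => //; have xw : 0 <= x / w by apply: divr_ge0 => //; apply: ltW.
  by case: (clampP (x / w) le1) => *; lra.
- apply: mulr_le0_ge0 => //; have xw : x / w <= 0 by rewrite pmulr_lle0 ?invr_gt0.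
  by case: (clampP (x / w) le1) => *; lra.
Qed.

Lemma bump_xi1 (w x : R) : 0 < w -> w <= x -> x <= 5 -> bump_xi w x = 1.
Proof.
move=> w0 wx x5; rewrite /bump_xi cutoff1; [|lra|by rewrite ger0_norm //; lra].
by rewrite mulr1 clamp_hi ?ler_pdivlMr ?mul1r //; lra.
Qed.

Lemma bump_xiN1 (w x : R) : 0 < w -> x <= - w -> -5 <= x -> bump_xi w x = -1.
Proof.
move=> w0 wx x5; rewrite /bump_xi cutoff1; [|lra|by rewrite ler0_norm //; lra].
by rewrite mulr1 clamp_lo ?ler_pdivrMr ?mulN1r //; lra.
Qed.

Definition bump_path (a b w x : R) : plane :=
  let s := cutoff w (3 / 2 * w) x in
  (x - w / 2 * (1 - s) * bump_xi w x, a + (b - a) * s).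

Lemma bump_pathP (a b w : R) : 0 < w -> w <= 3 -> a != b ->
  forall u, Defs.bump a b w u <-> exists x, u = bump_path a b w x.
Proof.
move=> w0 w3 ab u; have ww : w < 3 / 2 * w by lra.
have ba0 : b - a != 0 by rewrite subr_eq0 eq_sym.
have s_mid x : w <= `|x| -> `|x| <= 3 / 2 * w -> cutoff w (3 / 2 * w) x = 3 - 2 * `|x| / w.
  move=> h1 h2; rewrite /cutoff clamp_id; first by field; rewrite gt_eqF //=; lra.
  have d0 : 0 < 3 / 2 * w - w by lra.
  by rewrite ler_pdivrMr // ler_pdivlMr //; apply/andP; split; lra.
split; last first.
  move=> [x ->]; rewrite /bump_path /Defs.bump /=.
  have [xw|wx] := leP `|x| w.
    by apply: Or33; rewrite cutoff1 // subrr mulr0 mul0r subr0; split=> //; lra.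
  have [x3|x3] := leP `|x| (3 / 2 * w); last first.
    apply: Or31; rewrite (cutoff0 ww (ltW x3)) subr0 mulr1 mulr0 addr0; split=> //.
    have [x1 x2 _ _] := bump_xi_in x w0.
    have [x0|x0] := lerP 0 x.
      rewrite (ger0_norm x0) in x3; rewrite ger0_norm; first by nra.
      nra.
    by rewrite (ltr0_norm x0) in x3; rewrite ler0_norm; nra.
  apply: Or32; rewrite s_mid ?(ltW wx) //.
  (* On a slanted side the horizontal shear takes back exactly the excess of [|x|] over [w]. As
     [w <= 3], such a side lies in [|x| <= 9 / 2], within the range [|x| <= 5] where [bump_xi] is 1
     or -1. *)
  have e1 : w / 2 * (1 - (3 - 2 * `|x| / w)) = `|x| - w by field; rewrite gt_eqF.
  rewrite e1; split.
    have [x0|x0] := lerP 0 x.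
      rewrite (ger0_norm x0) in wx x3 *; rewrite bump_xi1; [|lra|lra|lra].
      by have -> : x - (x - w) * 1 = w; [ring|rewrite ger0_norm //; lra].
    rewrite (ltr0_norm x0) in wx x3 *; rewrite bump_xiN1; [|lra|lra|lra].
    by have -> : x - (- x - w) * -1 = - w; [ring|rewrite normrN ger0_norm //; lra].
  have t0 : 2 <= 2 * `|x| / w by rewrite ler_pdivlMr //; lra.
  have t1 : 2 * `|x| / w <= 3 by rewrite ler_pdivrMr //; lra.
  move: (2 * `|x| / w) t0 t1 => t t0 t1.
  have -> : (a + (b - a) * (3 - t) - a) * (a + (b - a) * (3 - t) - b) =
     - ((b - a) ^+ 2 * ((3 - t) * (1 - (3 - t)))) by ring.
  by rewrite oppr_le0 mulr_ge0 ?sqr_ge0 // mulr_ge0; lra.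
case: u => p q; rewrite /Defs.bump /= => -[[wp ->]|[pw qab]|[pw ->]].
- have [X XE] : exists X, X + - (w / 2) * bump_xi w X = p.
    apply: (@incr_surj _ _ (w / 2)).
      have cxi : continuous (bump_xi w).
        by rewrite /bump_xi; ct; apply: cont_cutoff; ct.
      by ct.
    move=> x; rewrite addrAC subrr add0r normrM normrN (gtr0_norm (x := w / 2)); last by lra.
    have [x1 x2 _ _] := bump_xi_in x w0.
    have : `|bump_xi w x| <= 1 by rewrite ler_norml x1.
    nra.
  (* The amplitude [w / 2] is below [15 * w / (15 + w)] because [w < 15]. *)
  have mono x y : x < y -> x - w / 2 * bump_xi w x < y - w / 2 * bump_xi w y.
    move=> xy; have := @lip_shear R (- (w / 2)) x y (bump_xi w) (15 * w / (15 + w)).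
    have cL : `| - (w / 2)| < 15 * w / (15 + w).
      rewrite normrN ger0_norm; last by lra.
      by rewrite ltr_pdivlMr; nra.
    by move=> /(_ cL (bump_xi_lip x y w0) xy); lra.
  have X3 : 3 / 2 * w <= `|X|.
    rewrite leNgt; apply/negP; rewrite ltr_norml => /andP[X1 X2].
    have e1 : bump_xi w (3 / 2 * w) = 1 by apply: bump_xi1; lra.
    have e2 : bump_xi w (- (3 / 2 * w)) = -1 by apply: bump_xiN1; lra.
    have := mono _ _ X2; have := mono _ _ X1; rewrite e1 e2.
    by move: wp; rewrite ler_normr => /orP[]; lra.
  by exists X; rewrite /bump_path cutoff0 // subr0 mulr1 mulr0 addr0; congr (_, _); lra.
- pose s := (q - a) / (b - a).
  have qE : q = a + (b - a) * s by rewrite /s; field.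
  have /andP[s0 s1] : 0 <= s <= 1.
    have h : (b - a) ^+ 2 * (s * (1 - s)) >= 0.
      have -> : (b - a) ^+ 2 * (s * (1 - s)) = - ((q - a) * (q - b)) by rewrite qE; ring.
      by rewrite oppr_ge0.
    have d0 : 0 < (b - a) ^+ 2 by rewrite exprn_even_gt0.
    rewrite pmulr_rge0 // in h.
    by apply/andP; split; nra.
  pose t := w * (3 - s) / 2.
  have t1 : w <= t by rewrite /t; nra.
  have t2 : t <= 3 / 2 * w by rewrite /t; nra.
  have t0 : 0 <= t by lra.
  have e : 3 - 2 * t / w = s by rewrite /t; field; rewrite gt_eqF.
  have e2 : w / 2 * (1 - s) = t - w by rewrite /t; field.
  have [p0|p0] := lerP 0 p.
    rewrite (ger0_norm p0) in pw; exists t.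
    rewrite /bump_path s_mid (ger0_norm t0) // e e2 bump_xi1; [|lra|lra|lra].
    by rewrite pw qE; congr (_, _); ring.
  rewrite (ltr0_norm p0) in pw; exists (- t).
  rewrite /bump_path s_mid normrN (ger0_norm t0) // e e2 bump_xiN1; [|lra|lra|lra].
  by rewrite qE; congr (_, _); lra.
- exists p; rewrite /bump_path cutoff1 // subrr mulr0 mul0r subr0.
  by congr (_, _); lra.
Qed.

(** Both shears are cut off at vertical distance [1 / 4] from [h], so the strand slides past [T]
    without moving it. The cutoff in [y] is 1 on [|y| <= 4], which contains the path, and then
    decreases with slope [1 / 8], gentle enough for a push of amplitude at most 2. *)
Lemma level_bump (a b w h : R) (T : set space) :
  0 < w -> w <= 3 -> a != b -> `|a| <= 1 -> `|b| <= 1 -> `|h| <= 1 / 2 ->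
  (forall p, T p -> 1 / 4 <= `|p.2 - h|) ->
  tangle_equiv (T `|` [set p | hline a p.1 /\ p.2 = h])
               (T `|` [set p | Defs.bump a b w p.1 /\ p.2 = h]).
Proof.
move=> w0 w3 ab a1 b1 h1 Th.
have ww : w < 3 / 2 * w by lra.
have ba0 : b - a != 0 by rewrite subr_eq0 eq_sym.
have l14 : (0 : R) < 1 / 4 by lra.
have l412 : (4 : R) < 12 by lra.
have l520 : (5 : R) < 20 by lra.
pose lam (z : R) := cutoff 0 (1 / 4) (z - h).
have lamh : lam h = 1 by rewrite /lam subrr cutoff1 // normr0.
have lam0 z : 1 / 4 <= `|z - h| -> lam z = 0 by move=> hz; rewrite /lam cutoff0.
have lam_in z : 0 <= lam z <= 1 by apply: cutoff_in.
have lam_out z : 1 <= `|z| -> lam z = 0.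
  move=> z1; apply: lam0; have := ler_normB z h.
  have := ler_distD h z 0; rewrite !subr0; lra.
pose f (x : R) := cutoff w (3 / 2 * w) x.
pose chi (y : R) := cutoff 4 12 y.
pose Dy (x y z : R) := lam z * (b - a) * f x * chi y.
have ba2 : `|b - a| <= 2 by apply: le_trans (ler_normB _ _) _; lra.
have cyb x z : `|lam z * (b - a) * f x| <= 2.
  have /andP[l0 l1] := lam_in z; have /andP[f0 f1] := cutoff_in w (3 / 2 * w) x.
  rewrite !normrM (ger0_norm l0) (ger0_norm f0) -/(f x).
  rewrite -/(f x) in f0 f1; have d0 := normr_ge0 (b - a).
  have e1 : lam z * `|b - a| <= `|b - a| by rewrite ler_piMl.
  have e2 : lam z * `|b - a| * f x <= lam z * `|b - a| by rewrite ler_piMr // mulr_ge0.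
  lra.
(* After the vertical shear the profile can be read off from [y]: for [y = a + (b - a) * s] this is
   [w / 2 * (1 - s)]. So the amplitude of the second shear does not depend on [x]. *)
pose q (y : R) := w / 2 * clamp 0 1 (1 - (y - a) / (b - a)) * chi y.
have q_in y : 0 <= q y <= w / 2.
  have /andP[c0 c1] : 0 <= clamp 0 1 (1 - (y - a) / (b - a)) <= 1 by apply: clamp_in.
  have /andP[k0 k1] := cutoff_in 4 12 y.
  have w20 : 0 <= w / 2 by lra.
  rewrite /q /chi; move: (clamp _ _ _) (cutoff _ _ _) c0 c1 k0 k1 => c k c0 c1 k0 k1.
  have h0 : 0 <= w / 2 * c by rewrite mulr_ge0.
  rewrite mulr_ge0 //=; apply: (@le_trans _ _ (w / 2 * c)); first by rewrite ler_piMr.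
  by rewrite ler_piMr.
pose Dx (x y z : R) := - (lam z * q y) * bump_xi w x.
have cxb y z : `| - (lam z * q y)| <= w / 2.
  have /andP[l0 l1] := lam_in z; have /andP[q0 q1] := q_in y.
  by rewrite normrN normrM (ger0_norm l0) (ger0_norm q0); nra.
pose T1 := (fun p : space => ((p.1.1, p.1.2 + Dy p.1.1 p.1.2 p.2), p.2)) @`
  (T `|` [set p | hline a p.1 /\ p.2 = h]).
have clam (U : topologicalType) (g : U -> R) : continuous g -> continuous (fun u => lam (g u)).
  by move=> cg; apply: cont_cutoff; ct.
have E1 : tangle_equiv (T `|` [set p | hline a p.1 /\ p.2 = h]) T1.
  apply: (@yshear R Dy 2 20).
  - have k1 : continuous (fun p : space => lam p.2) by apply: clam; ct.
    have k2 : continuous (fun p : space => f p.1.1) by apply: cont_cutoff; ct.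
    have k3 : continuous (fun p : space => chi p.1.2) by apply: cont_cutoff; ct.
    apply: cont_mul k3; apply: cont_mul k2; apply: cont_mul k1 _.
    exact: cont_cst.
  - move=> x y z; rewrite /Dy normrM; have /andP[k0 k1] := cutoff_in 4 12 y.
    rewrite (ger0_norm k0) -/(chi y); have := cyb x z.
    by move: (`|_|) (normr_ge0 (lam z * (b - a) * f x)) => d d0 d2; rewrite -/(chi y) in k0 k1; nra.
  - move=> x y z [hx|[hy|hz]]; rewrite /Dy.
    + by rewrite /f cutoff0 ?mulr0 ?mul0r //; lra.
    + by rewrite /chi cutoff0 ?mulr0 //; lra.
    + by rewrite lam_out // !mul0r.
  - move=> x z y y' yy; apply: (@lip_shear R _ y y' chi 8) => //.
      by apply: le_lt_trans (cyb x z) _; lra.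
    by have := cutoff_lip y y' l412; have -> : (12 - 4 : R) = 8 by lra.
have E2 : tangle_equiv T1
    ((fun p : space => ((p.1.1 + Dx p.1.1 p.1.2 p.2, p.1.2), p.2)) @` T1).
  apply: (@xshear R Dx (w / 2) 20).
  - have k1 : continuous (fun p : space => lam p.2) by apply: clam; ct.
    have k2 : continuous (fun p : space => q p.1.2).
      have k3 : continuous (fun p : space => chi p.1.2) by apply: cont_cutoff; ct.
      have k4 : continuous (fun p : space => clamp 0 1 (1 - (p.1.2 - a) / (b - a))).
        by apply: cont_clamp; ct.
      by apply: cont_mul k3; apply: cont_mul k4; apply: cont_cst.
    have k5 : continuous (fun p : space => bump_xi w p.1.1).
      have k6 : continuous (fun p : space => cutoff 5 20 p.1.1) by apply: cont_cutoff; ct.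
      have k7 : continuous (fun p : space => clamp (-1) 1 (p.1.1 / w)).
        by apply: cont_clamp; ct.
      exact: cont_mul k7 k6.
    by apply: cont_mul k5; apply: cont_opp; apply: cont_mul k1 k2.
  - move=> x y z; rewrite /Dx normrM; have [x1 x2 _ _] := bump_xi_in x w0.
    have x3 : `|bump_xi w x| <= 1 by rewrite ler_norml x1.
    have := cxb y z; move: (`|_|) (normr_ge0 (- (lam z * q y))) => d d0 d2.
    by have := normr_ge0 (bump_xi w x); nra.
  - move=> x y z [hx|[hy|hz]]; rewrite /Dx.
    + by rewrite /bump_xi cutoff0 ?mulr0 //; lra.
    + by rewrite /q /chi cutoff0 ?mulr0 ?oppr0 ?mul0r //; lra.
    + by rewrite lam_out // mul0r oppr0 mul0r.
  - move=> y z x x' xx; apply: (@lip_shear R _ x x' (bump_xi w) (15 * w / (15 + w))) => //.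
      by apply: le_lt_trans (cxb y z) _; rewrite ltr_pdivlMr; nra.
    exact: bump_xi_lip.
have path_eq x : ((x + Dx x (a + Dy x a h) h, a + Dy x a h) : plane) = bump_path a b w x.
  rewrite /bump_path /Dx /Dy lamh !mul1r /chi cutoff1 ?mulr1 //; last by lra.
  rewrite -/(f x); have /andP[f0 f1] := cutoff_in w (3 / 2 * w) x; rewrite -/(f x) in f0 f1.
  congr (_, _); rewrite /q /chi cutoff1 ?mulr1 //.
    have -> : (a + (b - a) * f x - a) / (b - a) = f x by field.
    by rewrite clamp_id; [ring|apply/andP; split; lra].
  have -> : a + (b - a) * f x = (1 - f x) * a + f x * b by ring.
  apply: le_trans (ler_normD _ _) _; rewrite !normrM (ger0_norm f0) ger0_norm; last by lra.
  by move: (normr_ge0 a) (normr_ge0 b); nra.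
apply: tangle_equiv_trans E1 _; move: E2; congr tangle_equiv.
rewrite /T1 image_comp; apply/seteqP; split.
- move=> _ [[[x y] z] /= [Tp <-|[hy hz] <-]].
    have l0 : lam z = 0 by apply: lam0; apply: (Th _ Tp).
    by left; rewrite /Dx /Dy l0 !mul0r oppr0 mul0r !addr0.
  right; rewrite /= in hz; rewrite hz; split=> //.
  have -> : y = a by exact: hy.
  by apply/(bump_pathP w0 w3 ab); exists x; rewrite -path_eq.
- move=> [[x y] z] [Tp|[/= hb ->]].
    have l0 : lam z = 0 by apply: lam0; apply: (Th _ Tp).
    by exists ((x, y), z); [left|rewrite /= /Dx /Dy l0 !mul0r oppr0 mul0r !addr0].
  have [X ->] := (bump_pathP w0 w3 ab _).1 hb.
  by exists ((X, a), h); [right|rewrite -path_eq].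
Qed.

End LevelBump.

(** * Recognizing the diagram of a tangle *)

Section LocalPresentation.
Variables (R : realType) (X : topologicalType).
Local Notation plane := (R * R)%type.
Implicit Types (T : set (X * R)) (D : diagram X).

(* The tangle is read off by an injective parameter [psi], so that the four
   branches at a crossing would give four disjoint intervals of the line. *)
Lemma embedded_not_crossing T D u (N : set X) (psi : X * R -> R) :
  slab T -> continuous psi -> nbhs u N ->
  (forall y, N y -> dset D y -> exists z, T (y, z)) ->
  (forall y z z', N y -> T (y, z) -> T (y, z') -> z = z') ->
  (forall p q, N p.1 -> N q.1 -> T p -> T q -> psi p = psi q -> p = q) ->
  ~ crossing R D u.
Proof.
move=> sT cpsi uN DT Tu Ti [e [ee e0 eS]].
have [ce ei _] := ee.
have [d d0 dN] : exists2 d, 0 < d & forall v, N (e (squeeze d v)).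
  by apply: (chart_shrink ce); rewrite e0.
pose k (v : plane) := e (squeeze d v).
have [ck ki _] : open_embedding k by apply: embed_comp ee; apply: squeeze_embed.
have kS v : v.1 * v.2 = 0 -> exists z, T (k v, z).
  move=> v0; apply: DT; first exact: dN.
  by have [h _] := eS (squeeze d v); apply/h; rewrite squeeze12_eq0.
have path (c : R -> plane) : continuous c -> (forall s, (c s).1 * (c s).2 = 0) ->
    exists2 g : R -> R, continuous g & forall s, T (k (c s), g s).
  move=> cc c0; have [g gP] := choice (fun s => kS (c s) (c0 s)).
  exists g => //; have ckc : continuous (fun s => k (c s)) by apply: cont_comp cc.
  by move=> s; apply: (height_cont sT (ckc s) _ gP) => z Tz; exact: (Tu (k (c s)) z (g s) (dN _) Tz (gP s)).
have cpa : continuous (fun s : R => (s, 0) : plane) by ct.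
have cpb : continuous (fun s : R => (0, s) : plane) by ct.
have [a ca aP] := path _ cpa (fun s => mulr0 _).
have [b cb bP] := path _ cpb (fun s => mul0r _).
have cha : continuous (fun s => psi (k (s, 0), a s)).
  by apply: cont_comp cpsi _; apply: cont_pair => //; apply: cont_comp ck _.
have chb : continuous (fun s => psi (k (0, s), b s)).
  by apply: cont_comp cpsi _; apply: cont_pair => //; apply: cont_comp ck _.
have ab0 : a 0 = b 0 by apply: (Tu (k (0, 0))) => //; exact: dN.
pose h s := psi (k (s, 0), a s) - psi (k (0, 0), a 0).
have [|||ep ep0 epP] := @injective_line_range R h.
- by rewrite /h; ct.
- move=> s t /= /addIr /Ti H.
  by have [/ki[]] := H (dN _) (dN _) (aP _) (aP _).
- by rewrite /h subrr.
have : nbhs (0 : R) [set s | `|psi (k (0, s), b s) - psi (k (0, 0), a 0)| < ep].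
  have c' : continuous (fun s => psi (k (0, s), b s) - psi (k (0, 0), a 0)) by ct.
  apply: (cont_nbhs (A := [set y : R | `|y| < ep]) (c' 0)); rewrite /= -ab0 subrr.
  by apply/nbhs_lineP; exists ep => // y; rewrite subr0.
move=> /nbhs_lineP[r r0 /(_ (r / 2))]; rewrite subr0 gtr0_norm ?divr_gt0 //.
have r20 : r / 2 < r by lra.
move=> /(_ r20) /epP [s /addIr sE].
have := Ti (k (s, 0), a s) (k (0, r / 2), b (r / 2)) (dN _) (dN _) (aP s) (bP _) sE.
by move=> [/ki[_ r2] _]; exfalso; clear -r0 r2; lra.
Qed.

Lemma dset_of_point D u : simple_point R D u \/ crossing R D u -> dset D u.
Proof.
move=> [|] [e [_ <- eS]]; first exact/eS.
by have [h _] := eS (0, 0); apply/h; rewrite mulr0.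
Qed.

Lemma presents_out T D u : ~ dset D u -> (forall z, ~ T (u, z)) -> presents_at T D u.
Proof.
move=> nD nT; split; first by split=> [//|[z /nT]].
- by move=> s; case: nD; apply: dset_of_point; left.
- by move=> s; case: nD; apply: dset_of_point; right.
Qed.

Lemma presents_single T D u (N : set X) (psi : X * R -> R) z0 :
  slab T -> continuous psi -> nbhs u N -> T (u, z0) ->
  (forall y, N y -> dset D y <-> exists z, T (y, z)) ->
  (forall y z z', N y -> T (y, z) -> T (y, z') -> z = z') ->
  (forall p q, N p.1 -> N q.1 -> T p -> T q -> psi p = psi q -> p = q) ->
  presents_at T D u.
Proof.
move=> sT cpsi uN Tz DT Tu Ti; have Nu := nbhs_singleton uN; split.
- exact: DT.
- by move=> _; exists z0 => z; split=> [Tz'|-> //]; apply: (Tu u).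
- by move=> c; case: (embedded_not_crossing sT cpsi uN _ Tu Ti c) => y Ny /(DT y Ny).
Qed.

Lemma presents_double T D (e : plane -> X) hp hq : hq < hp -> open_embedding e ->
  (forall v, dset D (e v) <-> v.1 * v.2 = 0) ->
  (forall v, dover D (e (0, 0)) (e v) <-> v.2 = 0) ->
  (forall v z, T (e v, z) <-> (v.2 = 0 /\ z = hp) \/ (v.1 = 0 /\ z = hq)) ->
  presents_at T D (e (0, 0)).
Proof.
move=> hpq ee eD eO eT.
have cr : crossing R D (e (0, 0)) by exists e.
have near_e (z : R) (P : R -> Prop) : (\forall t \near z, P t) ->
    \forall p \near (e (0, 0), z), (exists v, p.1 = e v) /\ P p.2.
  have re : nbhs (e (0, 0)) (range e).
    by case: ee => _ _ /(_ setT openT) oe; apply: open_nbhs_nbhs; split.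
  move=> zP; exists (range e, P) => //=.
  by move=> [y t] /= [[v _ <-] Pt]; split=> //; exists v.
split.
- rewrite eD /= mulr0; split=> // _; exists hp; apply/eT; by left.
- by move=> /simple_not_crossing /(_ cr).
- move=> _; exists hq, hp; split=> //.
  + by move=> z; rewrite eT /=; split=> [[[_ ->]|[_ ->]]|[->|->]]; [right|left|right|left].
  + have nz : \forall t \near hp, hq < t by apply: open_nbhs_nbhs; split; [exact: open_gt|].
    apply: filterS (near_e _ _ nz) => -[y t] /= [[v ->] ht] /eT[[v2 _]|[_ tq]].
      exact/eO.
    by rewrite tq ltxx in ht.
  + have nz : \forall t \near hq, t < hp by apply: open_nbhs_nbhs; split; [exact: open_lt|].
    apply: filterS (near_e _ _ nz) => -[y t] /= [[v ->] ht] /eT[[_ tp]|[v1 _]].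
      by rewrite tp ltxx in ht.
    by move=> /eO v2; congr e; rewrite [v]surjective_pairing v1 v2.
Qed.

End LocalPresentation.

Section Layered.
Variable R : realType.
Local Notation plane := (R * R)%type.
Local Notation space := ((R * R) * R)%type.
Implicit Types (A B C P Q : set plane) (u : plane).

Definition transverse P Q u := exists e : plane -> plane,
  [/\ open_embedding e, e (0, 0) = u, forall v, P (e v) <-> v.2 = 0 &
      forall v, Q (e v) <-> v.1 = 0].

Lemma transverse_sym P Q u : transverse P Q u -> transverse Q P u.
Proof.
move=> [e [ee e0 eP eQ]]; exists (fun v => e (v.2, v.1)); split=> //.
exact: embed_comp (swap_embed R) ee.
Qed.

Lemma transverse_avoid P Q C u : closed C -> ~ C u -> transverse P Q u ->
  exists e : plane -> plane,
  [/\ open_embedding e, e (0, 0) = u, forall v, P (e v) <-> v.2 = 0,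
      forall v, Q (e v) <-> v.1 = 0 & forall v, ~ C (e v)].
Proof.
move=> cC nC [e [ee e0 eP eQ]].
have [d d0 dN] : exists2 d, 0 < d & forall v, (~` C) (e (squeeze d v)).
  case: (ee) => ce _ _; apply: (chart_shrink ce); rewrite e0.
  by apply: open_nbhs_nbhs; split; [exact: closed_openC|].
exists (fun v => e (squeeze d v)); split.
- exact: embed_comp (squeeze_embed d0) ee.
- by rewrite squeeze0.
- by move=> v; rewrite eP squeeze2_eq0.
- by move=> v; rewrite eQ; apply: squeeze1_eq0.
- exact: dN.
Qed.

Lemma affine_embed (p q a b c d : R) : a * d - b * c != 0 ->
  open_embedding (fun v : plane => (p + (a * v.1 + b * v.2), q + (c * v.1 + d * v.2)) : plane).
Proof.
move=> D0; apply: homeo_embed; split; first by ct.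
exists (fun v => ((d * (v.1 - p) - b * (v.2 - q)) / (a * d - b * c),
                  (a * (v.2 - q) - c * (v.1 - p)) / (a * d - b * c))).
split; first by ct.
- by move=> [x y] /=; congr (_, _); field.
- by move=> [x y] /=; congr (_, _); field.
Qed.

(** A substitute for being an embedded line, in the form that excludes crossings where the
    projection is injective. It is transported by isotopies, so bumps and kinks inherit it from
    straight lines. *)
Definition readable (T : set space) := exists2 psi : space -> R, continuous psi &
  forall p q, T p -> T q -> psi p = psi q -> p = q.

Definition level A (h : R) : set space := [set p | A p.1 /\ p.2 = h].

Lemma closed_level A h : closed A -> closed (level A h).
Proof.
move=> cA; rewrite (_ : level A h = fst @^-1` A `&` snd @^-1` [set h]); last by [].
apply: closedI.
  by apply: closed_comp => // p _; exact: cvg_fst.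
by apply: closed_comp => [p _|]; [exact: cvg_snd|exact: closed_eq].
Qed.

(** Without triple points, near each point at most two layers matter: a single one is handled by
    [presents_single], and two form a crossing whose upper branch lies on the higher layer. *)
Lemma layered_presents A B C (a b c : R) :
  closed A -> closed B -> closed C -> b < a -> c < b -> `|a| < 1 -> `|b| < 1 -> `|c| < 1 ->
  readable (level A a) -> readable (level B b) -> readable (level C c) ->
  (forall u, A u -> B u -> ~ C u) ->
  (forall u, A u -> B u -> transverse A B u) ->
  (forall u, A u -> C u -> transverse A C u) ->
  (forall u, B u -> C u -> transverse B C u) ->
  let T := level A a `|` level B b `|` level C c in
  slab T /\ forall u, presents_at T (layers [:: A; B; C]) u.
Proof.
move=> cA cB cC ba cb a1 b1 c1 rA rB rC nABC tAB tAC tBC T.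
have sT : slab T.
  split; first by apply: closedU; [apply: closedU|]; apply: closed_level.
  by move=> p [[[_ ->]|[_ ->]]|[_ ->]].
split=> // u; set D := layers _.
have DE y : dset D y <-> [\/ A y, B y | C y].
  rewrite /D /=; split=> [[h|[h|[h|[]]]]|[h|h|h]].
  - by apply: Or31.
  - by apply: Or32.
  - by apply: Or33.
  - by left.
  - by right; left.
  - by right; right; left.
have avoid P y : closed P -> ~ P y -> nbhs y (~` P).
  by move=> cP nP; apply: open_nbhs_nbhs; split; [exact: closed_openC|].
have single (S P Q : set plane) h : readable (level S h) -> closed P -> closed Q ->
    S u -> ~ P u -> ~ Q u ->
    (forall y, ~ P y -> ~ Q y -> dset D y <-> S y) ->
    (forall y z, ~ P y -> ~ Q y -> T (y, z) <-> S y /\ z = h) -> presents_at T D u.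
  move=> [psi cpsi psii] cP cQ Su nP nQ DS TS.
  apply: (@presents_single _ _ T D u (~` P `&` ~` Q) psi h) => //.
  - by apply: filterI; apply: avoid.
  - exact/TS.
  - move=> y [Py Qy]; rewrite DS //; split=> [Sy|[z /TS[]//]].
    by exists h; apply/TS.
  - by move=> y z z' [Py Qy] /TS[//|//|_ ->] /TS[//|//|_ ->].
  - move=> [y z] [y' z'] /= [Py Qy] [Py' Qy'] /TS[//|//|Sy zh] /TS[//|//|Sy' zh'].
    by apply: psii.
have double (S S' P : set plane) h h' : h' < h -> closed P -> transverse S S' u ->
    ~ P u -> (forall y, ~ P y -> dset D y <-> S y \/ S' y) ->
    (forall y, ~ P y -> dover D u y <-> S y) ->
    (forall y z, ~ P y -> T (y, z) <-> (S y /\ z = h) \/ (S' y /\ z = h')) ->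
    presents_at T D u.
  move=> hh cP tr nP DS OS TS.
  have [e [ee e0 eS eS' eP]] := transverse_avoid cP nP tr.
  rewrite -e0; apply: (@presents_double _ _ T D e h h') => //.
  - move=> v; rewrite DS // eS eS'; split=> [[->|->]|/eqP]; rewrite ?mulr0 ?mul0r //.
    by rewrite mulf_eq0 => /orP[/eqP|/eqP]; [right|left].
  - by move=> v; rewrite e0 OS.
  - by move=> v z; rewrite TS // eS eS'.
have TE y z : T (y, z) <-> [\/ A y /\ z = a, B y /\ z = b | C y /\ z = c].
  rewrite /T; split=> [[[h|h]|h]|[h|h|h]].
  - by apply: Or31.
  - by apply: Or32.
  - by apply: Or33.
  - by left; left.
  - by left; right.
  - by right.
have OE y : dover D u y <-> (A u /\ A y) \/ (~ A u /\ ((B u /\ B y) \/ (~ B u /\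
    ((C u /\ C y) \/ (~ C u /\ False))))) by [].
have [Au|nA] := pselect (A u); have [Bu|nB] := pselect (B u);
  have [Cu|nC] := pselect (C u).
- by case: (nABC u).
- apply: (@double A B C a b) => //; first exact: tAB.
  + by move=> y nCy; rewrite DE; split=> [[]|[]]; [left|right| |apply: Or31|apply: Or32].
  + by move=> y nCy; rewrite OE; split=> [[[]|[]]|Ay] //; left.
  + by move=> y z nCy; rewrite TE; split=> [[|| []]|[]]; [left|right| |apply: Or31|apply: Or32].
- apply: (@double A C B a c) => //; [exact: lt_trans cb ba|exact: tAC| | |].
  + by move=> y nCy; rewrite DE; split=> [[]|[]]; [left| |right|apply: Or31|apply: Or33].
  + by move=> y nCy; rewrite OE; split=> [[[]|[]]|Ay] //; left.
  + by move=> y z nCy; rewrite TE; split=> [[| []|]|[]]; [left| |right|apply: Or31|apply: Or33].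
- apply: (@single A B C a) => //.
  + by move=> y n1 n2; rewrite DE; split=> [[]|] //; apply: Or31.
  + by move=> y z n1 n2; rewrite TE; split=> [[|[]|[]]|] //; apply: Or31.
- apply: (@double B C A b c) => //; first exact: tBC.
  + by move=> y nCy; rewrite DE; split=> [[]|[]]; [ |left|right|apply: Or32|apply: Or33].
  + move=> y nCy; rewrite OE; split=> [[[]|[_ [[]|[]]]]|By] //.
    by right; split=> //; left.
  + by move=> y z nCy; rewrite TE; split=> [[[]| |]|[]]; [ |left|right|apply: Or32|apply: Or33].
- apply: (@single B A C b) => //.
  + by move=> y n1 n2; rewrite DE; split=> [[]|] //; apply: Or32.
  + by move=> y z n1 n2; rewrite TE; split=> [[[]||[]]|] //; apply: Or32.
- apply: (@single C A B c) => //.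
  + by move=> y n1 n2; rewrite DE; split=> [[]|] //; apply: Or33.
  + by move=> y z n1 n2; rewrite TE; split=> [[[]|[]|]|] //; apply: Or33.
- apply: presents_out; first by move=> /DE[].
  by move=> z /TE[] [].
Qed.

End Layered.

(** * The kink of the first Reidemeister move *)

Section Kink.
Variable R : realType.
Local Notation plane := (R * R)%type.
Local Notation space := ((R * R) * R)%type.
Implicit Types T : set space.

Lemma tangle_readable T T' : tangle_equiv T T' -> readable T -> readable T'.
Proof.
move=> [r [F [[cF hF F0 Fs] ->]]] [psi cpsi psii].
have [g [cg _] [Fg gF]] := homeo_inv (hF 1).
exists (fun p => psi (g p)); first exact: cont_comp cpsi cg.
by move=> _ _ [p Tp <-] [q Tq <-]; rewrite !Fg => /psii ->.
Qed.

Lemma readable_level (A : set plane) (f : plane -> R) (h : R) : continuous f ->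
  (forall u v, A u -> A v -> f u = f v -> u = v) -> readable (level A h).
Proof.
move=> cf fi; exists (fun p => f p.1); first by apply: cont_comp cf _; ct.
by move=> [u z] [v z'] [/= Au ->] [/= Av ->] /fi ->.
Qed.

(* The line [y = z = 0], parametrized by [X], is carried onto the kink by a shear
   in [y] (to [kink_f X]), then one in [z] (to [h * kink_g X]), then one in [x],
   whose displacement [kink_k] depends on the new [y] and on [z / h] only: the
   breakpoints 1, 6/5, 7/5, 8/5, 9/5, 2 of [X] go to the corners of the kink. *)
Definition kink_f (X : R) := clamp 0 1 (5 * (X - 1)) - 2 * clamp 0 1 (5 * (X - 7 / 5))
  + clamp 0 1 (5 * (X - 9 / 5)).
Definition kink_g (X : R) := clamp 0 1 (5 * (X - 6 / 5)) - clamp 0 1 (5 * (X - 8 / 5)).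

Definition kink_k (y s : R) :=
  (1 - s) * (- (clamp (-1) 1 y / 5)) + s * (- (3 / 2) + clamp (-1) 1 y / 10).

Definition kink_path (h X : R) : space :=
  ((X + kink_k (kink_f X) (kink_g X), kink_f X), h * kink_g X).

Ltac clamps := repeat first
  [ rewrite clamp_lo; [|lra|lra] | rewrite clamp_hi; [|lra|lra]
  | rewrite clamp_id; [|apply/andP; split; lra] ].

Lemma kink_pathE h X : [/\ X <= 1 \/ 2 <= X -> kink_path h X = ((X, 0), 0),
  1 <= X <= 6 / 5 -> kink_path h X = ((1, 5 * (X - 1)), 0),
  6 / 5 <= X <= 7 / 5 -> kink_path h X = ((7 - 5 * X, 1), h * (5 * X - 6)),
  7 / 5 <= X <= 8 / 5 -> kink_path h X = ((0, 15 - 10 * X), h)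
  & (8 / 5 <= X <= 9 / 5 -> kink_path h X = ((10 * X - 16, -1), h * (9 - 5 * X))) /\
    (9 / 5 <= X <= 2 -> kink_path h X = ((2, 5 * (X - 2)), 0))].
Proof.
have val f g x y z : kink_f X = f -> kink_g X = g -> X + kink_k f g = x -> f = y ->
    h * g = z -> kink_path h X = ((x, y), z).
  by rewrite /kink_path => -> -> -> -> ->.
split; last split.
- move=> [?|?]; (apply: (val 0 0); [rewrite /kink_f; clamps; lra|rewrite /kink_g; clamps; lra| | |]);
    rewrite ?mulr0 // /kink_k; clamps; lra.
- move=> /andP[? ?]; apply: (val (5 * (X - 1)) 0);
    [rewrite /kink_f; clamps; lra|rewrite /kink_g; clamps; lra| | |];
    rewrite ?mulr0 // /kink_k; clamps; lra.
- move=> /andP[? ?]; apply: (val 1 (5 * X - 6));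
    [rewrite /kink_f; clamps; lra|rewrite /kink_g; clamps; lra| | |]; rewrite // /kink_k; clamps; lra.
- move=> /andP[? ?]; apply: (val (15 - 10 * X) 1);
    [rewrite /kink_f; clamps; lra|rewrite /kink_g; clamps; lra| | |];
    rewrite ?mulr1 // /kink_k; clamps; lra.
- move=> /andP[? ?]; apply: (val (-1) (9 - 5 * X));
    [rewrite /kink_f; clamps; lra|rewrite /kink_g; clamps; lra| | |]; rewrite // /kink_k; clamps; lra.
- move=> /andP[? ?]; apply: (val (5 * (X - 2)) 0);
    [rewrite /kink_f; clamps; lra|rewrite /kink_g; clamps; lra| | |];
    rewrite ?mulr0 // /kink_k; clamps; lra.
Qed.

(** One case per edge of the polygonal kink, in order. [kink_in] lies at height [h], the two
    horizontal edges next to it climb from 0 to [h] and back, and the rest is at height 0. *)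
Variant kink_space (h x y z : R) : Prop :=
| KinkS1 of y = 0 & z = 0 & x <= 1
| KinkS2 of x = 1 & 0 <= y & y <= 1 & z = 0
| KinkS3 of y = 1 & 0 <= x & x <= 1 & z = h * (1 - x)
| KinkS4 of x = 0 & -1 <= y & y <= 1 & z = h
| KinkS5 of y = -1 & 0 <= x & x <= 2 & z = h * (1 - x / 2)
| KinkS6 of x = 2 & -1 <= y & y <= 0 & z = 0
| KinkS7 of y = 0 & z = 0 & 2 <= x.

Definition kink_tangle h : set space := [set p | kink_space h p.1.1 p.1.2 p.2].

Lemma kink_image h p : kink_tangle h p <-> exists X, p = kink_path h X.
Proof.
case: p => -[x y] z; rewrite /kink_tangle /=; split.
- case=> [-> -> x1|-> y0 y1 ->|-> x0 x1 ->|-> y0 y1 ->|-> x0 x1 ->|-> y0 y1 ->|-> -> x2].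
  + by exists x; have [-> //] := kink_pathE h x; left.
  + exists (1 + y / 5); have [_ k _ _ _] := kink_pathE h (1 + y / 5).
    by rewrite k; [congr (_, _, _); field|lra].
  + exists ((7 - x) / 5); have [_ _ k _ _] := kink_pathE h ((7 - x) / 5).
    by rewrite k; [congr (_, _, _); field|lra].
  + exists ((15 - y) / 10); have [_ _ _ k _] := kink_pathE h ((15 - y) / 10).
    by rewrite k; [congr (_, _, _); field|lra].
  + exists ((16 + x) / 10); have [_ _ _ _ [k _]] := kink_pathE h ((16 + x) / 10).
    by rewrite k; [congr (_, _, _); field|lra].
  + exists (2 + y / 5); have [_ _ _ _ [_ k]] := kink_pathE h (2 + y / 5).
    by rewrite k; [congr (_, _, _); field|lra].
  + by exists x; have [-> //] := kink_pathE h x; right.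
- move=> [X]; have [k1 k2 k3 k4 [k5 k6]] := kink_pathE h X.
  have [h1|h1] := lerP X 1; first by rewrite k1; [move=> [-> -> ->]; apply: KinkS1|left].
  have [h2|h2] := lerP X (6 / 5).
    by rewrite k2; [clear -h1 h2 => -[-> -> ->]; apply: KinkS2; lra|lra].
  have [h3|h3] := lerP X (7 / 5).
    by rewrite k3; [clear -h2 h3 => -[-> -> ->]; apply: KinkS3; lra|lra].
  have [h4|h4] := lerP X (8 / 5).
    by rewrite k4; [clear -h3 h4 => -[-> -> ->]; apply: KinkS4; lra|lra].
  have [h5|h5] := lerP X (9 / 5).
    by rewrite k5; [clear -h4 h5 => -[-> -> ->]; apply: KinkS5; try lra; field|lra].
  have [h6|h6] := lerP X 2.
    by rewrite k6; [clear -h5 h6 => -[-> -> ->]; apply: KinkS6; lra|lra].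
  by rewrite k1; [clear -h6 => -[-> -> ->]; apply: KinkS7; lra|right; lra].
Qed.

Lemma kink_equiv h : h != 0 -> `|h| <= 1 / 2 -> tangle_equiv (level (hline 0) 0) (kink_tangle h).
Proof.
move=> h0 h1.
have l412 : (4 : R) < 12 by lra.
have l420 : (4 : R) < 20 by lra.
have l121 : (1 / 2 : R) < 1 by lra.
have fP x : [/\ `|kink_f x| <= 1, 20 <= `|x| -> kink_f x = 0, 0 <= kink_g x <= 1
    & 20 <= `|x| -> kink_g x = 0].
  have h1' : `|kink_f x| <= 1 /\ 0 <= kink_g x <= 1.
    have /kink_image : exists X, kink_path 1 x = kink_path 1 X by exists x.
    by rewrite /kink_tangle /kink_path /= mul1r ler_norml => -[] *; lra.
  have out : 20 <= `|x| -> kink_f x = 0 /\ kink_g x = 0.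
    have [k _ _ _ _] := kink_pathE 1 x; rewrite ler_normr => xx.
    have [] : kink_path 1 x = ((x, 0), 0) by apply: k; case/orP: xx => ?; [right|left]; lra.
    by rewrite mul1r => _ -> ->.
  by case: h1' => a b; split=> // /out[].
have cf (U : topologicalType) (u : U -> R) : continuous u -> continuous (fun x => kink_f (u x)).
  by move=> cu; rewrite /kink_f; ct.
have cg (U : topologicalType) (u : U -> R) : continuous u -> continuous (fun x => kink_g (u x)).
  by move=> cu; rewrite /kink_g; ct.
(* In the three shears the cutoffs in [y] and [z] equal 1 on the successive images of the line. The
   cutoff in the sheared variable has slope [1 / 8], 1 and [1 / 16], for amplitudes at most 1,
   [1 / 2] and [8 / 5]. *)
pose Dy (x y z : R) := kink_f x * cutoff (1 / 2) 1 z * cutoff 4 12 y.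
pose Dz (x y z : R) := h * kink_g x * cutoff 4 12 y * cutoff 0 1 z.
pose kk (y z : R) := kink_k y (clamp 0 1 (z / h)).
pose Dx (x y z : R) := kk y z * cutoff 4 12 y * cutoff (1 / 2) 1 z * cutoff 4 20 x.
have mul01 (a b : R) : `|b| <= 1 -> `|a * b| <= `|a|.
  by move=> b1; rewrite normrM ler_piMr.
have cut1 a b x : `|cutoff a b x| <= (1 : R).
  by have /andP[c0 c1] := cutoff_in a b x; rewrite ger0_norm.
have cc (U : topologicalType) a b (u : U -> R) : continuous u -> continuous (fun x => cutoff a b (u x)).
  exact: cont_cutoff.
have E1 : tangle_equiv (level (hline 0) 0)
   ((fun p => ((p.1.1, p.1.2 + Dy p.1.1 p.1.2 p.2), p.2)) @` level (hline 0) 0).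
  apply: (@yshear R Dy 1 20).
  - have k1 : continuous (fun p : space => kink_f p.1.1) by apply: cf; ct.
    have k2 : continuous (fun p : space => cutoff (1 / 2) 1 p.2) by apply: cc; ct.
    have k3 : continuous (fun p : space => cutoff 4 12 p.1.2) by apply: cc; ct.
    exact: cont_mul (cont_mul k1 k2) k3.
  - move=> x y z; have [fx _ _ _] := fP x; rewrite /Dy.
    by apply: le_trans (mul01 _ _ _) _ => //; apply: le_trans (mul01 _ _ _) _.
  - move=> x y z [hx|[hy|hz]]; rewrite /Dy.
    + by have [_ -> //] := fP x; rewrite !mul0r.
    + by rewrite (cutoff0 l412) ?mulr0 //; lra.
    + by rewrite (cutoff0 l121 hz) mulr0 mul0r.
  - move=> x z y y' yy; have [fx _ _ _] := fP x.
    apply: (@lip_shear R _ y y' (cutoff 4 12) 8) => //.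
      by apply: le_lt_trans (mul01 _ _ _) _ => //; lra.
    by have := cutoff_lip y y' l412; have -> : (12 - 4 : R) = 8 by lra.
apply: tangle_equiv_trans E1 _.
set T1 := (X in tangle_equiv X _).
have E2 : tangle_equiv T1 ((fun p => (p.1, p.2 + Dz p.1.1 p.1.2 p.2)) @` T1).
  apply: (@zshear R Dz 1 20).
  - have k1 : continuous (fun p : space => kink_g p.1.1) by apply: cg; ct.
    have k2 : continuous (fun p : space => cutoff 0 1 p.2) by apply: cc; ct.
    have k3 : continuous (fun p : space => cutoff 4 12 p.1.2) by apply: cc; ct.
    by apply: cont_mul k2; apply: cont_mul k3; apply: cont_mul k1; apply: cont_cst.
  - move=> x y z; have [_ _ /andP[g0 g1] _] := fP x; rewrite /Dz.
    apply: le_trans (mul01 _ _ _) _ => //; apply: le_trans (mul01 _ _ _) _ => //.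
    by apply: le_trans (mul01 _ _ _) _; [rewrite ger0_norm|lra].
  - move=> x y z [hx|[hy|hz]]; rewrite /Dz.
    + by have [_ _ _ -> //] := fP x; rewrite mulr0 !mul0r.
    + by rewrite (cutoff0 l412) ?mulr0 ?mul0r //; lra.
    + by rewrite (cutoff0 ltr01 hz) mulr0.
  - move=> x y z z' zz; have [_ _ /andP[g0 g1] _] := fP x.
    apply: (@lip_shear R _ z z' (cutoff 0 1) 1) => //.
      apply: le_lt_trans (mul01 _ _ _) _ => //.
      by apply: le_lt_trans (mul01 _ _ _) _; [rewrite ger0_norm|lra].
    by have := cutoff_lip z z' ltr01; rewrite subr0.
apply: tangle_equiv_trans E2 _.
set T2 := (X in tangle_equiv X _).
have E3 : tangle_equiv T2 ((fun p => ((p.1.1 + Dx p.1.1 p.1.2 p.2, p.1.2), p.2)) @` T2).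
  have kb y z : `|kk y z| <= 8 / 5.
    have /andP[s0 s1] := clamp_in (z / h) ler01.
    have le1 : (-1 : R) <= 1 by lra.
    have /andP[y0 y1] := clamp_in y le1.
    rewrite /kk /kink_k ler_norml; move: (clamp 0 1 _) (clamp (-1) 1 y) s0 s1 y0 y1 => s t *.
    by apply/andP; split; nra.
  have Db (x y z : R) : `|kk y z * cutoff 4 12 y * cutoff (1 / 2) 1 z| <= 8 / 5.
    apply: le_trans (mul01 _ _ _) _ => //; apply: le_trans (mul01 _ _ _) _ => //.
  apply: (@xshear R Dx (8 / 5) 20).
  - have k1 : continuous (fun p : space => kk p.1.2 p.2) by rewrite /kk /kink_k; ct.
    have k2 : continuous (fun p : space => cutoff (1 / 2) 1 p.2) by apply: cc; ct.
    have k3 : continuous (fun p : space => cutoff 4 12 p.1.2) by apply: cc; ct.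
    have k4 : continuous (fun p : space => cutoff 4 20 p.1.1) by apply: cc; ct.
    exact: cont_mul (cont_mul (cont_mul k1 k3) k2) k4.
  - by move=> x y z; apply: le_trans (mul01 _ _ _) (Db x y z).
  - move=> x y z [hx|[hy|hz]]; rewrite /Dx.
    + by rewrite (cutoff0 l420) ?mulr0.
    + by rewrite (cutoff0 l412) ?mulr0 ?mul0r //; lra.
    + by rewrite (cutoff0 l121 hz) mulr0 mul0r.
  - move=> y z x x' xx.
    apply: (@lip_shear R _ x x' (cutoff 4 20) 16) => //.
      by apply: le_lt_trans (Db x y z) _; lra.
    by have := cutoff_lip x x' l420; have -> : (20 - 4 : R) = 16 by lra.
move: E3; congr tangle_equiv; rewrite /T2 /T1 !image_comp.
have pathE x : ((x + Dx x (0 + Dy x 0 0) (0 + Dz x (0 + Dy x 0 0) 0), 0 + Dy x 0 0),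
    0 + Dz x (0 + Dy x 0 0) 0) = kink_path h x.
  have [f1 f2 /andP[g0 g1] g2] := fP x.
  have n0 (a : R) : 0 <= a -> `|0| <= a by rewrite normr0.
  have yE : 0 + Dy x 0 0 = kink_f x.
    by rewrite /Dy (cutoff1 l121) ?(cutoff1 l412) ?n0 ?mulr1 ?add0r //; lra.
  have f4 : `|kink_f x| <= 4 by lra.
  have zE : 0 + Dz x (kink_f x) 0 = h * kink_g x.
    by rewrite /Dz (cutoff1 l412 f4) (cutoff1 ltr01) ?n0 ?mulr1 ?add0r //; lra.
  rewrite yE zE /kink_path; congr (_, _, _); congr (_ + _).
  have zh : `|h * kink_g x| <= 1 / 2 by apply: le_trans (mul01 _ _ _) _ => //; rewrite ger0_norm.
  rewrite /Dx (cutoff1 l412 f4) (cutoff1 l121 zh) !mulr1 /kk mulrAC divff // mul1r.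
  rewrite clamp_id ?g0 //; have [x4|x4] := lerP `|x| 4; first by rewrite cutoff1 ?mulr1.
  (* Beyond [|x| = 4] the cutoff in [x] may differ from 1, but the path is the straight line there
     and the displacement vanishes. *)
  have [k _ _ _ _] := kink_pathE 1 x.
  have [] : kink_path 1 x = ((x, 0), 0).
    by apply: k; move: x4; rewrite ltr_normr => /orP[] ?; [right|left]; lra.
  rewrite mul1r => _ -> ->; rewrite /kink_k clamp_id; last by lra.
  by rewrite !mul0r !oppr0 mulr0 addr0 mul0r.
apply/seteqP; split.
- move=> _ [[[x y] z] [/= hy hz] <-]; apply/kink_image; exists x.
  by have y0 : y = 0 := hy; rewrite /= y0 hz; apply: pathE.
- move=> p /kink_image[x ->]; exists ((x, 0), 0); first by split.
  exact: pathE.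
Qed.

End Kink.

Section KinkPresents.
Variable R : realType.
Local Notation plane := (R * R)%type.
Local Notation space := ((R * R) * R)%type.

Lemma closed_hline (a : R) : closed (hline a).
Proof.
rewrite (_ : hline a = snd @^-1` [set a]); last by [].
by apply: closed_comp => [p _|]; [exact: cvg_snd|exact: closed_eq].
Qed.

Lemma readable_hline (a h : R) : readable (level (hline a) h).
Proof.
apply: (@readable_level R _ fst); first by ct.
by move=> [x y] [x' y']; rewrite /hline /= => -> -> ->.
Qed.

Lemma tangle_closed (T T' : set space) : tangle_equiv T T' -> closed T -> closed T'.
Proof.
move=> [r [F [[cF hF F0 Fs] ->]]] cT; have [g [cg _] [Fg gF]] := homeo_inv (hF 1).
have -> : F 1 @` T = g @^-1` T.
  by apply/seteqP; split=> [_ [p Tp <-]|p Tp]; [rewrite /= Fg|exists (g p)].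
by apply: closed_comp => // z _; apply: cg.
Qed.

Lemma kink_height (h : R) (x y z : R) : 0 <= h \/ h <= 0 -> kink_space h x y z ->
  `|z| <= `|h|.
Proof.
move=> h0 [] *; subst; rewrite ?normr0 // normrM.
  by rewrite ler_piMr // ler_norml; lra.
by rewrite ler_piMr // ler_norml; lra.
Qed.

Lemma kink_dset (x y : R) h : kink_in (x, y) \/ kink_out (x, y) <->
  exists z, kink_space h x y z.
Proof.
rewrite /kink_in /kink_out /=; split.
- move=> [[-> /andP[y0 y1]]|[[-> [x1|x2]]|
    [[-> /andP[y0 y1]]|[-> /andP[x0 x1]]|[-> /andP[x0 x1]]|[-> /andP[y0 y1]]]]].
  + by exists h; apply: KinkS4.
  + by exists 0; apply: KinkS1.
  + by exists 0; apply: KinkS7.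
  + by exists 0; apply: KinkS2.
  + by exists (h * (1 - x)); apply: KinkS3.
  + by exists (h * (1 - x / 2)); apply: KinkS5.
  + by exists 0; apply: KinkS6.
- move=> [z [-> _ x1|-> y0 y1 _|-> x0 x1 _|-> y0 y1 _|-> x0 x1 _|-> y0 y1 _|-> _ x2]].
  + by right; left; split; [|left].
  + by right; right; apply: Or41; split=> //; apply/andP.
  + by right; right; apply: Or42; split=> //; apply/andP.
  + by left; split=> //; apply/andP.
  + by right; right; apply: Or43; split=> //; apply/andP.
  + by right; right; apply: Or44; split=> //; apply/andP.
  + by right; left; split; [|right].
Qed.

Lemma kink_unique h (x y z z' : R) : x != 0 \/ y != 0 ->
  kink_space h x y z -> kink_space h x y z' -> z = z'.
Proof.
move=> n0; have {n0} n0 : x = 0 -> y = 0 -> False.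
  by move=> x0 y0; case: n0; rewrite ?x0 ?y0 eqxx.
move=> [a b c|a b c d|a b c d|a b c d|a b c d|a b c d|a b c]
  [a' b' c'|a' b' c' d'|a' b' c' d'|a' b' c' d'|a' b' c' d'|a' b' c' d'|a' b' c'].
all: try by exfalso; clear n0; subst; lra.
all: try by subst.
all: try by exfalso; apply: n0.
(* The remaining pairs of edges meet at a corner, of abscissa 1, 0 or 2, where both give the same
   height. *)
all: try by (have e : x = 1 by clear n0; lra); clear n0; subst z z'; rewrite e; lra.
all: try by (have e : x = 0 by clear n0; lra); clear n0; subst z z'; rewrite e; lra.
all: try by (have e : x = 2 by clear n0; lra); clear n0; subst z z'; rewrite e; lra.
Qed.

Lemma kink_presents (h : R) : h != 0 -> `|h| <= 1 / 2 ->
  slab (kink_tangle h) /\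
  forall u, presents_at (kink_tangle h)
    (layers (if 0 < h then [:: @kink_in R; @kink_out R] else [:: @kink_out R; @kink_in R])) u.
Proof.
move=> h0 h1; have te := kink_equiv h0 h1.
have hh : 0 <= h \/ h <= 0 by case: (lerP 0 h) => ?; [left|right; apply: ltW].
have sT : slab (kink_tangle h).
  split; first by apply: (tangle_closed te); apply: closed_level; apply: closed_hline.
  move=> [[x y] z] /(kink_height hh) /=; lra.
split=> // u; set D := layers _.
have DE x y : dset D (x, y) <-> kink_in (x, y) \/ kink_out (x, y).
  rewrite /D; case: (0 < h) => /=.
    by split=> [[|[|[]]]|[]]; [left|right|left|right; left].
  by split=> [[|[|[]]]|[]]; [right|left|right; left|left].
have [psi cpsi psii] : readable (kink_tangle h).
  by apply: tangle_readable te _; apply: readable_hline.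
have [uE|un] := eqVneq u (0, 0).
  (* In the square [|x|, |y| < 1 / 2] the kink reduces to the two axes, [kink_in] being vertical and
     [kink_out] horizontal. *)
  have l2 : (0 : R) < 1 / 2 by lra.
  have sq (v : plane) : [/\ -1 / 2 < (squeeze (1 / 2) v).1, (squeeze (1 / 2) v).1 < 1 / 2,
      -1 / 2 < (squeeze (1 / 2) v).2 & (squeeze (1 / 2) v).2 < 1 / 2].
    have := @squeeze1_lt R (1 / 2) v.1 l2; have := @squeeze1_lt R (1 / 2) v.2 l2.
    by rewrite !ltr_norml => /andP[? ?] /andP[? ?]; split; rewrite /squeeze /=; lra.
  have inE (v : plane) : kink_in (squeeze (1 / 2) v) <-> v.1 = 0.
    rewrite -(squeeze1_eq0 v.1 l2); have [a b c d] := sq v.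
    split=> [[]|e] //; split=> //; apply/andP; split; lra.
  have outE (v : plane) : kink_out (squeeze (1 / 2) v) <-> v.2 = 0.
    rewrite -(squeeze2_eq0 v l2); have [a b c d] := sq v.
    move: (squeeze _ v) a b c d => [x y] /= a b c d.
    rewrite /kink_out /=; split=> [[[]|[[]|[]|[]|[]]]|->].
    + by [].
    + by move=> *; lra.
    + by move=> *; lra.
    + by move=> *; lra.
    + by move=> *; lra.
    + by left; split=> //; left; lra.
  have tE (v : plane) (z : R) : kink_tangle h (squeeze (1 / 2) v, z) <->
      (v.2 = 0 /\ z = 0) \/ (v.1 = 0 /\ z = h).
    rewrite -(squeeze2_eq0 v l2) -(squeeze1_eq0 v.1 l2) -/(squeeze (1 / 2) v).1.
    have [a b c d] := sq v; rewrite -[squeeze1 _ v.1]/(squeeze (1 / 2) v).1.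
    move: (squeeze _ v) a b c d => [x y] /= a b c d.
    rewrite /kink_tangle /=; split=> [[]|[[-> ->]|[-> ->]]] *; try lra.
    + by apply: KinkS1 => //; lra.
    + by apply: KinkS4 => //; lra.
  have es := squeeze_embed l2; rewrite uE -(squeeze0 l2).
  have s0 : kink_in (squeeze (1 / 2) ((0, 0) : plane)) by apply/(inE (0, 0)).
  have s0' : kink_out (squeeze (1 / 2) ((0, 0) : plane)) by apply/(outE (0, 0)).
  (* For positive [h] the vertical strand is on top, and the coordinates are exchanged because the
     over strand has to be the first axis of the chart. *)
  have [hp|hn] := ltrP 0 h.
    have es' : open_embedding (fun v : plane => squeeze (1 / 2) (v.2, v.1)).
      exact: embed_comp (swap_embed R) es.
    apply: (@presents_double _ _ (kink_tangle h) D (fun v : plane => squeeze (1 / 2) (v.2, v.1)) h 0) => //.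
    + by move=> v; rewrite DE inE outE /=; split=> [[->|->]|/eqP]; rewrite ?mulr0 ?mul0r //
        mulf_eq0 => /orP[] /eqP ->; [right|left].
    + move=> v; rewrite /D hp /=; have := inE (v.2, v.1) => /= <-.
      by split=> [[[]|[]]|?] //; left.
    + by move=> v z; rewrite tE /=; split=> -[]; [right|left|right|left].
  have hn' : h < 0 by rewrite lt_neqAle h0.
  apply: (@presents_double _ _ (kink_tangle h) D (squeeze (1 / 2)) 0 h) => //.
  + by move=> v; rewrite DE inE outE /=; split=> [[->|->]|/eqP]; rewrite ?mulr0 ?mul0r //
        mulf_eq0 => /orP[] /eqP ->; [left|right].
  + move=> v; rewrite /D ltNge hn /=; have := outE v => /= <-.
    by split=> [[[]|[]]|?] //; left.
have [uD|nD] := pselect (dset D u); last first.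
  apply: presents_out => // z Tz; apply: nD.
  by case: u un Tz => x y un Tz; apply/DE/(kink_dset _ _ h); exists z.
have [z0 z0P] : exists z, kink_tangle h (u, z).
  by case: u un uD => x y un /DE /(kink_dset _ _ h).
apply: (@presents_single _ _ _ D u (~` [set (0, 0)]) psi z0) => //.
- apply: open_nbhs_nbhs; split; last by apply/eqP.
  by apply: closed_openC; apply: (accessible_closed_set1 (hausdorff_accessible (@hausdorff_plane R))).
- by move=> [x y] _; rewrite DE (kink_dset _ _ h).
- move=> [x y] z z' n0; apply: kink_unique.
  have [x0|] := eqVneq x 0; last by left.
  by right; apply/eqP => /= y0; apply: n0; rewrite x0 y0.
- by move=> p q _ _; apply: psii.
Qed.

End KinkPresents.

(** * Tangles for the Reidemeister models *)

Section Models.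
Variable R : realType.
Local Notation plane := (R * R)%type.
Local Notation space := ((R * R) * R)%type.
Implicit Types (A B C : set plane) (T : set space).

Lemma closed_nonpos (U : topologicalType) (f : U -> R) : continuous f ->
  closed [set u | f u <= 0].
Proof. by move=> cf; apply: (@closed_comp _ _ f [set y | y <= 0]) => //; exact: closed_le. Qed.

Lemma closed_zero (U : topologicalType) (f : U -> R) : continuous f ->
  closed [set u | f u = 0].
Proof. by move=> cf; apply: (@closed_comp _ _ f [set y | y = 0]) => //; exact: closed_eq. Qed.

Lemma closed_diag1 : closed (@diag1 R).
Proof.
rewrite (_ : @diag1 R = [set p | p.2 - p.1 = 0]); first by apply: closed_zero; ct.
by apply/seteqP; split=> p /=; [move=> ->; rewrite subrr|move/subr0_eq].
Qed.

Lemma closed_diag2 : closed (@diag2 R).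
Proof.
rewrite (_ : @diag2 R = [set p | p.2 + p.1 = 0]); first by apply: closed_zero; ct.
by apply/seteqP; split=> p /=; [move=> ->; rewrite addNr|move/eqP; rewrite addr_eq0 => /eqP].
Qed.

Lemma closed_bump (a b w : R) : closed (Defs.bump a b w).
Proof.
rewrite (_ : Defs.bump a b w =
  ([set p | w - `|p.1| <= 0] `&` [set p | p.2 - a = 0]) `|`
  (([set p | `|p.1| - w = 0] `&` [set p | (p.2 - a) * (p.2 - b) <= 0]) `|`
   ([set p | `|p.1| - w <= 0] `&` [set p | p.2 - b = 0]))).
  by repeat apply: closedU; apply: closedI; (apply: closed_nonpos || apply: closed_zero); ct.
apply/seteqP; split=> p; rewrite /Defs.bump /= !subr_le0.
- by move=> [[h ->]|[-> h]|[h ->]]; rewrite ?subrr; [left|right; left|right; right].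
- move=> [[h /subr0_eq ->]|[[/subr0_eq -> h]|[h /subr0_eq ->]]].
  + by apply: Or31.
  + by apply: Or32.
  + by apply: Or33.
Qed.

Lemma readable_set0 (h : R) : readable (level (set0 : set plane) h).
Proof. by exists (fun=> 0); [exact: cont_cst|move=> p q []]. Qed.

Lemma readable_diag1 (h : R) : readable (level (@diag1 R) h).
Proof.
apply: (@readable_level R _ fst); first by ct.
by move=> [x y] [x' y']; rewrite /diag1 /= => -> -> ->.
Qed.

Lemma readable_diag2 (h : R) : readable (level (@diag2 R) h).
Proof.
apply: (@readable_level R _ fst); first by ct.
by move=> [x y] [x' y']; rewrite /diag2 /= => -> -> ->.
Qed.

Lemma readable_bump (a b w h : R) : 0 < w -> w <= 3 -> a != b -> `|a| <= 1 -> `|b| <= 1 ->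
  `|h| <= 1 / 2 -> readable (level (Defs.bump a b w) h).
Proof.
move=> w0 w3 ab a1 b1 h1.
have := @level_bump R a b w h set0 w0 w3 ab a1 b1 h1; rewrite !set0U => te.
by apply: tangle_readable (te _) _ => //; apply: readable_hline.
Qed.

(** [presents] without [is_diagram], which for a model comes from the diagram of which it is the
    local picture. *)
Definition presented T M := slab T /\ forall u, presents_at T M u.

(** Padding with empty layers reduces the models with one or two layers to [layered_presents]. *)
Lemma layers2 A B : layers [:: A; B; set0] = layers [:: A; B].
Proof.
rewrite /layers /= !setU0; congr Diagram; apply/funext => c; apply/funext => p /=.
by apply/propext; split=> [[|[n [|[m []]]]]|[|[n []]]] //; try tauto; case.
Qed.

Lemma layers1 A : layers [:: A; set0; set0] = layers [:: A].
Proof.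
rewrite /layers /= !setU0; congr Diagram; apply/funext => c; apply/funext => p /=.
by apply/propext; split; tauto.
Qed.

Lemma level0 (h : R) : level (set0 : set plane) h = set0.
Proof. by apply/seteqP; split=> p []. Qed.

Let half : (1 / 2 : R) < 1. Proof. lra. Qed.
Let half0 : `|1 / 2 : R| < 1. Proof. by rewrite ger0_norm; lra. Qed.
Let zero0 : `|0 : R| < 1. Proof. by rewrite normr0. Qed.
Let halfN : `| - (1 / 2) : R| < 1. Proof. by rewrite normrN ger0_norm; lra. Qed.

Lemma presented2 A B : closed A -> closed B ->
  readable (level A (1 / 2)) -> readable (level B 0) ->
  (forall u, A u -> B u -> transverse A B u) ->
  presented (level A (1 / 2) `|` level B 0) (layers [:: A; B]).
Proof.
move=> cA cB rA rB AB.
rewrite -layers2 -[_ `|` _]setU0 -[X in presented (_ `|` X)](level0 (- (1 / 2))).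
by apply: layered_presents => //; first [exact: closed0|exact: readable_set0|
  move=> ? ? ? []|move=> ? ? []|move=> ? []|lra].
Qed.

Lemma presented1 A : closed A -> readable (level A 0) ->
  presented (level A 0) (layers [:: A]).
Proof.
move=> cA rA.
have q : `|- (1 / 4) : R| < 1 by rewrite normrN ger0_norm; lra.
rewrite -layers1.
have -> : level A 0 = level A 0 `|` level set0 (- (1 / 4)) `|` level set0 (- (1 / 2)).
  by rewrite !level0 !setU0.
by apply: layered_presents => //; first [exact: closed0|exact: readable_set0|
  move=> ? ? ? []|move=> ? ? []|move=> ? []|lra].
Qed.

Lemma transverse_affine A B (p q a b c d : R) : a * d - b * c != 0 ->
  (forall s t : R, `|s| < 1 / 4 -> `|t| < 1 / 4 ->
     (A (p + (a * s + b * t), q + (c * s + d * t)) <-> t = 0) /\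
     (B (p + (a * s + b * t), q + (c * s + d * t)) <-> s = 0)) ->
  transverse A B (p, q).
Proof.
move=> D0 AB; have l4 : (0 : R) < 1 / 4 by lra.
exists (fun v => let w := squeeze (1 / 4) v in (p + (a * w.1 + b * w.2), q + (c * w.1 + d * w.2))).
split.
- exact: embed_comp (squeeze_embed l4) (affine_embed p q D0).
- by rewrite squeeze0 //= !mulr0 !addr0.
- move=> v; rewrite -(squeeze2_eq0 v l4).
  by have [] := AB _ _ (squeeze1_lt v.1 l4) (squeeze1_lt v.2 l4).
- move=> v; rewrite -(squeeze1_eq0 v.1 l4).
  by have [] := AB _ _ (squeeze1_lt v.1 l4) (squeeze1_lt v.2 l4).
Qed.

Lemma transverse_diag u : @diag1 R u -> @diag2 R u -> transverse (@diag1 R) (@diag2 R) u.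
Proof.
case: u => x y; rewrite /diag1 /diag2 /= => yx yNx.
have [-> ->] : x = 0 /\ y = 0 by split; lra.
apply: (@transverse_affine _ _ 0 0 1 1 1 (-1)).
  by rewrite lt_eqF //; lra.
by move=> s t _ _ /=; split; split=> ?; lra.
Qed.

Lemma transverse_bump_diag (b k : R) A u : b = 1 \/ b = -1 -> k = 1 \/ k = -1 ->
  (forall p, A p <-> p.2 = k * p.1) ->
  Defs.bump 0 b 3 u -> A u -> transverse (Defs.bump 0 b 3) A u.
Proof.
move=> b1 k1 AE; case: u => x y; rewrite AE /Defs.bump /=.
have kk : k * k = 1 by case: k1 => ->; ring.
(* A diagonal meets the bump only on its plateau, which is wide enough ([|x| <= 3]) to keep the
   diagonals away from the sides. *)
move=> bu yk; have {bu} [xE yE] : x = k * b /\ y = b.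
  have xk : x = k * y by rewrite yk mulrA kk mul1r.
  case: bu => [[x3 y0]|[x3 yb]|[_ yb]].
  - by move: x3; rewrite xk y0 mulr0 normr0; lra.
  - exfalso; have yy : y * y = 9.
      have <- : `|x| * `|x| = 9 by rewrite x3; ring.
      by rewrite -normrM ger0_norm -?expr2 ?sqr_ge0 // xk exprMn [k ^+ 2]expr2 kk mul1r.
    have y3 : `|y| = 3 by rewrite -x3 xk normrM; case: k1 => ->; rewrite ?normrN normr1 mul1r.
    by move: y3; case: (ger0P y) => y0 y3; case: b1 yb => -> yb; nra.
  - by rewrite -yb.
rewrite xE yE.
apply: (@transverse_affine _ _ (k * b) b 1 k 0 1); first by rewrite mulr0 subr0 mulr1 oner_neq0.
move=> s t; rewrite !ltr_norml => /andP[s0 s1] /andP[t0 t1]; split.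
- rewrite /= !mul0r !mul1r !add0r; split=> [|->]; last first.
    apply: Or33; split; last by ring.
    by rewrite ler_norml; case: k1 => ->; case: b1 => ->; lra.
  case; rewrite ?ler_norml ?ler_normr.
  + by move=> [/orP h ?]; exfalso; case: k1 h => ->; case: b1 => -> [] *; lra.
  + move=> [h _]; exfalso; have : `|k * b + (s + k * t)| < 3.
      by rewrite ltr_norml; case: k1 => ->; case: b1 => ->; lra.
    by rewrite h; lra.
  + by move=> [_ h]; lra.
- rewrite AE /= !mul0r !mul1r !add0r !mulrDr !mulrA kk !mul1r.
  by case: k1 => ->; split=> ?; lra.
Qed.

Lemma transverse_bump_hline u : Defs.bump 1 (-1) 1 u -> hline 0 u ->
  transverse (Defs.bump (1 : R) (-1) 1) (hline 0) u.
Proof.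
case: u => x y; rewrite /Defs.bump /hline /= => bu y0.
have {bu} xE : x = 1 \/ x = -1.
  case: bu => [[_ ?]|[x1 _]|[_ ?]]; [lra| |lra].
  by move: x1; case: (ger0P x) => *; [left|right]; lra.
rewrite y0; apply: (@transverse_affine _ _ x 0 0 1 1 0); first by rewrite lt_eqF //; lra.
move=> s t; rewrite !ltr_norml => /andP[s0 s1] /andP[t0 t1]; split.
- rewrite /= !mul0r !mul1r !add0r !addr0; split=> [|->]; last first.
    apply: Or32; split; last by nra.
    by rewrite addr0; case: xE => ->; rewrite ?normrN normr1.
  case=> [[_ ?]|[h _]|[_ ?]]; [lra| |lra].
  by move: h; case: xE => ->; [rewrite ger0_norm|rewrite ler0_norm]; lra.
- by rewrite /= !mul0r !mul1r !add0r !addr0; split.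
Qed.

(** The third move shifts a single strand at its own height. The intermediate straight line may
    project through a crossing of the other strands, since tangles in space need not have a diagram
    in between. *)
Lemma bump_bump (h : R) T : `|h| <= 1 / 2 -> (forall p, T p -> 1 / 4 <= `|p.2 - h|) ->
  tangle_equiv (T `|` level (Defs.bump 0 1 3) h) (T `|` level (Defs.bump 0 (-1) 3) h).
Proof.
have n1 : (0 : R) != 1 by rewrite eq_sym oner_neq0.
have nN : (0 : R) != -1 by rewrite gt_eqF //; lra.
move=> h1 Th; apply: (@tangle_equiv_trans _ _ (T `|` level (hline 0) h)).
  apply: tangle_equiv_sym; apply: level_bump => //; rewrite ?normr0 ?normr1 ?ler01 //; lra.
by apply: level_bump => //; rewrite ?normr0 ?normrN ?normr1 ?ler01 //; lra.
Qed.

Lemma model_tangles M M' : reidemeister_model M M' ->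
  exists T T', [/\ tangle_equiv T T', presented T M & presented T' M'].
Proof.
have c3 : (3 : R) <= 3 by [].
have bb1 b : b = 1 \/ b = -1 -> [/\ 0 != b, `|b| <= 1 :> R & b = 1 \/ b = -1].
  move=> [->|->]; rewrite ?normrN normr1; split=> //; try by [left|right].
    by rewrite eq_sym oner_neq0.
  by rewrite gt_eqF //; lra.
have cb (b : R) : closed (Defs.bump 0 b 3) by exact: closed_bump.
have rb (b h : R) : b = 1 \/ b = -1 -> `|h| <= 1 / 2 -> readable (level (Defs.bump 0 b 3) h).
  by move=> /bb1[b0 b1 _] h1; apply: readable_bump; rewrite ?normr0 //; lra.
have [cd1 cd2] := (closed_diag1, closed_diag2).
have [rd1 rd2] := (readable_diag1, readable_diag2).
have t1 (b : R) u : b = 1 \/ b = -1 -> Defs.bump 0 b 3 u -> @diag1 R u ->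
    transverse (Defs.bump 0 b 3) (@diag1 R) u.
  by move=> bb; apply: (@transverse_bump_diag b 1) => //; [left|move=> p; rewrite mul1r].
have t2 (b : R) u : b = 1 \/ b = -1 -> Defs.bump 0 b 3 u -> @diag2 R u ->
    transverse (Defs.bump 0 b 3) (@diag2 R) u.
  by move=> bb; apply: (@transverse_bump_diag b (-1)) => //; [right|move=> p; rewrite mulN1r].
have td := transverse_diag.
have triple (b : R) u : b = 1 \/ b = -1 -> Defs.bump 0 b 3 u -> @diag1 R u -> @diag2 R u -> False.
  move=> bb; case: u => x y; rewrite /diag1 /diag2 /Defs.bump /= => bu yx yNx.
  have x0 : x = 0 by lra.
  by move: bu; rewrite yx x0 normr0; case: bb => ->; case=> -[? ?]; lra.
have l12 : 0 < (1 / 2 : R) by lra.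
have l12' : - (1 / 2) < (0 : R) by lra.
have hh : `|1 / 2 : R| <= 1 / 2 by rewrite ger0_norm; lra.
have hN : `| - (1 / 2) : R| <= 1 / 2 by rewrite normrN ger0_norm; lra.
have h0 : `|0 : R| <= 1 / 2 by rewrite normr0; lra.
have far (a b : R) A : 1 / 4 <= `|a - b| -> forall p, level A a p -> 1 / 4 <= `|p.2 - b|.
  by move=> ab p [_ ->].
have b1 : (1 : R) = 1 \/ (1 : R) = -1 by left.
have bN : (-1 : R) = 1 \/ (-1 : R) = -1 by right.
case.
- have k1 : (1 / 2 : R) != 0 by rewrite gt_eqF.
  exists (level (hline 0) 0), (kink_tangle (1 / 2)); split; first exact: kink_equiv.
    by apply: presented1; [apply: closed_hline|apply: readable_hline].
  by have := kink_presents k1 hh; rewrite l12.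
- have k1 : (- (1 / 2) : R) != 0 by rewrite lt_eqF.
  exists (level (hline 0) 0), (kink_tangle (- (1 / 2))); split; first exact: kink_equiv.
    by apply: presented1; [apply: closed_hline|apply: readable_hline].
  by have := kink_presents k1 hN; rewrite ltNge (ltW l12').
- exists (level (hline 1) (1 / 2) `|` level (hline 0) 0),
    (level (Defs.bump 1 (-1) 1) (1 / 2) `|` level (hline 0) 0); split.
  + rewrite !(setUC (level _ (1 / 2))); apply: level_bump; rewrite ?normrN ?normr1 //.
    * by lra.
    * by rewrite gt_eqF //; lra.
    * by apply: far; rewrite sub0r normrN ger0_norm; lra.
  + apply: presented2; try exact: closed_hline; try exact: readable_hline.
    by move=> u; rewrite /hline /= => -> ?; exfalso; lra.
  + apply: presented2; [exact: closed_bump|exact: closed_hline| |exact: readable_hline|].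
      by apply: readable_bump; rewrite ?normrN ?normr1 //; [lra|rewrite gt_eqF //; lra].
    exact: transverse_bump_hline.
- exists (level (hline 0) (1 / 2) `|` level (hline 1) 0),
    (level (hline 0) (1 / 2) `|` level (Defs.bump 1 (-1) 1) 0); split.
  + apply: level_bump; rewrite ?normrN ?normr1 //.
    * by lra.
    * by rewrite gt_eqF //; lra.
    * by apply: far; rewrite subr0 ger0_norm; lra.
  + apply: presented2; try exact: closed_hline; try exact: readable_hline.
    by move=> u; rewrite /hline /= => -> ?; exfalso; lra.
  + apply: presented2; [exact: closed_hline|exact: closed_bump|exact: readable_hline| |].
      by apply: readable_bump; rewrite ?normrN ?normr1 //; [lra|rewrite gt_eqF //; lra].
    by move=> u h h'; apply: transverse_sym; apply: transverse_bump_hline.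
- pose T b := level (Defs.bump 0 b 3) (1 / 2) `|` level (@diag1 R) 0 `|` level (@diag2 R) (- (1 / 2)).
  have P b : b = 1 \/ b = -1 -> presented (T b) (layers [:: Defs.bump 0 b 3; @diag1 R; @diag2 R]).
    move=> bb; apply: layered_presents => //; try by [apply: rb|move=> u; apply: triple bb|
      move=> u; apply: t1|move=> u; apply: t2].
  exists (T 1), (T (-1)); split; [|exact: P|exact: P].
  have TE b : T b = (level (@diag1 R) 0 `|` level (@diag2 R) (- (1 / 2))) `|` level (Defs.bump 0 b 3) (1 / 2).
    by rewrite /T -setUA setUC.
  rewrite !TE.
  by apply: bump_bump => // p [] /far; apply;
    [rewrite sub0r normrN|rewrite -opprD normrN]; rewrite ger0_norm; lra.
- pose T b := level (@diag1 R) (1 / 2) `|` level (Defs.bump 0 b 3) 0 `|` level (@diag2 R) (- (1 / 2)).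
  have P b : b = 1 \/ b = -1 -> presented (T b) (layers [:: @diag1 R; Defs.bump 0 b 3; @diag2 R]).
    move=> bb; apply: layered_presents => //; try by [apply: rb|move=> u ? ? ?; apply: (triple b u)|
      move=> u ? ?; apply: transverse_sym; apply: t1|move=> u; apply: t2].
  exists (T 1), (T (-1)); split; [|exact: P|exact: P].
  have TE b : T b = (level (@diag1 R) (1 / 2) `|` level (@diag2 R) (- (1 / 2))) `|` level (Defs.bump 0 b 3) 0.
    by rewrite /T setUAC.
  rewrite !TE.
  by apply: bump_bump => // p [] /far; apply; rewrite subr0 ?normrN ger0_norm; lra.
- pose T b := level (@diag1 R) (1 / 2) `|` level (@diag2 R) 0 `|` level (Defs.bump 0 b 3) (- (1 / 2)).
  have P b : b = 1 \/ b = -1 -> presented (T b) (layers [:: @diag1 R; @diag2 R; Defs.bump 0 b 3]).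
    move=> bb; apply: layered_presents => //; try by [apply: rb|move=> u ? ? ?; apply: (triple b u)|
      move=> u ? ?; apply: transverse_sym; apply: t1|move=> u ? ?; apply: transverse_sym; apply: t2].
  exists (T 1), (T (-1)); split; [|exact: P|exact: P].
  by apply: bump_bump => // p [] /far; apply; rewrite opprK ?add0r ger0_norm; lra.
Qed.

End Models.

(** * Following a sequence of moves *)

Section ChartExtension.
Variables (R : realType) (X : topologicalType).
Local Notation plane := (R * R)%type.
Local Notation space := ((R * R) * R)%type.
Variable e : plane -> X.
Hypotheses (hX : hausdorff_space X) (ee : open_embedding e).
Implicit Types (S : space -> space) (W : set (X * R)).

Definition chart_extend S (p : X * R) : X * R :=
  extend e (fun u => (e (S (u, p.2)).1, (S (u, p.2)).2)) (fun x => (x, p.2)) p.1.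

Let ei : injective e. Proof. by case: ee. Qed.

Lemma chart_extend_in S u z :
  chart_extend S (e u, z) = (e (S (u, z)).1, (S (u, z)).2).
Proof. by rewrite /chart_extend /= extend_in. Qed.

Lemma chart_extend_out S x z : ~ (exists u, e u = x) -> chart_extend S (x, z) = (x, z).
Proof. by move=> h; rewrite /chart_extend /= extend_out. Qed.

Lemma chart_extend_off S rho x z : (forall p, rho <= sup_norm p.1 -> S p = p) ->
  ~ (e @` [set u | sup_norm u <= rho]) x -> chart_extend S (x, z) = (x, z).
Proof.
move=> Sid xn; have [[u ux]|nx] := pselect (exists u, e u = x); last exact: chart_extend_out.
rewrite -ux chart_extend_in Sid //=; rewrite leNgt; apply/negP => /ltW h.
by apply: xn; exists u.
Qed.

Lemma chart_extend_comp S S' p :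
  chart_extend S (chart_extend S' p) = chart_extend (fun q => S (S' q)) p.
Proof.
case: p => x z; have [[u <-]|nx] := pselect (exists u, e u = x).
  by rewrite !chart_extend_in -!surjective_pairing.
by rewrite !chart_extend_out.
Qed.

Lemma chart_extend_cont (Z : topologicalType) (S : Z -> space -> space) rho :
  continuous (fun p : Z * space => S p.1 p.2) ->
  (forall t p, rho <= sup_norm p.1 -> S t p = p) ->
  continuous (fun p : Z * (X * R) => chart_extend (S p.1) p.2).
Proof.
move=> cS Sid; have [ce _ _] := ee.
have c1 : continuous (fun p : X * (Z * R) => chart_extend (S p.2.1) (p.1, p.2.2)).
  apply: (@glue_cont _ _ _ _ e [set u | sup_norm u <= rho]
    (fun p : plane * (Z * R) => (e (S p.2.1 (p.1, p.2.2)).1, (S p.2.1 (p.1, p.2.2)).2))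
    (fun p : X * (Z * R) => (p.1, p.2.2))) => //.
  - exact: compact_square.
  - have cq : continuous (fun p : plane * (Z * R) => S p.2.1 (p.1, p.2.2)).
      by apply: (cont_comp cS (g := fun p : plane * (Z * R) => (p.2.1, (p.1, p.2.2)))); ct.
    apply: cont_pair; last by apply: cont_comp cq; ct.
    by apply: cont_comp ce _; apply: cont_comp cq; ct.
  - by ct.
  - by move=> u z; rewrite chart_extend_in.
  - by move=> x z xn; apply: (chart_extend_off _ (Sid z.1)).
have c2 : continuous (fun p : Z * (X * R) => (p.2.1, (p.1, p.2.2))) by ct.
rewrite (_ : (fun _ => _) = fun p : Z * (X * R) => chart_extend (S p.1) (p.2.1, p.2.2)).
  exact: cont_comp c1 c2.
by apply/funext => -[t [x z]].
Qed.

(** Points outside the open slab are fixed, so by injectivity no other point can be sent there. *)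
Lemma compact_isotopy_slab rho F t (p : space) : compact_isotopy rho F ->
  `|p.2| < 1 -> `|(F t p).2| < 1.
Proof.
move=> [cF hF F0 Fs] p1; rewrite ltNge; apply/negP => h.
have [_ [g [_ Fg _]]] := hF t.
have e1 : F t (F t p) = F t p by apply: Fs; right.
have : F t p = p by rewrite -[LHS]Fg e1 Fg.
by move=> pE; move: h; rewrite pE leNgt p1.
Qed.

Lemma chart_extend_isotopy rho F : compact_isotopy rho F ->
  slab_isotopy (fun t => chart_extend (F t)).
Proof.
move=> cI; have [cF hF F0 Fs] := cI.
have Fid t p : rho <= sup_norm p.1 -> F t p = p by move=> h; apply: Fs; left.
split.
- exact: chart_extend_cont cF Fid.
- move=> t; have [g [cg _] [Fg gF]] := homeo_inv (hF t).
  have gid p : rho <= sup_norm p.1 -> g p = p.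
    by move=> h; rewrite -{1}(Fid t p h) Fg.
  have cont1 S : continuous S -> (forall p, rho <= sup_norm p.1 -> S p = p) ->
      continuous (chart_extend S).
    move=> cS Sid.
    have c1 : continuous (fun p : R * (X * R) => chart_extend S p.2).
      apply: (@chart_extend_cont R (fun _ => S) rho) => //.
      by apply: cont_comp cS _; ct.
    have c2 : continuous (fun p : X * R => (0 : R, p)) by ct.
    exact: (cont_comp c1 c2).
  have cFt : continuous (F t).
    have c2 : continuous (fun p : space => (t, p)) by ct.
    exact: (cont_comp cF c2).
  split; first by apply: cont1 cFt _; apply: Fid.
  exists (chart_extend g); split; first exact: cont1.
  + move=> [x z]; rewrite chart_extend_comp.
    have [[u <-]|nx] := pselect (exists u, e u = x); last by rewrite chart_extend_out.
    by rewrite chart_extend_in Fg.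
  + move=> [x z]; rewrite chart_extend_comp.
    have [[u <-]|nx] := pselect (exists u, e u = x); last by rewrite chart_extend_out.
    by rewrite chart_extend_in gF.
- move=> [x z]; have [[u <-]|nx] := pselect (exists u, e u = x); last by rewrite chart_extend_out.
  by rewrite chart_extend_in F0.
- move=> t [x z] /= z1; have [[u <-]|nx] := pselect (exists u, e u = x); last by rewrite chart_extend_out.
  by rewrite chart_extend_in Fs //; right.
- move=> t [x z] /= z1; have [[u <-]|nx] := pselect (exists u, e u = x); last by rewrite chart_extend_out.
  by rewrite chart_extend_in; apply: (compact_isotopy_slab _ cI).
Qed.

Lemma wpull_chart_extend S W : wpull e (chart_extend S @` W) = S @` wpull e W.
Proof.
apply/seteqP; split=> [[u z] [[x y] Wxy]|_ [[u z] Wuz <-]].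
  have [[v vx]|nx] := pselect (exists v, e v = x); last first.
    rewrite chart_extend_out // => -[xu _]; case: nx; by exists u.
  move: Wxy; rewrite -vx chart_extend_in => Wxy [/ei vu yz].
  by exists (v, y) => //; rewrite [S _]surjective_pairing vu yz.
exists (e u, z) => //.
by rewrite chart_extend_in.
Qed.

End ChartExtension.

Section VerticalMove.
Variables (R : realType) (X : topologicalType).
Implicit Types (W : set (X * R)) (D : diagram X).

Lemma presents_at_vertical (F : X * R -> X * R) W D x : homeomorphism F ->
  (forall p, (F p).1 = p.1) ->
  (forall y z z', z < z' -> (F (y, z)).2 < (F (y, z')).2) ->
  presents_at W D x -> presents_at (F @` W) D x.
Proof.
move=> [cF [g [cg Fg gF]]] F1 Fm.
have g1 p : (g p).1 = p.1 by rewrite -{2}(gF p) F1.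
have FE y z : F (y, z) = (y, (F (y, z)).2) by rewrite [LHS]surjective_pairing F1.
have WF y z : (F @` W) (y, (F (y, z)).2) <-> W (y, z).
  rewrite -FE; split=> [[p Wp /(can_inj Fg) <-] //|Wp]; by exists (y, z).
have inv y z : exists z', z = (F (y, z')).2.
  by exists (g (y, z)).2; rewrite -[(y, _)](_ : g (y, z) = _) ?gF // [LHS]surjective_pairing g1.
move=> [h1 h2 h3]; split.
- rewrite h1; split=> -[z].
    by rewrite -WF => h; exists (F (x, z)).2.
  by have [z' ->] := inv x z; rewrite WF => h; exists z'.
- move=> /h2 [z0 z0P]; exists (F (x, z0)).2 => z.
  have [z' ->] := inv x z; rewrite WF z0P; split=> [-> //|E].
  have /(can_inj Fg)[] // : F (x, z') = F (x, z0) by rewrite FE E -FE.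
- move=> /h3 [z1 [z2 [z12 zP n2 n1]]].
  have nearF z (A : X -> Prop) : (\forall p \near (x, z), W p -> A p.1) ->
      \forall p \near (x, (F (x, z)).2), (F @` W) p -> A p.1.
    move=> nA; have : nbhs (x, (F (x, z)).2) [set p | W (g p) -> A (g p).1].
      by apply: (cont_nbhs (A := [set p | W p -> A p.1]) (cg _)); rewrite -FE Fg.
    by apply: filterS => p h [q Wq Fq]; rewrite -g1; apply: h; rewrite -Fq Fg.
  exists (F (x, z1)).2, (F (x, z2)).2; split.
  + exact: Fm.
  + move=> z; have [z' ->] := inv x z; rewrite WF zP.
    split=> [[->|->]|[E|E]]; [by left|by right| |].
      by left; have /(can_inj Fg)[] // : F (x, z') = F (x, z1) by rewrite FE E -FE.
    by right; have /(can_inj Fg)[] // : F (x, z') = F (x, z2) by rewrite FE E -FE.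
  + exact: nearF.
  + by apply: (nearF z1 (fun y => dover D x y -> y = x)).
Qed.

End VerticalMove.

Section Reidemeister.
Variables (R : realType) (X : topologicalType).
Local Notation plane := (R * R)%type.
Local Notation space := ((R * R) * R)%type.
Implicit Types (W : set (X * R)) (D : diagram X) (T : set space).

(** Straight-line interpolation between a height and its match: an increasing map stays increasing
    under convex combination with the identity. [chi] tapers the motion horizontally. *)
Lemma vertical_isotopy (V T : set space) (D : diagram plane) (chi : plane -> R) :
  presents V D -> presents T D -> continuous chi -> (forall u, 0 <= chi u <= 1) ->
  exists Phi : R -> space -> space,
  [/\ slab_isotopy Phi, forall t p, (Phi t p).1 = p.1,
      forall t y z z', z < z' -> (Phi t (y, z)).2 < (Phi t (y, z')).2,
      forall t p, chi p.1 = 0 \/ 1 <= `|p.2| -> Phi t p = p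
    & forall p, chi p.1 = 1 -> (Phi 1 @` V) p <-> T p].
Proof.
move=> VD TD cchi chi01; have [m [cm mi mid mV]] := vertical_matching VD TD.
have t01 (t : R) : 0 <= clamp 0 1 t <= 1 by apply: clamp_in.
have k01 t u : 0 <= clamp 0 1 t * chi u <= 1.
  have /andP[a b] := t01 t; have /andP[c d] := chi01 u.
  by rewrite mulr_ge0 //= mulr_ile1.
have mb u z : `|m u z - z| <= 2.
  have [z1|z1] := lerP 1 `|z|; first by rewrite mid // subrr normr0.
  move: z1; rewrite ltr_norml => /andP[a b]; have := mi u _ _ a; have := mi u _ _ b.
  by rewrite (mid u 1) ?(mid u (-1)) ?normrN ?normr1 // => c d; rewrite ler_norml; lra.
pose f t u z := z + clamp 0 1 t * chi u * (m u z - z).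
have fm t u : {homo f t u : z z' / z < z'}.
  move=> z z' zz; rewrite /f; have := mi u _ _ zz; have := k01 t u.
  move: (clamp 0 1 t * chi u) (m u z) (m u z') => k a b /andP[k0 k1] ab.
  have [->|k2] := eqVneq k 0; first by rewrite !mul0r !addr0.
  have k3 : 0 < k by rewrite lt_neqAle eq_sym k2.
  nra.
have cf : continuous (fun p : R * space => f p.1 p.2.1 p.2.2).
  have c1 : continuous (fun p : R * space => clamp 0 1 p.1) by ct.
  have c2 : continuous (fun p : R * space => chi p.2.1) by apply: cont_comp cchi _; ct.
  have c3 : continuous (fun p : R * space => m p.2.1 p.2.2).
    by apply: (cont_comp cm (g := fun p : R * space => p.2)); ct.
  by rewrite /f; ct.
have fid t u z : chi u = 0 \/ 1 <= `|z| -> f t u z = z.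
  move=> [h|h]; rewrite /f; first by rewrite h // mulr0 mul0r addr0.
  by rewrite mid // subrr mulr0 addr0.
exists (fun t p => (p.1, f t p.1 p.2)); split.
- split.
  + by ct.
  + move=> t; apply: (monotone_homeo (m := f t)) => //.
      have c2 : continuous (fun p : space => (t, p)) by ct.
      exact: (cont_comp cf c2).
    move=> u y; apply: (incr_surj (C := 2)).
      have c2 : continuous (fun z : R => (t, (u, z)) : R * space) by ct.
      exact: (cont_comp cf c2).
    move=> z; rewrite /f addrAC subrr add0r normrM.
    have /andP[a b] := k01 t u; rewrite (ger0_norm a); have := mb u z.
    by have := normr_ge0 (m u z - z); nra.
  + by move=> [u z]; rewrite /f clamp_lo ?ler01 //= !mul0r addr0.
  + by move=> t [u z] /= h; rewrite fid //; right.
  + move=> t [u z] /=; rewrite !ltr_norml => /andP[a b].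
    have := fm t u _ _ a; have := fm t u _ _ b.
    rewrite (fid t u 1) ?(fid t u (-1)) ?normrN ?normr1; [|by right|by right].
    by move=> c d; apply/andP.
- by [].
- by move=> t y z z'; apply: fm.
- by move=> t [u z] /= h; rewrite fid.
- have f1 u z : chi u = 1 -> f 1 u z = m u z.
    by move=> h; rewrite /f h // clamp_hi ?ler01 // !mul1r addrCA subrr addr0.
  move=> [u z] /= ur; split=> [[[v y] Vvy /= [vu fz]]|Tuz].
    by rewrite -fz vu f1 // -mV -vu.
  have [y yz] : exists y, m u y = z.
    apply: (incr_surj (C := 2)); last exact: mb.
    have c2 : continuous (fun z : R => (u, z) : space) by ct.
    exact: (cont_comp cm c2).
  by exists (u, y); [apply/mV; rewrite yz|rewrite /= f1 // yz].
Qed.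

Lemma presents_unique (V T : set space) (D : diagram plane) :
  presents V D -> presents T D -> slab_equiv V T.
Proof.
move=> VD TD; have c1 : continuous (fun _ : plane => 1 : R) by apply: cont_cst.
have [|Phi [sP _ _ _ PT]] := vertical_isotopy VD TD c1; first by move=> _; rewrite ler01 lexx.
by exists Phi => //; apply/seteqP; split=> p /PT; apply.
Qed.

Lemma vertical_normalization (V T : set space) (D : diagram plane) (r : R) :
  presents V D -> presents T D ->
  exists Phi : R -> space -> space,
  [/\ compact_isotopy (r + 1) Phi, forall t p, (Phi t p).1 = p.1,
      forall t y z z', z < z' -> (Phi t (y, z)).2 < (Phi t (y, z')).2
    & forall p, sup_norm p.1 <= r -> (Phi 1 @` V) p <-> T p].
Proof.
move=> VD TD; have rr : r < r + 1 by lra.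
pose chi (u : plane) := cutoff r (r + 1) (sup_norm u).
have s0 (u : plane) : `|sup_norm u| = sup_norm u.
  by rewrite ger0_norm // /sup_norm le_max normr_ge0.
have cchi : continuous chi by apply: cont_cutoff; apply: cont_sup_norm; ct.
have [|Phi [[cP hP P0 _ _] P1 Pm Pid PT]] := vertical_isotopy VD TD cchi.
  by move=> u; apply: cutoff_in.
exists Phi; split=> //.
- split=> // t p [h|h]; apply: Pid; [left|by right].
  by rewrite /chi cutoff0 ?s0.
- by move=> p h; apply: PT; rewrite /chi cutoff1 ?s0.
Qed.

(* Inside the chart, make the link agree with the model tangle [T] over a large
   box by a vertical isotopy tapered off outside it, then apply the isotopy from
   [T] to [T'], which is supported in the box. *)
Lemma reidemeister_step W D D' (e : plane -> X) T T' :
  hausdorff_space X -> open_embedding e -> presents W D -> is_diagram R D' ->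
  tangle_equiv T T' -> presented T (dpull e D) -> presented T' (dpull e D') ->
  (forall x, ~ (e @` @box R) x -> germ_eq R D D' x) ->
  exists2 W', presents W' D' & slab_equiv W W'.
Proof.
move=> hX ee WD dD' [rho [F [cF TT']]] [sT TD] [sT' TD'] off.
have VD := presents_pull (embed_local ee) WD.
have TP : presents T (dpull e D) by split=> //; case: VD.
(* A square strictly larger than both the box of the local pictures and the support of the tangle
   isotopy. *)
pose r := Num.max 3 rho + 1.
have [r3 rr] : 3 < r /\ rho < r.
  by rewrite /r; split; apply: (@le_lt_trans _ _ (Num.max 3 rho)); rewrite ?le_max ?lexx ?orbT //; lra.
have [Phi [cP P1 Pm PT]] := vertical_normalization r VD TP.
pose Phi' t := chart_extend e (Phi t); pose F' t := chart_extend e (F t).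
have sP : slab_isotopy Phi' by apply: chart_extend_isotopy cP.
have sF : slab_isotopy F' by apply: chart_extend_isotopy cF.
exists (F' 1 @` (Phi' 1 @` W)); last first.
  by apply: (@slab_equiv_trans _ _ _ (Phi' 1 @` W)); [exists Phi'|exists F'].
split=> //; first by apply: slab_image => //; apply: slab_image => //; case: WD.
(* Inside this square the new link is the tangle [T'], which presents [D'] in the chart. *)
move=> x; have [[u ur ux]|xn] := pselect ((e @` [set u | sup_norm u < r]) x).
  rewrite -ux; apply/(presents_at_pull (embed_local ee)).
  rewrite !wpull_chart_extend //; apply: presents_at_germ (TD' u).
    by split=> [|_]; apply: filterE.
  have : nbhs u [set v | sup_norm v < r].
    have cs : continuous (@sup_norm R) by apply: cont_sup_norm; ct.
    apply: (cont_nbhs (A := [set y | y < r]) (cs u)).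
    by apply: open_nbhs_nbhs; split; [exact: open_lt|].
  have [_ hF _ Fs] := cF; have [_ [g [_ Fg gF]]] := hF 1.
  apply: filterS => v /= vr z.
  have small p : sup_norm (F 1 p).1 < r -> sup_norm p.1 < r.
    have [h|h _] := lerP rho (sup_norm p.1); last exact: lt_trans rr.
    by rewrite Fs //; left.
  rewrite TT'; split=> -[p hp pv].
    by exists p => //; apply/PT => //; apply: ltW; apply: small; rewrite pv.
  by exists p => //; apply/PT => //; apply: ltW; apply: small; rewrite pv.
have cl : closed (e @` [set u | sup_norm u <= rho]).
  apply: compact_closed => //; apply: continuous_compact; last exact: compact_square.
  by apply: continuous_subspaceT; case: ee.
have xrho : ~ (e @` [set u | sup_norm u <= rho]) x.
  by move=> [u ur ux]; apply: xn; exists u => //; apply: le_lt_trans rr.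
have nx : \forall y \near x, ~ (e @` [set u | sup_norm u <= rho]) y.
  by apply: open_nbhs_nbhs; split=> //; apply: closed_openC.
(* Outside it, the link has only undergone the vertical isotopy, so it still presents [D], and [D]
   and [D'] have the same germ there. *)
apply: (@presents_at_germ _ _ (Phi' 1 @` W) _ D).
- apply: off => -[u [u1 u2] ux]; apply: xn; exists u => //.
  by apply: le_lt_trans r3; rewrite sup_norm_le u1.
- have Fid y z : ~ (e @` [set u | sup_norm u <= rho]) y -> F' 1 (y, z) = (y, z).
    by apply: chart_extend_off => // p h; case: cF => _ _ _; apply; left.
  apply: filterS nx => y yn z; split=> [Wp|[[v w] Wp]].
    by exists (y, z) => //; apply: Fid.
  have [/= vin|vn] := pselect ((e @` [set u | sup_norm u <= rho]) v); last first.
    by rewrite Fid // => -[<- <-].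
  case: vin Wp => a ar <-; rewrite /F' chart_extend_in // => Wp [ay wz]; exfalso.
  apply: yn; exists (F 1 (a, w)).1 => //=.
  rewrite leNgt; apply/negP => h.
  have [_ hF _ Fs] := cF; have [_ [g [_ Fg gF]]] := hF 1.
  have : F 1 (F 1 (a, w)) = F 1 (a, w) by apply: Fs; left; apply: ltW.
  by move=> /(can_inj Fg) aE; move: h; rewrite aE /= ltNge ar.
- have [_ /(_ 1) hP _ _ _] := sP.
  apply: (presents_at_vertical hP); last by case: WD.
  + move=> [y z]; rewrite /Phi'; have [[u <-]|ny] := pselect (exists u, e u = y).
      by rewrite chart_extend_in //= P1.
    by rewrite chart_extend_out.
  + move=> y z z' zz; rewrite /Phi'; have [[u <-]|ny] := pselect (exists u, e u = y).
      by rewrite !chart_extend_in //; apply: Pm.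
    by rewrite !chart_extend_out.
Qed.

End Reidemeister.

Lemma within_cont_comp (X Y Z : topologicalType) (A : set Y) (g : Y -> Z) (h : X -> Y) :
  {within A, continuous g} -> continuous h -> (forall x, A (h x)) ->
  continuous (fun x => g (h x)).
Proof.
move=> /subspace_continuousP cg ch hA; apply: contP => x N gN.
have := cg _ (hA x) _ gN; rewrite /= /within /= => n.
by apply: filterS (cont_nbhs (ch x) n) => y /(_ (hA y)).
Qed.

Section Push.
Variables (R : realType) (X : topologicalType).
Local Notation plane := (R * R)%type.
Implicit Types (D : diagram X) (W : set (X * R)).

Lemma presents_push (h : X -> X) D D' W : homeomorphism h -> deq R D (dpull h D') ->
  is_diagram R D' -> presents W D -> exists2 W', presents W' D' & W = wpull h W'.
Proof.
move=> hh DD dD' WD; have lh := embed_local (homeo_embed hh).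
have [k hk [hK kK]] := homeo_inv hh.
have WE : W = wpull h (wpull k W).
  by apply/seteqP; split=> -[x z] /=; rewrite /wpull /= hK.
exists (wpull k W) => //.
have [[cW sW] _ WP] : presents W (dpull h D').
  by apply: presents_deq DD _ WD; apply: is_diagram_pull.
split=> //; first split.
- have ck : continuous (fun p : X * R => (k p.1, p.2)).
    by case: hk => ck _; apply: cont_pair; [apply: cont_comp ck _|]; ct.
  by apply: closed_comp => // z _; apply: ck.
- by move=> p /sW.
- move=> x; rewrite -(kK x); apply/(presents_at_pull lh).
  by rewrite -WE; apply: WP.
Qed.

Lemma presents_unpush (h : X -> X) D D' W' : homeomorphism h -> deq R D (dpull h D') ->
  is_diagram R D -> presents W' D' -> presents (wpull h W') D.
Proof.
move=> hh DD dD WD; have lh := embed_local (homeo_embed hh).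
by apply: presents_deq_sym DD dD _; apply: presents_pull.
Qed.

(** Pulling back by the final stage of an isotopy gives an equivalent link, through the isotopy
    applied at every height. *)
Lemma slab_equiv_push (F : R -> X -> X) W :
  continuous (fun p : R * X => F p.1 p.2) -> (forall t, homeomorphism (F t)) ->
  (forall x, F 0 x = x) -> slab_equiv (wpull (F 1) W) W.
Proof.
move=> cF hF F0; exists (fun t p => (F t p.1, p.2)).
  split=> //.
  - apply: cont_pair; last by ct.
    by apply: (cont_comp cF (g := fun p : R * (X * R) => (p.1, p.2.1))); ct.
  - move=> t; have [g [cg _] [Fg gF]] := homeo_inv (hF t); have [cFt _] := hF t.
    split; first by apply: cont_pair; [apply: cont_comp cFt _|]; ct.
    exists (fun p => (g p.1, p.2)); split.
    + by apply: cont_pair; [apply: cont_comp cg _|]; ct.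
    + by move=> [x z] /=; rewrite Fg.
    + by move=> [x z] /=; rewrite gF.
  - by move=> [x z]; rewrite F0.
have [g _ [Fg gF]] := homeo_inv (hF 1).
apply/seteqP; split=> [[x z] Wxz|_ [[x z] Wxz <-]] //.
by exists (g x, z); rewrite /wpull /= gF.
Qed.

End Push.

Section Moves.
Variables (R : realType) (X : topologicalType).
Local Notation plane := (R * R)%type.
Implicit Types (D : diagram X) (W : set (X * R)).
Variable f : plane -> X.
Hypotheses (hX : hausdorff_space X) (lf : local_homeo f) (covf : covering f).
Hypothesis sf : forall x, exists p, f p = x.

Let cf : continuous f. Proof. by case: lf. Qed.

Lemma slab_equiv_lift W W' : slab_equiv W W' -> slab_equiv (wpull f W) (wpull f W').
Proof.
move=> [F sF ->]; have [F' sF' FE] := isotopy_lift cf covf sF.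
by exists F'.
Qed.

(** The links are compared in the plane, because a twist need not be isotopic to the identity
    downstairs. All links presenting [D] are allowed, since the diagrams met along the moves need
    not be motifs of weaves. *)
Definition follows D D' := forall W, presents W D ->
  exists2 W', presents W' D' & slab_equiv (wpull f W) (wpull f W').

Lemma follows_homeo (h : X -> X) D D' : homeomorphism h ->
  (forall W, slab_equiv (wpull f (wpull h W)) (wpull f W)) ->
  is_diagram R D -> is_diagram R D' -> deq R D (dpull h D') ->
  follows D D' /\ follows D' D.
Proof.
move=> hh eh dD dD' DD; split=> W WD.
  by have [W' WD' ->] := presents_push hh DD dD' WD; exists W'.
exists (wpull h W); first exact: (presents_unpush hh DD dD WD).
exact: slab_equiv_sym.
Qed.

Lemma follows_isotopy D D' : is_diagram R D -> is_diagram R D' -> isotopy_move R D D' ->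
  follows D D' /\ follows D' D.
Proof.
move=> dD dD' [F [[cF hF F0] DD]].
have c01 (t : R) : 0 <= clamp 0 1 t <= 1 by apply: clamp_in.
have h1 : homeomorphism (F 1) by apply: hF; rewrite ler01 lexx.
apply: (follows_homeo h1) => // W; apply: slab_equiv_lift.
have c1 : clamp 0 1 1 = 1 :> R by rewrite clamp_id ?lexx ?ler01.
(* An ambient isotopy is controlled on [[0, 1]] only; clamping the time extends it to the whole
   line. *)
have := @slab_equiv_push R X (fun t => F (clamp 0 1 t)) W; rewrite c1; apply.
- apply: (within_cont_comp (h := fun p : R * X => (clamp 0 1 p.1, p.2)) cF); first by ct.
  by move=> p; split=> //=; rewrite in_itv /=.
- by move=> t; apply: hF.
- by move=> x; rewrite clamp_id ?F0 // lexx ler01.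
Qed.

Lemma follows_dehn D D' : is_diagram R D -> is_diagram R D' -> dehn_move R D D' ->
  follows D D' /\ follows D' D.
Proof.
move=> dD dD' [h [th DD]].
have [h' hh' [fh' [G [cG hG G0 G1]]]] := dehn_lift lf covf sf th.
have hh : homeomorphism h by case: th => a [_ _ _ []].
apply: (follows_homeo hh) => // W.
have -> : wpull f (wpull h W) = wpull (G 1) (wpull f W).
  by apply/seteqP; split=> -[p z]; rewrite /wpull /= G1 fh'.
exact: slab_equiv_push.
Qed.

Lemma closed_chart_box (e : plane -> X) : open_embedding e -> closed (e @` @box R).
Proof.
move=> [ce _ _]; apply: compact_closed => //; apply: continuous_compact.
  exact: continuous_subspaceT.
rewrite (_ : @box R = [set u | sup_norm u <= 3]); first exact: compact_square.
by apply/seteqP; split=> u /=; rewrite sup_norm_le => /andP.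
Qed.

Lemma follows_reidemeister D D' : is_diagram R D -> is_diagram R D' ->
  reidemeister_move R D D' -> follows D D' /\ follows D' D.
Proof.
move=> dD dD' [e [M [M' [ee MM DM DM' off]]]].
have [T [T' [TT TM TM']]] := model_tangles MM.
have transfer (A : diagram X) N S : deq R (dpull e A) N -> presented S N -> presented S (dpull e A).
  move=> AN [sS SN]; split=> // u; apply: presents_at_germ (SN u).
    by apply: deq_on_germ_sym AN; apply: filterT.
  by apply: filterE.
have nbox x : ~ (e @` @box R) x -> nbhs x (~` (e @` @box R)).
  by move=> xn; apply: open_nbhs_nbhs; split=> //; apply: closed_openC; apply: closed_chart_box.
split=> W WD.
  have [|W' W'D /slab_equiv_lift] := reidemeister_step hX ee WD dD' TT (transfer _ _ _ DM TM)
    (transfer _ _ _ DM' TM'); last by exists W'.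
  by move=> x /nbox xn; apply: deq_on_germ off dD.
have [|W' W'D /slab_equiv_lift] := reidemeister_step hX ee WD dD (tangle_equiv_sym TT)
  (transfer _ _ _ DM' TM') (transfer _ _ _ DM TM); last by exists W'.
by move=> x /nbox xn; apply: deq_on_germ_sym off.
Qed.

Lemma follows_trans D1 D2 D3 : follows D1 D2 -> follows D2 D3 -> follows D1 D3.
Proof.
move=> f12 f23 W /f12 [W' /f23 [W'' WD e2] e1].
by exists W'' => //; apply: slab_equiv_trans e1 e2.
Qed.

(** Both directions are carried along together, so that symmetric steps only exchange them. *)
Lemma follows_related D D' : related_by_moves R D D' -> follows D D' /\ follows D' D.
Proof.
elim=> {D D'} [D D' [dD dD' [m|m|m]]|D|D D' _ []|D1 D2 D3 _ [a b] _ [c d]].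
- exact: follows_reidemeister.
- exact: follows_isotopy.
- exact: follows_dehn.
- by split=> W WD; exists W => //; apply: slab_equiv_refl.
- by [].
- by split; [apply: follows_trans a c|apply: follows_trans d b].
Qed.

End Moves.

(** * From real heights to the thickened plane *)

Section Interval.
Variable R : realType.

Lemma height_cont_val : continuous (fun z : II R => set_val z : R).
Proof. exact: initial_continuous. Qed.

Lemma cont_val (T : topologicalType) (f : T -> II R) : continuous f ->
  continuous (fun t => set_val (f t) : R).
Proof. by move=> cf; apply: cont_comp height_cont_val cf. Qed.

Lemma nbhs_val (z : II R) (N : set (II R)) : nbhs z N ->
  exists2 B : set R, nbhs (set_val z : R) B & forall w : II R, B (set_val w) -> N w.
Proof.
move=> [_ [[B oB <-] Bz] BN]; exists B; last by move=> w Bw; apply: BN.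
by apply: open_nbhs_nbhs.
Qed.

Lemma cont_into_val (T : topologicalType) (f : T -> II R) :
  continuous (fun t => set_val (f t) : R) -> continuous f.
Proof.
move=> cf; apply: contP => t N /nbhs_val [B Bf BN].
by apply: filterS (cont_nbhs (cf t) Bf) => s /BN.
Qed.

Fact to_II_subproof (r : R) : `[(-1 : R), 1]%classic (clamp (-1) 1 r).
Proof. by rewrite /= in_itv /=; apply: clamp_in; lra. Qed.

Definition to_II (r : R) : II R := SigSub (mem_set (to_II_subproof r)).

Lemma to_IIE r : set_val (to_II r) = clamp (-1) 1 r. Proof. by []. Qed.

Lemma val_II (z : II R) : `|set_val z : R| <= 1.
Proof. by have /set_mem := valP z; rewrite /= in_itv /= ler_norml. Qed.

Lemma val_to_II r : `|r| <= 1 -> set_val (to_II r) = r.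
Proof. by rewrite ler_norml to_IIE => h; rewrite clamp_id. Qed.

Lemma II_inj (z w : II R) : (set_val z : R) = set_val w -> z = w.
Proof. exact: val_inj. Qed.

Lemma cont_to_II (T : topologicalType) (f : T -> R) : continuous f ->
  continuous (fun t => to_II (f t)).
Proof. by move=> cf; apply: cont_into_val; change (continuous (fun t => clamp (-1) 1 (f t))); ct. Qed.

End Interval.

Definition unbox (R : realType) (X : Type) (p : X * II R) : X * R := (p.1, set_val p.2).
Definition rebox (R : realType) (X : Type) (p : X * R) : X * II R := (p.1, to_II p.2).
Arguments unbox {R X} p.
Arguments rebox {R X} p.

Section Bar.
Variables (R : realType) (X : topologicalType).
Implicit Types (W : set (X * II R)) (D : diagram X).

Lemma cont_unbox : continuous (@unbox R X).
Proof. by apply: cont_pair; [ct|apply: cont_val; ct]. Qed.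

Lemma cont_rebox : continuous (@rebox R X).
Proof. by apply: cont_pair; [ct|apply: cont_to_II; ct]. Qed.

Lemma unboxK : cancel (@unbox R X) rebox.
Proof. by move=> [x z]; congr (_, _); apply: II_inj; rewrite val_to_II ?val_II. Qed.

Lemma reboxK (p : X * R) : `|p.2| <= 1 -> unbox (rebox p) = p.
Proof. by case: p => x z /= h; congr (_, _); rewrite /= val_to_II. Qed.

Lemma unbox_le (p : X * II R) : `|(unbox p).2| <= 1.
Proof. exact: val_II. Qed.

Lemma unbox_image W x z : (unbox @` W) (x, set_val z) <-> W (x, z).
Proof.
split=> [[[y w] Wyw [yx /II_inj zw]]|Wxz]; last by exists (x, z).
by rewrite -yx -zw.
Qed.

Lemma diagram_presents W D : closed (unbox @` W) ->
  (forall p, W p -> -1 < height p < 1) -> diagram_of W D -> presents (unbox @` W) D.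
Proof.
move=> cW hW [dD DW sD cD]; split=> //.
  by split=> // _ [p /hW hp <-]; rewrite ltr_norml.
have inv x t : (unbox @` W) (x, t) -> exists2 z : II R, t = set_val z & W (x, z).
  by move=> [[y w] Wyw [<- <-]]; exists w.
move=> x; split.
- rewrite DW; split=> [[[y z] Wyz /= yx]|[t /inv [z _ Wxz]]]; last by exists (x, z).
  by exists (set_val z); apply/unbox_image; rewrite -yx.
- move=> /sD [z [Wxz uz]]; exists (set_val z) => t; split=> [/inv [w -> /uz -> //]|->].
  exact/unbox_image.
- move=> /cD [z1 [z2 [z12 zP n2 n1]]].
  have near z (A : X -> Prop) : (\forall p \near (x, z), W p -> A p.1) ->
      \forall p \near (x, set_val z : R), (unbox @` W) p -> A p.1.
    move=> [[U N] /= [Ux /nbhs_val [B Bz BN]] UN].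
    exists (U, B) => //= -[y t] [/= Uy Bt] /inv [w tw Wyw].
    by apply: (UN (y, w)) => //; split=> //=; apply: BN; rewrite -tw.
  exists (set_val z1), (set_val z2); split=> //.
  + move=> t; split=> [/inv [w -> /zP [->|->]]|[->|->]]; [by left|by right| |];
      by apply/unbox_image/zP; first [by left|by right].
  + exact: near.
  + exact: (near z1 (fun y => dover D x y -> y = x)).
Qed.

Lemma slab_equiv_box W W' : slab_equiv (unbox @` W) (unbox @` W') ->
  exists F : R -> X * II R -> X * II R, ambient_isotopy F /\ F 1 @` W = W'.
Proof.
move=> [F [cF hF F0 Fh Fs] WE].
(* The boundary heights are fixed and interior heights stay interior, so reading the isotopy through
   the clamp of [rebox] loses nothing. *)
have Fle t p : `|p.2| <= 1 -> `|(F t p).2| <= 1.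
  by rewrite le_eqVlt => /orP[/eqP p1|/(Fs t) /ltW //]; rewrite Fh p1.
exists (fun t p => rebox (F t (unbox p))); split; last first.
  apply/seteqP; split.
    move=> _ [p Wp <-]; have : (unbox @` W') (F 1 (unbox p)).
      by rewrite WE; exists (unbox p) => //; exists p.
    by move=> [q Wq <-]; rewrite unboxK.
  move=> q Wq; have : (unbox @` W') (unbox q) by exists q.
  by rewrite WE => -[_ [p Wp <-] pq]; exists p => //; rewrite pq unboxK.
split.
- apply: continuous_subspaceT; apply: cont_comp cont_rebox _.
  apply: (cont_comp cF (g := fun p : R * (X * II R) => (p.1, unbox p.2))).
  by apply: cont_pair; [ct|apply: cont_comp cont_unbox _; ct].
- move=> t _; have [cFt [g [cg Fg gF]]] := hF t.
  have gle p : `|p.2| <= 1 -> `|(g p).2| <= 1.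
    rewrite -{1}(gF p) leNgt => h; rewrite leNgt; apply: contra h => h.
    by rewrite Fh // ltW.
  have cc (S : X * R -> X * R) : continuous S -> continuous (fun p => rebox (S (unbox p))).
    by move=> cS; apply: cont_comp cont_rebox _; apply: cont_comp cS cont_unbox.
  split; first exact: cc.
  exists (fun p => rebox (g (unbox p))); split; first exact: cc.
  + by move=> p; rewrite reboxK ?Fg ?unboxK // Fle // unbox_le.
  + by move=> p; rewrite reboxK ?gF ?unboxK // gle // unbox_le.
- by apply/funext => p; rewrite F0 unboxK.
Qed.

Lemma hausdorff_slab : hausdorff_space X -> hausdorff_space (X * R)%type.
Proof.
move=> hX p q pq; rewrite [p]surjective_pairing [q]surjective_pairing.
have cf (r : X * R) : {for r, continuous (@fst X R)} by exact: cvg_fst.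
have cs (r : X * R) : {for r, continuous (@snd X R)} by exact: cvg_snd.
have e1 : p.1 = q.1.
  have c1 : cluster (nbhs p.1) q.1.
    move=> A B pA qB; have [[x z] [Ax Bx]] := pq _ _ (cont_nbhs (cf p) pA) (cont_nbhs (cf q) qB).
    by exists x.
  exact: hX c1.
have e2 : p.2 = q.2.
  have c2 : cluster (nbhs p.2) q.2.
    move=> A B pA qB; have [[x z] [Ax Bx]] := pq _ _ (cont_nbhs (cs p) pA) (cont_nbhs (cs q) qB).
    by exists z.
  exact: Rhausdorff c2.
by rewrite e1 e2.
Qed.

Lemma link_closed (m : nat) (c : 'I_m -> R -> X * II R) : hausdorff_space X ->
  link c -> closed (unbox @` (\bigcup_i range (c i))).
Proof.
move=> hX [cc ceq _].
have -> : unbox @` (\bigcup_i range (c i)) =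
    \bigcup_(i in [set: 'I_m]) ((fun t => unbox (c i t)) @` `[0, 1]%classic).
  apply/seteqP; split=> [_ [_ [i _ [t _ <-]] <-]|_ [i _ [t _ <-]]]; last first.
    by exists (c i t) => //; exists i.
  (* By periodicity the component is the image of the compact interval [[0, 1]]. *)
  exists i => //; exists (t - (Num.floor t)%:~R).
    have := floor_le_tmp t; have := floorD1_gt t.
    rewrite /= in_itv /= intrD; move=> *; apply/andP; split; lra.
  congr unbox; apply/ceq; split=> //; exists (- Num.floor t).
  by rewrite mulrNz.
apply: closed_bigcup; first exact: finite_finset.
move=> i _; apply: compact_closed; first exact: hausdorff_slab.
apply: continuous_compact; last exact: segment_compact.
apply: continuous_subspaceT; apply: cont_comp cont_unbox _.
by case: (cc i).
Qed.

End Bar.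

Section Weave.
Variable R : realType.
Local Notation plane := (R * R)%type.
Implicit Types (Winf : set (plane * II R)) (Dinf : diagram plane) (L : set 'M[R]_3).

Lemma weave_presents L (W : set (surface L * II R)) (D : diagram (surface L)) :
  lattice L -> weave_link W -> diagram_of W D -> presents (unbox @` W) D.
Proof.
move=> lat [m [c [lc WE _ _ _]]] WD; rewrite WE in WD *.
apply: diagram_presents WD; first by apply: link_closed lc; apply: surface_hausdorff.
by move=> _ [i _ [t _ <-]]; case: lc => _ _; apply.
Qed.

Lemma unbox_cover L (W : set (surface L * II R)) :
  unbox @` (cover3 L @^-1` W) = wpull (Defs.cover L) (unbox @` W).
Proof.
apply/seteqP; split=> [_ [[p z] Wpz <-]|[p z] [[x w] Wxw [xp wz]]].
  by exists (cover3 L (p, z)).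
by exists (p, w); [rewrite /= /cover3 /= -xp|rewrite /unbox /= wz].
Qed.

Lemma weaving_diagram_presents Winf Dinf : weaving_diagram Winf Dinf ->
  presents (unbox @` Winf) Dinf.
Proof.
move=> [L [W [D [lat lW -> WD [dD qD]]]]]; rewrite unbox_cover.
apply: presents_deq_sym qD dD _; apply: presents_pull; first exact: cover_local.
exact: weave_presents.
Qed.

End Weave.

Theorem theorem2p8 (R : realType)
    (Winf1 Winf2 : set (hplane R * II R))
    (Dinf1 Dinf2 : diagram (hplane R))
    (L1 L2 : set 'M[R]_3)
    (DW1 : diagram (surface L1)) (DW2 : diagram (surface L2)) :
  weaving_diagram Winf1 Dinf1 ->
  weaving_diagram Winf2 Dinf2 ->
  lattice L1 -> lattice L2 ->
  lattice_sub L1 L2 -> L1 <> L2 ->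
  quotient_diagram Dinf1 DW1 -> weaving_motif DW1 ->
  quotient_diagram Dinf2 DW2 -> weaving_motif DW2 ->
  (exists DW1' : diagram (surface L2),
      scale_equivalent_via Dinf1 DW1 DW1' /\ related_by_moves R DW1' DW2) ->
  weave_equivalent Winf1 Winf2.
Proof.
move=> w1 w2 _ lat _ _ _ _ q2 _ [DW1' [[[W0 lW0 WD0] _ _ q1] moves]].
have P1 := weaving_diagram_presents w1; have P2 := weaving_diagram_presents w2.
have [_ dD1 _] := P1; have [_ dD2 _] := P2.
have lc := cover_local lat.
have motif (W : set (surface L2 * R)) D (Dinf : diagram (hplane R)) :
    presents W D -> is_diagram R Dinf -> quotient_diagram Dinf D ->
    presents (wpull (Defs.cover L2) W) Dinf.
  by move=> WD dD qD; apply: presents_deq_sym qD dD _; apply: presents_pull.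
have V0 := weave_presents lat lW0 WD0.
have [follow _] := follows_related (surface_hausdorff lat) lc (cover_covering lat)
  (@cover_surj R L2) moves.
have [W' V' e] := follow _ V0.
(* By [q1] the lift of [W0] has diagram [Dinf1], like [Winf1]; by [q2] the lift of [W'] has diagram
   [Dinf2], like [Winf2]. Vertical isotopies in the plane close both ends, and [e] joins the two
   lifts. *)
apply: slab_equiv_box; apply: slab_equiv_trans (presents_unique P1 (motif _ _ _ V0 dD1 q1)) _.
exact: slab_equiv_trans e (presents_unique (motif _ _ _ V' dD2 q2) P2).
Qed.
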